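(* Under the setting, assumptions and algorithm MVTS-DN described in the context, for any $0<\epsilon<\tfrac12$ and $0<\delta<1$ (with $T$ sufficiently large), with probability at least $1-\delta$ the total regret satisfies $$\sum_{t=1}^{T}\Delta_{a(t)}(t)=O\Big(\big(1+\rho+\tfrac1\rho\big)\,d\ln T\,\ln\tfrac{K}{\delta}\sqrt{dKT^{1+2\epsilon}\ln\tfrac{K}{\delta}\cdot\tfrac1\epsilon}\Big),$$ where the constant in $O(\cdot)$ depends only on $R$.
   Context: Contextual bandit, disjoint model: there are $K$ arms and $T$ rounds. At each round $t$, contexts $x_i(t)\in\mathbb{R}^d$, $i\in[K]$, are revealed (possibly chosen adversarially); the decision maker pulls arm $a(t)$ and observes $r_{a(t)}(t)$. Conditionally on the past and the arm choice, the reward of arm $i$ has mean $x_i(t)^{\top}\mu_i$ and variance $\sigma_i^2$, with unknown fixed $\mu_i\in\mathbb{R}^d$, $\sigma_i^2>0$. Assumptions: (i) $\eta_i(t):=r_i(t)-x_i(t)^{\top}\mu_i$ is conditionally $R$-sub-Gaussian; (ii) $\eta_i(t)^2-\sigma_i^2$ is conditionally $R$-sub-Gaussian; (iii) $\|x_i(t)\|\le1$, $\|\mu_i\|\le1$, $|x_i(t)^{\top}\mu_i-x_j(t)^{\top}\mu_j|\le1$, $|\sigma_i^2-\sigma_j^2|\le1$ for all $i\ne j$ and all $t$. Risk tolerance $\rho\in(0,\infty)$. Mean-variance of arm $i$ at round $t$: $\mathrm{MV}_i(t)=x_i(t)^{\top}\mu_i-\rho\sigma_i^2$; $a^*(t)=\arg\max_i\mathrm{MV}_i(t)$;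 $\Delta_i(t)=\mathrm{MV}_{a^*(t)}(t)-\mathrm{MV}_i(t)$. Algorithm MVTS-DN: at round $0$ each arm is pulled once. Let $T_i(t)$ be the set of rounds among $0,\dots,t-1$ at which arm $i$ was pulled, $A_i(t)=\mathbf{I}_d+\sum_{s\in T_i(t)}x_i(s)x_i(s)^{\top}$, $b_i(t)=\sum_{s\in T_i(t)}x_i(s)r_i(s)$, $C_i(t)=\tfrac12|T_i(t)|$, $D_i(t)=\tfrac12\big[\sum_{s\in T_i(t)}r_i(s)^2-b_i(t)^{\top}A_i(t)^{-1}b_i(t)\big]$. Set $v=R\sqrt{\tfrac4\epsilon d\ln\tfrac{4K}{\delta}}$ and $u=8R^2d\ln\tfrac{4K}{\delta}\sqrt{1/\epsilon}$. At each round $t=1,\dots,T$, for each arm $i$ independently sample $\tilde\sigma_i^2(t)\sim\mathcal{N}\big(D_i(t)/C_i(t),\,u^2/|T_i(t)|\big)$ and $\tilde\mu_i(t)\sim\mathcal{N}\big(A_i(t)^{-1}b_i(t),\,v^2A_i(t)^{-1}\big)$, then pull $a(t)=\arg\max_i\big(x_i(t)^{\top}\tilde\mu_i(t)-\rho\tilde\sigma_i^2(t)\big)$ (ties broken arbitrarily) and update the statistics with the observed reward. *)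

(* Defs.v *)
From HB Require Import structures.
From mathcomp Require Import all_boot all_order all_algebra.
From mathcomp Require Import all_classical all_reals all_analysis.
From mathcomp Require Import normal_distribution.

Set Implicit Arguments.
Unset Strict Implicit.
Unset Printing Implicit Defensive.

Import Order.TTheory GRing.Theory Num.Theory.
Import numFieldNormedType.Exports.

Local Open Scope classical_set_scope.
Local Open Scope ring_scope.

Definition dotv {R : comNzRingType} {d : nat} (x y : 'cV[R]_d) : R :=
  \sum_(k < d) x k 0 * y k 0.

Definition sqnorm {R : comNzRingType} {d : nat} (x : 'cV[R]_d) : R := dotv x x.

(*   x t i w : context of arm i at round t (column vector)             *)
(*   r t i w : reward of arm i at round t                              *)
(*   a t w   : arm pulled at round t >= 1                              *)
(* At round 0 every arm is pulled once, so arm i is pulled at round s  *)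
(* iff s = 0 or a s = i.                                               *)

Section Stats.
Context {R : realType} {Omega : Type} {d K : nat}.
Variables (x : nat -> 'I_K -> Omega -> 'cV[R]_d) (r : nat -> 'I_K -> Omega -> R)
          (a : nat -> Omega -> 'I_K).

Definition pulled (i : 'I_K) (s : nat) (w : Omega) : bool :=
  (s == 0)%N || (a s w == i).

Definition Tcount (i : 'I_K) (t : nat) (w : Omega) : nat :=
  (\sum_(0 <= s < t | pulled i s w) 1)%N.

Definition Amat (i : 'I_K) (t : nat) (w : Omega) : 'M[R]_d :=
  1%:M + \sum_(0 <= s < t | pulled i s w) (x s i w *m (x s i w)^T).

Definition bvec (i : 'I_K) (t : nat) (w : Omega) : 'cV[R]_d :=
  \sum_(0 <= s < t | pulled i s w) (r s i w *: x s i w).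

Definition Cstat (i : 'I_K) (t : nat) (w : Omega) : R := (Tcount i t w)%:R / 2.

Definition Dstat (i : 'I_K) (t : nat) (w : Omega) : R :=
  ((\sum_(0 <= s < t | pulled i s w) r s i w ^+ 2)
   - ((bvec i t w)^T *m invmx (Amat i t w) *m bvec i t w) 0 0) / 2.

End Stats.

Definition vpar {R : realType} (Rsg eps delta : R) (d K : nat) : R :=
  Rsg * Num.sqrt (4 / eps * d%:R * ln (4 * K%:R / delta)).
Definition upar {R : realType} (Rsg eps delta : R) (d K : nat) : R :=
  8 * Rsg ^+ 2 * d%:R * ln (4 * K%:R / delta) * Num.sqrt (1 / eps).

Definition MV {R : realType} {Omega : Type} {d K : nat}
  (x : nat -> 'I_K -> Omega -> 'cV[R]_d) (mu : 'I_K -> 'cV[R]_d) (s2 : 'I_K -> R)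
  (rho : R) (i : 'I_K) (t : nat) (w : Omega) : R :=
  dotv (x t i w) (mu i) - rho * s2 i.

(* Delta_j(t) = MV_{a*(t)}(t) - MV_j(t) = max_i (MV_i(t) - MV_j(t))
   (the term i = j is 0, so the initial value 0 of the max is harmless) *)
Definition Delta {R : realType} {Omega : Type} {d K : nat}
  (x : nat -> 'I_K -> Omega -> 'cV[R]_d) (mu : 'I_K -> 'cV[R]_d) (s2 : 'I_K -> R)
  (rho : R) (j : 'I_K) (t : nat) (w : Omega) : R :=
  \big[Num.max/0]_(i < K) (MV x mu s2 rho i t w - MV x mu s2 rho j t w).

Definition regret {R : realType} {Omega : Type} {d K : nat}
  (x : nat -> 'I_K -> Omega -> 'cV[R]_d) (mu : 'I_K -> 'cV[R]_d) (s2 : 'I_K -> R)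
  (rho : R) (a : nat -> Omega -> 'I_K) (T : nat) (w : Omega) : R :=
  \sum_(1 <= t < T.+1) Delta x mu s2 rho (a t w) t w.

Definition Fmeas {R : realType} {Omega : Type} (G : set (set Omega)) (f : Omega -> R) :=
  forall B : set R, measurable B -> G (f @^-1` B).

(* Conditional R-sub-Gaussianity given the sigma-algebra generated by G
   (G a generating family closed enough; here used with the families
   below), stated without conditional expectations:
   E[exp(l eta) 1_B] <= exp(l^2 c^2 / 2) P(B) for all B in G, all l.
   This is equivalent to E[exp(l eta) | sigma(G)] <= exp(l^2 c^2/2) a.s.
   whenever the sets of sigma(G) are finite disjoint unions of sets of G. *)
Definition cond_subG {R : realType} {dO : measure_display} {Omega : measurableType dO}
  (P : probability Omega R) (G : set (set Omega)) (c : R) (eta : Omega -> R) :=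
  forall B, G B -> forall l : R,
    (\int[P]_(w in B) (expR (l * eta w))%:E <= (expR (l ^+ 2 * c ^+ 2 / 2))%:E * P B)%E.

(* Sets generating "the past and the arm choice" at round t:
   A in F t, and (for t >= 1) A intersected with {a(t) = j}. *)
Definition condsets {Omega : Type} {K : nat} (F : nat -> set (set Omega))
  (a : nat -> Omega -> 'I_K) (t : nat) : set (set Omega) :=
  [set B | exists2 A, F t A &
     (B = A \/ ((0 < t)%N /\ exists j : 'I_K, B = A `&` [set w | a t w = j]))].

(*   F t      : information available when choosing the arm at round t *)
(*              (history up to t-1 and the contexts of round t)         *)
(*   Z t i, xi t i : the standard Gaussian randomness used at round t   *)
(*   L t i    : a (F t-measurable) square root of A_i(t)^{-1}, so that  *)
(*              mu~ = A^{-1} b + v L Z ~ N(A^{-1}b, v^2 A^{-1}),        *)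
(*              sigma~^2 = D/C + (u/sqrt|T_i|) xi ~ N(D/C, u^2/|T_i|).   *)

Definition mu_tilde {R : realType} {Omega : Type} {d K : nat}
  (x : nat -> 'I_K -> Omega -> 'cV[R]_d) (r : nat -> 'I_K -> Omega -> R)
  (a : nat -> Omega -> 'I_K) (Z : nat -> 'I_K -> Omega -> 'cV[R]_d)
  (L : nat -> 'I_K -> Omega -> 'M[R]_d) (v : R) (t : nat) (i : 'I_K) (w : Omega)
  : 'cV[R]_d :=
  invmx (Amat x a i t w) *m bvec x r a i t w + v *: (L t i w *m Z t i w).

Definition sig_tilde {R : realType} {Omega : Type} {d K : nat}
  (x : nat -> 'I_K -> Omega -> 'cV[R]_d) (r : nat -> 'I_K -> Omega -> R)
  (a : nat -> Omega -> 'I_K) (xi : nat -> 'I_K -> Omega -> R) (u : R)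
  (t : nat) (i : 'I_K) (w : Omega) : R :=
  Dstat x r a i t w / @Cstat R Omega K a i t w
  + (u / Num.sqrt (Tcount a i t w)%:R) * xi t i w.

Definition mvts_dn_setting {R : realType} {dO : measure_display}
  {Omega : measurableType dO} (P : probability Omega R) {d K : nat}
  (Rsg rho eps delta : R)
  (F : nat -> set (set Omega))
  (x : nat -> 'I_K -> Omega -> 'cV[R]_d) (r : nat -> 'I_K -> Omega -> R)
  (mu : 'I_K -> 'cV[R]_d) (s2 : 'I_K -> R) (a : nat -> Omega -> 'I_K)
  (Z : nat -> 'I_K -> Omega -> 'cV[R]_d) (xi : nat -> 'I_K -> Omega -> R)
  (L : nat -> 'I_K -> Omega -> 'M[R]_d) : Prop :=
  let v := vpar Rsg eps delta d K in
  let u := upar Rsg eps delta d K in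
  let eta t i w := r t i w - dotv (x t i w) (mu i) in
  let score t i w := dotv (x t i w) (mu_tilde x r a Z L v t i w)
                     - rho * sig_tilde x r a xi u t i w in
  (forall t, sigma_algebra [set: Omega] (F t)) /\
  (forall t, F t `<=` measurable) /\
  (forall t, F t `<=` F t.+1) /\
  (* contexts of round t are known at round t (possibly adversarial) *)
  (forall t i (k : 'I_d), Fmeas (F t) (fun w => x t i w k 0)) /\
  (forall t i, measurable_fun [set: Omega] (r t i)) /\
  (* round 0: every arm pulled once, rewards observed *)
  (forall i, Fmeas (F 1) (r 0 i)) /\
  (forall t, (0 < t)%N -> forall j : 'I_K, F t.+1 [set w | a t w = j]) /\
  (forall t, (0 < t)%N -> Fmeas (F t.+1) (fun w => r t (a t w) w)) /\
  (forall t i (k l : 'I_d), Fmeas (F t) (fun w => L t i w k l)) /\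
  (forall t i w, L t i w *m (L t i w)^T = invmx (Amat x a i t w)) /\
  (forall t i (k : 'I_d), measurable_fun [set: Omega] (fun w => Z t i w k 0)) /\
  (forall t i, measurable_fun [set: Omega] (xi t i)) /\
  (forall t, (0 < t)%N -> forall A, F t A ->
     forall (B : 'I_K -> 'I_d -> set R) (C : 'I_K -> set R),
       (forall i k, measurable (B i k)) -> (forall i, measurable (C i)) ->
       P (A `&` [set w | forall i : 'I_K,
                          (forall k : 'I_d, B i k (Z t i w k 0)) /\ C i (xi t i w)])
       = (P A * \prod_(i < K) ((\prod_(k < d) normal_prob 0 1 (B i k))
                               * normal_prob 0 1 (C i)))%E) /\
  (forall t, (0 < t)%N -> forall w (i : 'I_K), score t i w <= score t (a t w) w) /\
  (forall t i, cond_subG P (condsets F a t) Rsg (eta t i)) /\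
  (forall t i, cond_subG P (condsets F a t) Rsg (fun w => eta t i w ^+ 2 - s2 i)) /\
  (forall i, 0 < s2 i) /\
  (forall t i w, sqnorm (x t i w) <= 1) /\
  (forall i, sqnorm (mu i) <= 1) /\
  (forall t (i j : 'I_K) w, i != j ->
     `|dotv (x t i w) (mu i) - dotv (x t j w) (mu j)| <= 1) /\
  (forall i j : 'I_K, i != j -> `|s2 i - s2 j| <= 1).

(* Main.v *)
(* Fix an arm, let [A] be its Gram matrix and [S] the noise-weighted sum of its contexts.
   Averaging the sub-Gaussian exponential over a one-dimensional Gaussian tilt shows that
   [exp (Q / 2 R^2) / sqrt (det A)] is a supermartingale, where [Q] is the quadratic form of
   [A^-1] at [S]; the ridge regularisation adds at most [|mu| <= 1] to the error. Ville's
   inequality bounds [Q] for all rounds at once, and likewise the centred sums of squared noise,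
   with tilts over dyadic scales. Hence posterior means lie within a width [w_i(t)] of the truth.
   Given the past, the Gaussian draws of round [t] fall with probability at least [popt] into a
   box on which the optimal arm is optimistic, and then the arm pulled is unsaturated (its
   gap is at most its width). On the other hand the gap of the arm pulled is always at most its
   width plus twice the smallest width of an unsaturated arm. The expected sum of these smallest widths is at most
   [wtot / popt], where [wtot] bounds the sum of the widths of the pulled arms (elliptical
   potential), and Markov's inequality turns this into a high-probability regret bound.
   The choice of [v] makes [1 / popt] of order [T^(eps/2)] up to subpolynomial factors, so the
   bound is of order [T^(1/2 + 3 eps/4)]. As [T] may be taken large depending on all the
   parameters, the constant can be taken to be 1. *)
Require Import Defs.
From HB Require Import structures.
From mathcomp Require Import all_boot all_order all_algebra.
From mathcomp Require Import all_classical all_reals all_analysis.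
From mathcomp Require Import normal_distribution measurable_realfun.
From mathcomp Require Import ring lra.

Import Order.TTheory GRing.Theory Num.Theory.
Import numFieldNormedType.Exports.

Local Open Scope classical_set_scope.
Local Open Scope ring_scope.

Set Implicit Arguments.
Unset Strict Implicit.
Unset Printing Implicit Defensive.

(** * Weighted integral comparison *)

(** Conditioning is expressed by integral inequalities over the sets of [F t]. A predictable
    coefficient or a random box must therefore be reduced to countably many fixed ones; rounding
    with [Num.floor] does this throughout. The delicate quantity is [1 / popt], essentially the
    exponential of [cQ^2 + cX^2], where [cQ] and [cX] are confidence radii divided by the sampling
    scales [v] and [u], neither of which depends on [T]. The radius of the mean has a square of
    order [ln T], and the factor [1 / eps] in [v^2] turns this into a small power of [T]. For the
    variance a radius of order [ln T] would be fatal, since it would give the exponential of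
    [(ln T)^2]. Two facts prevent it: dyadic scales, in place of a union bound over rounds, leave a
    radius of order [ln ln T]; and the quadratic form in the residual of the regression has the
    favourable sign, so it is absent from the side that optimism uses. The other arms are only
    truncated, at a cost exponential in [d K] but free of [T]. *)

Lemma ge0_le_integral_partition {dO : measure_display} {Omega : measurableType dO}
    {R : realType} (mu : {measure set Omega -> \bar R}) (I : countType) (c : Omega -> I)
    (D : set Omega) (f g : Omega -> \bar R) :
  measurable D -> (forall j, measurable (c @^-1` [set j])) ->
  measurable_fun D f -> measurable_fun D g ->
  (forall w, D w -> (0 <= f w)%E) -> (forall w, D w -> (0 <= g w)%E) ->
  (forall j, \int[mu]_(w in D `&` c @^-1` [set j]) f w <=
             \int[mu]_(w in D `&` c @^-1` [set j]) g w)%E ->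
  (\int[mu]_(w in D) f w <= \int[mu]_(w in D) g w)%E.
Proof.
move=> mD mc mf mg f0 g0 fg.
(* Cells are numbered by their [pickle] codes; a number that codes no cell gives the empty set, and
   countable additivity turns both integrals into series. *)
pose E (n : nat) := D `&` [set w | pickle (c w) = n].
have EE n : E n = if unpickle n is Some j then
    if pickle j == n then D `&` c @^-1` [set j] else set0 else set0.
  rewrite /E; case en: (unpickle n) => [j|].
    case: eqP => jn; apply/seteqP; split=> w //=.
    - by move=> [Dw cn]; split=> //; apply: (pcan_inj pickleK); rewrite cn.
    - by move=> [Dw ->].
    - by move=> [Dw cn]; move: en; rewrite -cn pickleK => -[cj]; rewrite -cj cn in jn.
  apply/seteqP; split=> w //= -[Dw cn].
  by move: en; rewrite -cn pickleK.
have mE n : measurable (E n).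
  rewrite EE; case: (unpickle n) => // j; case: ifP => // _.
  exact: measurableI.
have tE : trivIset setT E.
  by move=> i j _ _ [w [[_ <-] [_ <-]]].
have DE : D = \bigcup_n E n.
  by apply/seteqP; split=> [w Dw|w [n _ []]//]; exists (pickle (c w)).
rewrite DE !ge0_integral_bigcup -?DE//.
apply: lee_nneseries => n *.
  by apply: integral_ge0 => w [Dw _]; exact: f0.
rewrite EE; case: (unpickle n) => [j|]; last by rewrite !integral_set0.
by case: ifP => _; rewrite ?integral_set0.
Qed.

Lemma measurable_sub_sigma {dO : measure_display} {Omega : measurableType dO}
    {d' : measure_display} {Y : measurableType d'}
    (G : set (set Omega)) (f : Omega -> Y) : G `<=` measurable ->
  measurable_fun [set: g_sigma_algebraType G] f -> measurable_fun [set: Omega] f.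
Proof.
move=> Gm mf _ B mB; rewrite setTI.
have := mf measurableT B mB; rewrite setTI.
suff: <<s G >> `<=` (measurable : set (set Omega)) by apply.
by apply: smallest_sub => //; exact: sigma_algebra_measurable.
Qed.

Lemma sigma_in {Omega : pointedType} (G : set (set Omega)) (A : set Omega) :
  sigma_algebra [set: Omega] G ->
  measurable (A : set (g_sigma_algebraType G)) -> G A.
Proof. by move=> sG; rewrite /measurable/= sigma_algebra_id. Qed.

Lemma FmeasP {R : realType} {Omega : pointedType} (G : set (set Omega)) (f : Omega -> R) :
  sigma_algebra [set: Omega] G ->
  Fmeas G f <-> measurable_fun [set: g_sigma_algebraType G] f.
Proof.
move=> sG; split => mf.
  by move=> _ B mB; rewrite setTI; apply: sub_sigma_algebra; exact: mf.
move=> B mB; have := mf measurableT B mB.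
by rewrite setTI; exact: sigma_in.
Qed.

Lemma measurable_funVr {d : measure_display} {T : measurableType d} {R : realType}
    (D : set T) (f : T -> R) :
  measurable_fun D f -> measurable_fun D (fun w => (f w)^-1).
Proof.
move=> mf.
(* Both sides vanish at a zero of [f], so the inverse is everywhere a combination of measurable
   maps. *)
have -> : (fun w => (f w)^-1) = (fun w => f w * expR (- ln (f w ^+ 2))).
  apply/funext => w; have [->|f0] := eqVneq (f w) 0; first by rewrite invr0 mul0r.
  rewrite expRN lnK ?posrE ?exprn_even_gt0//.
  by rewrite expr2 invfM mulrA divff// mul1r.
apply: measurable_funM => //.
apply: measurableT_comp => //; apply: measurableT_comp => //.
by apply: measurableT_comp => //; exact: measurable_funX.
Qed.

Lemma measurable_sqrtr {R : realType} : measurable_fun [set: R] (@Num.sqrt R).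
Proof. by apply: continuous_measurable_fun; exact: sqrt_continuous. Qed.

Lemma measurable_preimage_floor {d : measure_display} {T : measurableType d}
    {R : realType} (f : T -> R) (j : int) : measurable_fun setT f ->
  measurable ((fun w => Num.floor (f w)) @^-1` [set j]).
Proof.
move=> mf; have -> : (fun w => Num.floor (f w)) @^-1` [set j] =
    f @^-1` `[j%:~R, (j + 1)%:~R[%classic.
  apply/seteqP; split=> w /=; rewrite in_itv/=.
    by move=> <-; rewrite floor_le floorD1_gt.
  by move=> h; apply: floor_def.
by rewrite -[_ @^-1` _]setTI; apply: mf.
Qed.

Section Weights.
Context {dO : measure_display} {Omega : measurableType dO} {R : realType}.
Variables (P : {measure set Omega -> \bar R}) (G : set (set Omega)).
Hypothesis Gm : G `<=` measurable.
Hypothesis sG : sigma_algebra [set: Omega] G.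

(** This plays the role of a conditional expectation: [f] is at most [g] on average given [G], and a
    weight known to [G] may be inserted. On a cell where [W] lies between [j h] and [(j + 1) h] the
    weight is replaced by the constant [(j + 1) h], which exceeds [W] by at most [h]. *)
Lemma le_integral_weight (D : set Omega) (f g W : Omega -> R) :
  measurable D -> measurable_fun setT f -> measurable_fun setT g ->
  (forall w, 0 <= f w) -> (forall w, 0 <= g w) ->
  (\int[P]_(w in D) (g w)%:E < +oo)%E ->
  (forall B, G B -> \int[P]_(w in B `&` D) (f w)%:E <= \int[P]_(w in B `&` D) (g w)%:E)%E ->
  measurable_fun [set: g_sigma_algebraType G] W -> (forall w, 0 <= W w) ->
  (\int[P]_(w in D) (W w * f w)%:E <= \int[P]_(w in D) (W w * g w)%:E)%E.
Proof.
move=> mD mf mg f0 g0 gfin fg mW W0.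
have mW' := measurable_sub_sigma Gm mW.
apply/lee_addgt0Pr => e e0.
have [M M0 MI] : exists2 M : R, 0 < M & (\int[P]_(w in D) (g w)%:E <= M%:E)%E.
  have : (0 <= \int[P]_(w in D) (g w)%:E)%E.
    by apply: integral_ge0 => w _; rewrite lee_fin.
  case: (\int[P]_(w in D) (g w)%:E)%E gfin => [r| |]// _ r0.
  exists (r + 1); last by rewrite lee_fin lerDl.
  by rewrite ltr_wpDl.
(* [M] bounds the integral of [g], so this mesh makes the total cost of rounding at most [e]. *)
pose h := e / M; have h0 : 0 < h by rewrite divr_gt0.
apply: (@le_trans _ _ (\int[P]_(w in D) ((W w + h) * g w)%:E)%E); last first.
  under eq_integral do rewrite mulrDl EFinD.
  rewrite ge0_integralD//.
  - apply: leeD => //; under eq_integral do rewrite EFinM.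
    rewrite ge0_integralZl_EFin//; last 3 first.
      by move=> w _; rewrite lee_fin.
      by apply/measurable_EFinP; exact: measurable_funTS.
      exact: ltW.
    apply: le_trans (lee_wpmul2l _ MI) _; first by rewrite lee_fin ltW.
    by rewrite -EFinM /h divfK// gt_eqF.
  - by move=> w _; rewrite lee_fin mulr_ge0.
  - by apply/measurable_EFinP; apply: measurable_funTS; exact: measurable_funM.
  - by move=> w _; rewrite lee_fin mulr_ge0// ltW.
  - by apply/measurable_EFinP; apply: measurable_funTS; exact: measurable_funM.
pose c w := Num.floor (W w / h).
have mWh : measurable_fun [set: g_sigma_algebraType G] (fun w => W w / h).
  by apply: measurable_funM.
have Gc j : G (c @^-1` [set j]) by apply: sigma_in => //; exact: measurable_preimage_floor.
apply: (ge0_le_integral_partition (mu := P) (c := c)).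
- exact: mD.
- by move=> j; exact: Gm.
- by apply/measurable_EFinP; apply: measurable_funTS; exact: measurable_funM.
- apply/measurable_EFinP; apply: measurable_funTS; apply: measurable_funM => //.
  exact: measurable_funD.
- by move=> w _; rewrite lee_fin mulr_ge0.
- by move=> w _; rewrite lee_fin mulr_ge0// addr_ge0// ltW.
move=> j; rewrite setIC.
have mC : measurable (c @^-1` [set j] `&` D) by apply: measurableI => //; exact: Gm.
have [j0|j0] := leP 0 j; last first.
  have -> : c @^-1` [set j] = set0.
    rewrite -subset0 => w /= cj; move: j0; rewrite -cj /c.
    by rewrite ltNge floor_ge0 divr_ge0// ltW.
  by rewrite set0I !integral_set0.
have jh0 : 0 <= (j + 1)%:~R * h by rewrite mulr_ge0 ?ler0z ?addr_ge0// ltW.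
apply: (@le_trans _ _ (\int[P]_(w in c @^-1` [set j] `&` D) (((j + 1)%:~R * h) * f w)%:E)%E).
  apply: ge0_le_integral => //.
  - by move=> w _; rewrite lee_fin mulr_ge0.
  - by apply/measurable_EFinP; apply: measurable_funTS; exact: measurable_funM.
  - by apply/measurable_EFinP; apply: measurable_funTS; exact: measurable_funM.
  - move=> w [/= cj _]; rewrite lee_fin ler_wpM2r//.
    by rewrite -ler_pdivrMr// -cj ltW// floorD1_gt.
apply: (@le_trans _ _ (\int[P]_(w in c @^-1` [set j] `&` D) (((j + 1)%:~R * h) * g w)%:E)%E).
  under eq_integral do rewrite EFinM.
  under [in leRHS]eq_integral do rewrite EFinM.
  rewrite !ge0_integralZl_EFin//.
  - by apply: lee_wpmul2l; [rewrite lee_fin|exact: fg].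
  - by move=> w _; rewrite lee_fin.
  - by apply/measurable_EFinP; exact: measurable_funTS.
  - by move=> w _; rewrite lee_fin.
  - by apply/measurable_EFinP; exact: measurable_funTS.
apply: ge0_le_integral => //.
- by move=> w _; rewrite lee_fin mulr_ge0.
- by apply/measurable_EFinP; apply: measurable_funTS; exact: measurable_funM.
- apply/measurable_EFinP; apply: measurable_funTS; apply: measurable_funM => //.
  exact: measurable_funD.
move=> w [/= cj _]; rewrite lee_fin ler_wpM2r//.
rewrite intrD mulrDl mul1r lerD2r -ler_pdivlMr// -cj floor_le.
by [].
Qed.

End Weights.

(** * Sub-Gaussian noise and Ville's inequality *)

Lemma limn_einf_ub {R : realType} (u : (\bar R)^nat) (C : \bar R) :
  (forall n, u n <= C)%E -> (limn_einf u <= C)%E.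
Proof.
move=> uC; rewrite limn_einf_lim; apply: lime_le; first exact: is_cvg_einfs.
apply: nearW => n; apply: le_trans (uC n).
by apply: ereal_inf_lbound; exists n => /=.
Qed.

Lemma cvg_floor_div {R : realType} (l : R) :
  (fun n => (Num.floor (l * n.+1%:R))%:~R / n.+1%:R) @ \oo --> l.
Proof.
apply: (@squeeze_cvgr _ _ _ _ (fun n => l - n.+1%:R^-1) (cst l)).
- apply: nearW => n; have n0 : 0 < n.+1%:R :> R by [].
  rewrite ler_pdivlMr// mulrBl mulVf ?gt_eqF// ler_pdivrMr// floor_le andbT.
  by rewrite lerBlDr -[X in _ + X](rmorph1 intr) -intrD ltW// floorD1_gt.
- rewrite -[X in _ --> X]subr0; apply: cvgB; first exact: cvg_cst.
  exact: cvg_harmonic.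
- exact: cvg_cst.
Qed.

Section SubGaussian.
Context {dO : measure_display} {Omega : measurableType dO} {R : realType}.
Variables (P : probability Omega R) (G : set (set Omega)).
Hypothesis Gm : G `<=` measurable.
Hypothesis sG : sigma_algebra [set: Omega] G.
Variables (D : set Omega) (eta : Omega -> R) (s : R).
Hypothesis mD : measurable D.
Hypothesis meta : measurable_fun setT eta.
Hypothesis subG : forall B, G B -> forall l : R,
  (\int[P]_(w in B `&` D) (expR (l * eta w))%:E
   <= (expR (l ^+ 2 * s ^+ 2 / 2))%:E * P (B `&` D))%E.

Local Notation Gmeas f := (measurable_fun [set: g_sigma_algebraType G] f).

Let integral_fin1 : (\int[P]_(w in D) (1 : R)%:E < +oo)%E.
Proof.
rewrite integral_cst//= mul1e (le_lt_trans (probability_le1 _ _))//.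
exact: ltry.
Qed.

Let subG1 (B : set Omega) (l : R) : G B ->
  (\int[P]_(w in B `&` D) (expR (l * eta w - l ^+ 2 * s ^+ 2 / 2))%:E
   <= \int[P]_(w in B `&` D) (1 : R)%:E)%E.
Proof.
move=> GB; have mBD : measurable (B `&` D) by apply: measurableI => //; exact: Gm.
rewrite integral_cst//= mul1e.
under eq_integral do rewrite addrC expRD EFinM.
rewrite ge0_integralZl_EFin//; last first.
  by apply/measurable_EFinP; apply: measurable_funTS; apply: measurableT_comp => //; exact: measurable_funM.
apply: le_trans (lee_wpmul2l _ (subG GB l)) _; first by rewrite lee_fin expR_ge0.
by rewrite muleA -EFinM -expRD addNr expR0 mul1e.
Qed.

(** The tilt is rounded down to multiples of [1 / (n + 1)]; on each cell it is constant and
    [le_integral_weight] applies. In this normalised form the bound does not involve the tilt, so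
    Fatou's lemma passes to the limit. [D] is kept apart from [G] because it will carry the event
    that an arm is pulled, which is known only one round later. *)
Lemma subG_weight1 (l W : Omega -> R) : Gmeas l -> Gmeas W -> (forall w, 0 <= W w) ->
  (\int[P]_(w in D) (W w * expR (l w * eta w - l w ^+ 2 * s ^+ 2 / 2))%:E
   <= \int[P]_(w in D) (W w)%:E)%E.
Proof.
move=> ml mW W0.
have ml' := measurable_sub_sigma Gm ml; have mW' := measurable_sub_sigma Gm mW.
pose ln n w := (Num.floor (l w * n.+1%:R))%:~R / n.+1%:R : R.
pose f n w := (W w * expR (ln n w * eta w - ln n w ^+ 2 * s ^+ 2 / 2))%:E.
have mfl n : Gmeas (fun w => l w * n.+1%:R) by exact: measurable_funM.
have mfl' n := measurable_sub_sigma Gm (mfl n).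
have mln n : measurable_fun [set: Omega] (ln n).
  apply: measurable_funM => //.
  apply: (measurable_comp (F := setT) (f := fun x : R => (Num.floor x)%:~R : R)) => //.
  by apply: nondecreasing_measurable => // x y xy; rewrite ler_int le_floor.
have mf n : measurable_fun D (f n).
  apply: measurable_funTS; apply/measurable_EFinP; apply: measurable_funM => //.
  apply: measurableT_comp => //; apply: measurable_funB; first exact: measurable_funM.
  by do 2 apply: measurable_funM => //; exact: measurable_funX.
have f0 n w : D w -> (0 <= f n w)%E by rewrite lee_fin mulr_ge0 ?expR_ge0.
have fW n : (\int[P]_(w in D) f n w <= \int[P]_(w in D) (W w)%:E)%E.
  have Gc j : G ((fun w => Num.floor (l w * n.+1%:R)) @^-1` [set j]).
    by apply: sigma_in => //; exact: measurable_preimage_floor.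
  apply: (ge0_le_integral_partition (mu := P) (c := fun w => Num.floor (l w * n.+1%:R))) => //.
  - by move=> j; exact: Gm.
  - by apply/measurable_EFinP; exact: measurable_funTS.
  - by move=> w; exact: f0.
  - by move=> w _; rewrite lee_fin.
  move=> j; set C := _ @^-1` _.
  pose lj := j%:~R / n.+1%:R : R.
  have GC : G C by exact: Gc.
  have mC : measurable (D `&` C) by apply: measurableI => //; exact: Gm.
  rewrite (eq_integral (fun w => (W w * expR (lj * eta w - lj ^+ 2 * s ^+ 2 / 2))%:E)); last first.
    by move=> w; rewrite inE => -[_ /= cj]; rewrite /f /ln cj.
  under [leRHS]eq_integral do rewrite -[W _]mulr1.
  apply: (@le_integral_weight _ _ _ P G Gm sG _ _ (cst 1)) => //.
  - by apply: measurableT_comp => //; apply: measurable_funB => //; exact: measurable_funM.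
  - apply: le_lt_trans integral_fin1; apply: ge0_subset_integral => //.
    exact/measurable_EFinP/measurable_cst.
  - move=> B GB; have -> : B `&` (D `&` C) = (B `&` C) `&` D by rewrite (setIC D) setIA.
    apply: subG1; apply: sigma_in => //.
    by apply: (@measurableI _ (g_sigma_algebraType G)); exact: sub_sigma_algebra.
rewrite (eq_integral (fun w => limn_einf (f ^~ w))).
  apply: le_trans (fatou P mD mf f0) _; exact: limn_einf_ub.
move=> w _.
have fl : (f n w @[n --> \oo] --> (W w * expR (l w * eta w - l w ^+ 2 * s ^+ 2 / 2))%:E).
  apply: cvg_EFin; first exact: nearW.
  rewrite /f/=.
  have lnl : (ln n w @[n --> \oo] --> l w) by exact: cvg_floor_div.
  apply: cvgM; first exact: cvg_cst.
  apply: (cvg_comp (fun n => ln n w * eta w - ln n w ^+ 2 * s ^+ 2 / 2) expR); last exact: continuous_expR.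
  apply: cvgB; first by apply: cvgM lnl _; exact: cvg_cst.
  apply: cvgM; last exact: cvg_cst.
  apply: cvgM; last exact: cvg_cst.
  by under eq_fun do rewrite expr2; rewrite expr2; exact: cvgM.
rewrite is_cvg_limn_einfE; last by apply/cvg_ex; eexists; exact: fl.
by apply/esym/cvg_lim.
Qed.

Lemma subG_weight (l W : Omega -> R) : Gmeas l -> Gmeas W -> (forall w, 0 <= W w) ->
  (\int[P]_(w in D) (W w * expR (l w * eta w))%:E
   <= \int[P]_(w in D) (W w * expR (l w ^+ 2 * s ^+ 2 / 2))%:E)%E.
Proof.
move=> ml mW W0.
(* The variance factor is itself [G]-measurable and is moved into the weight. *)
have := @subG_weight1 l (fun w => W w * expR (l w ^+ 2 * s ^+ 2 / 2)) ml.
under eq_integral do rewrite -mulrA -expRD addrC subrK.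
apply.
  apply: measurable_funM => //; apply: measurableT_comp => //.
  by do 2 apply: measurable_funM => //; exact: measurable_funX.
by move=> w; rewrite mulr_ge0 ?expR_ge0.
Qed.

End SubGaussian.

(** Exponential tilting shifts the mean of a standard Gaussian to [b]. It serves for the Gaussian
    mixture and again for the Chernoff bound on the tails. *)
Lemma gauss_mgf_id {R : realType} (b z : R) :
  normal_pdf 0 1 z * expR (b * z) = expR (b ^+ 2 / 2) * normal_pdf b 1 z.
Proof.
rewrite !normal_pdfE ?oner_eq0// /normal_fun mulrCA -mulrA -!expRD; congr (_ * expR _).
by field.
Qed.

(** Completing the square: the tilted density is again Gaussian, with precision [k]. The condition
    on [b] keeps [k] positive, that is, the exponential moment finite. *)
Lemma gauss_sq_id {R : realType} (a b s z : R) : b ^+ 2 * s ^+ 2 < 1 ->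
  let k := 1 - b ^+ 2 * s ^+ 2 in
  normal_pdf 0 1 z * expR ((a + b * z) ^+ 2 * s ^+ 2 / 2) =
  (Num.sqrt k)^-1 * expR (a ^+ 2 * s ^+ 2 / (2 * k)) *
    normal_pdf (a * b * s ^+ 2 / k) (Num.sqrt k)^-1 z.
Proof.
move=> bs k; have k0 : 0 < k by rewrite subr_gt0.
have sk0 : 0 < Num.sqrt k by rewrite sqrtr_gt0.
rewrite !normal_pdfE ?oner_eq0 ?invr_eq0 ?gt_eqF// /normal_fun.
have -> : normal_peak 1 = (Num.sqrt k)^-1 * normal_peak (Num.sqrt k)^-1 :> R.
  rewrite /normal_peak expr1n mul1r exprVn sqr_sqrtr ?ltW// -mulrnAr.
  by rewrite sqrtrM ?invr_ge0 ?ltW// sqrtrV ?ltW// invfM invrK mulKf ?gt_eqF.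
have -> : (Num.sqrt k)^-1 ^+ 2 *+ 2 = 2 / k by rewrite exprVn sqr_sqrtr ?ltW// mulr_natl.
set e1 := expR _; set e2 := expR _; set e3 := expR _; set e4 := expR _.
have E : e1 * e2 = e3 * e4.
  rewrite /e1 /e2 /e3 /e4 -!expRD; congr expR.
  have kn0 : k != 0 by rewrite gt_eqF.
  by rewrite /k in kn0 *; field; rewrite exprMn.
by rewrite -[LHS]mulrA E [RHS]mulrACA.
Qed.

Section SubGaussianQuadratic.
Context {dO : measure_display} {Omega : measurableType dO} {R : realType}.
Variables (P : probability Omega R) (G : set (set Omega)).
Hypothesis Gm : G `<=` measurable.
Hypothesis sG : sigma_algebra [set: Omega] G.
Variables (D : set Omega) (eta : Omega -> R) (s : R).
Hypothesis mD : measurable D.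
Hypothesis meta : measurable_fun setT eta.
Hypothesis subG : forall B, G B -> forall l : R,
  (\int[P]_(w in B `&` D) (expR (l * eta w))%:E
   <= (expR (l ^+ 2 * s ^+ 2 / 2))%:E * P (B `&` D))%E.

Local Notation Gmeas f := (measurable_fun [set: g_sigma_algebraType G] f).
Local Notation leb := (@lebesgue_measure R).

(** Tonelli: an inequality valid for each [z] survives averaging over a Gaussian [z]. The set [D]
    enters as an indicator because the product measure lives on the whole space. *)
Let gauss_mix (f g : R -> Omega -> R) (F H W : Omega -> R) :
  measurable_fun setT (fun wz : Omega * R => f wz.2 wz.1) ->
  measurable_fun setT (fun wz : Omega * R => g wz.2 wz.1) ->
  measurable_fun setT W -> (forall w, 0 <= W w) ->
  (forall z w, 0 <= f z w) -> (forall z w, 0 <= g z w) ->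
  (forall w, \int[leb]_z (normal_pdf 0 1 z * f z w)%:E = (F w)%:E)%E ->
  (forall w, \int[leb]_z (normal_pdf 0 1 z * g z w)%:E = (H w)%:E)%E ->
  (forall z, \int[P]_(w in D) (W w * f z w)%:E <= \int[P]_(w in D) (W w * g z w)%:E)%E ->
  (\int[P]_(w in D) (W w * F w)%:E <= \int[P]_(w in D) (W w * H w)%:E)%E.
Proof.
move=> mf mg mW W0 f0 g0 fF gH fg.
pose k (f : R -> Omega -> R) (wz : Omega * R) := (\1_D wz.1 * W wz.1 * (normal_pdf 0 1 wz.2 * f wz.2 wz.1))%:E.
have mk (h : R -> Omega -> R) : measurable_fun setT (fun wz : Omega * R => h wz.2 wz.1) -> measurable_fun setT (k h).
  move=> mh; apply/measurable_EFinP; apply: measurable_funM.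
    apply: (measurableT_comp (f := fun w => \1_D w * W w)) => //.
    by apply: measurable_funM.
  apply: measurable_funM => //.
  by apply: (measurableT_comp (measurable_normal_pdf 0 1)).
have k0 (h : R -> Omega -> R) : (forall z w, 0 <= h z w) -> forall wz, (0 <= k h wz)%E.
  by move=> h0 wz; rewrite lee_fin !mulr_ge0// normal_pdf_ge0.
have kz (h : R -> Omega -> R) z : measurable_fun setT (fun wz : Omega * R => h wz.2 wz.1) ->
    (forall z w, 0 <= h z w) ->
    (\int[P]_w k h (w, z) = (normal_pdf 0 1 z)%:E * \int[P]_(w in D) (W w * h z w)%:E)%E.
  move=> mh h0.
  have mhz : measurable_fun setT (h z).
    exact: (measurable_fun_pair1 (f := fun wz : Omega * R => h wz.2 wz.1)).
  rewrite -ge0_integralZl_EFin ?normal_pdf_ge0//; last 2 first.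
    by move=> w _; rewrite lee_fin mulr_ge0.
    by apply/measurable_EFinP; apply: measurable_funTS; exact: measurable_funM.
  rewrite [RHS]integral_mkcond; apply: eq_integral => w _.
  rewrite /k/= patchE indicE; case: ifP => _; last by rewrite !mul0r.
  by rewrite mul1r -EFinM mulrCA.
have kE (h : R -> Omega -> R) (J : Omega -> R) :
    measurable_fun setT (fun wz : Omega * R => h wz.2 wz.1) -> (forall z w, 0 <= h z w) ->
    (forall w, \int[leb]_z (normal_pdf 0 1 z * h z w)%:E = (J w)%:E)%E ->
    (\int[P]_(w in D) (W w * J w)%:E = \int[leb]_z \int[P]_w k h (w, z))%E.
  move=> mh h0 hJ.
  have mhw w : measurable_fun setT (h^~ w).
    exact: (measurable_fun_pair2 (f := fun wz : Omega * R => h wz.2 wz.1)).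
  rewrite integral_mkcond -(@fubini_tonelli _ _ _ _ _ P leb (k h) (mk _ mh) (k0 _ h0)).
  apply: eq_integral => w _; rewrite /k /=.
  under [RHS]eq_integral do rewrite EFinM.
  rewrite ge0_integralZl_EFin//; last 3 first.
    by move=> z _; rewrite lee_fin mulr_ge0// normal_pdf_ge0.
    by apply/measurable_EFinP; apply: measurable_funM => //; [exact: measurable_normal_pdf|exact: mhw].
    by rewrite mulr_ge0.
  by rewrite hJ patchE indicE; case: ifP => _; [rewrite mul1r EFinM|rewrite mul0r mul0e].
rewrite (kE f)// (kE g)//; apply: ge0_le_integral => //.
- by move=> z _; apply: integral_ge0 => w _; exact: k0.
- by apply: (@measurable_fun_fubini_tonelli_G _ _ _ _ _ P (k f)) => *; first [exact: k0|exact: mk].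
- by apply: (@measurable_fun_fubini_tonelli_G _ _ _ _ _ P (k g)) => *; first [exact: k0|exact: mk].
- by move=> z _; rewrite !kz// lee_wpmul2l ?lee_fin ?normal_pdf_ge0.
Qed.

(* The square is linearised by averaging [exp (l eta)] over a Gaussian [l]. *)
Lemma subG_quadratic (a b W : Omega -> R) :
  Gmeas a -> Gmeas b -> Gmeas W -> (forall w, 0 <= W w) ->
  (forall w, b w ^+ 2 * s ^+ 2 < 1) ->
  (\int[P]_(w in D) (W w * expR (a w * eta w + (b w * eta w) ^+ 2 / 2))%:E
   <= \int[P]_(w in D) (W w * ((Num.sqrt (1 - b w ^+ 2 * s ^+ 2))^-1 *
        expR (a w ^+ 2 * s ^+ 2 / (2 * (1 - b w ^+ 2 * s ^+ 2)))))%:E)%E.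
Proof.
move=> ma mb mW W0 bs.
have ma' := measurable_sub_sigma Gm ma; have mb' := measurable_sub_sigma Gm mb.
have mW' := measurable_sub_sigma Gm mW.
have mabz : measurable_fun setT (fun wz : Omega * R => a wz.1 + b wz.1 * wz.2).
  apply: measurable_funD; first exact: measurableT_comp ma' measurable_fst.
  by apply: measurable_funM => //; exact: measurableT_comp mb' measurable_fst.
(* Random tilt [a + b z]: on the left the average over [z] produces the square of [eta]; on the
   right the sub-Gaussian bound is averaged by [gauss_sq_id]. *)
apply: (gauss_mix (f := fun z w => expR ((a w + b w * z) * eta w))
                  (g := fun z w => expR ((a w + b w * z) ^+ 2 * s ^+ 2 / 2))) => //.
- apply: measurableT_comp => //; apply: measurable_funM => //.
  exact: measurableT_comp meta measurable_fst.
- apply: measurableT_comp => //; do 2 apply: measurable_funM => //.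
  exact: measurable_funX.
- move=> w; transitivity (\int[leb]_z ((expR (a w * eta w + (b w * eta w) ^+ 2 / 2))%:E *
      (normal_pdf (b w * eta w) 1 z)%:E))%E.
    apply: eq_integral => z _; rewrite -EFinM; congr EFin.
    rewrite (_ : (a w + b w * z) * eta w = a w * eta w + (b w * eta w) * z); last by ring.
    by rewrite !expRD mulrCA gauss_mgf_id mulrA.
  rewrite ge0_integralZl_EFin ?expR_ge0//; last 2 first.
    by move=> z _; rewrite lee_fin normal_pdf_ge0.
    by apply/measurable_EFinP; exact: measurable_normal_pdf.
  by rewrite integral_normal_pdf mule1.
- move=> w; under eq_integral do rewrite gauss_sq_id// EFinM.
  have k0 : 0 < 1 - b w ^+ 2 * s ^+ 2 by rewrite subr_gt0.
  rewrite ge0_integralZl_EFin ?mulr_ge0 ?expR_ge0 ?invr_ge0//.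
  - by rewrite integral_normal_pdf mule1.
  - by move=> z _; rewrite lee_fin normal_pdf_ge0.
  - by apply/measurable_EFinP; exact: measurable_normal_pdf.
- move=> z; apply: (subG_weight Gm sG mD meta subG (l := fun w => a w + b w * z)) => //.
  by apply: measurable_funD => //; exact: measurable_funM.
Qed.

End SubGaussianQuadratic.

Section Ville.
Context {dO : measure_display} {Omega : measurableType dO} {R : realType}.
Variables (P : probability Omega R) (F : nat -> set (set Omega)).
Hypothesis Fm : forall t, F t `<=` measurable.
Hypothesis sF : forall t, sigma_algebra [set: Omega] (F t).
Hypothesis FS : forall t, F t `<=` F t.+1.
Variable M : nat -> Omega -> R.
Hypothesis mM : forall t, measurable_fun [set: g_sigma_algebraType (F t)] (M t).
Hypothesis M0 : forall t w, 0 <= M t w.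
Hypothesis M01 : forall w, M 0%N w = 1.
Hypothesis superM : forall t A, F t A ->
  (\int[P]_(w in A) (M t.+1 w)%:E <= \int[P]_(w in A) (M t w)%:E)%E.

Lemma filtration_setI t (A B : set Omega) : F t A -> F t B -> F t (A `&` B).
Proof.
move=> FA FB; apply: sigma_in => //.
by apply: (@measurableI _ (g_sigma_algebraType (F t))); exact: sub_sigma_algebra.
Qed.

Lemma ville (c : R) (T : nat) : 0 < c ->
  (P [set w | exists2 t, (t <= T)%N & (c <= M t w)%R] <= (c^-1)%:E)%E.
Proof.
move=> c0.
pose X t := [set w | c <= M t w].
have FX t : F t (X t).
  apply: sigma_in => //.
  have -> : X t = M t @^-1` `[c, +oo[%classic.
    by apply/seteqP; split=> w /=; rewrite in_itv/= andbT.
  by rewrite -[_ @^-1` _]setTI; exact: mM.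
pose N t := [set w | forall s, (s <= t)%N -> M s w < c].
have NS t : N t.+1 = N t `\` X t.+1.
  apply/seteqP; split=> w /=.
    move=> h; split; first by move=> s st; apply: h; exact: leqW.
    by apply/negP; rewrite -ltNge; exact: h.
  move=> [h /negP]; rewrite -ltNge => h1 s; rewrite leq_eqVlt => /orP[/eqP ->//|].
  by rewrite ltnS; exact: h.
have N0 : N 0%N = ~` X 0%N.
  apply/seteqP; split=> w /=.
    by move=> h; apply/negP; rewrite -ltNge; exact: h.
  by move=> /negP; rewrite -ltNge => h s; rewrite leqn0 => /eqP ->.
have FN t : F t (N t).
  elim: t => [|t IH].
    by rewrite N0; apply: sigma_in => //; apply: (@measurableC _ (g_sigma_algebraType (F 0%N))); exact: sub_sigma_algebra.
  rewrite NS; apply: sigma_in => //; apply: (@measurableD _ (g_sigma_algebraType (F t.+1))); apply: sub_sigma_algebra => //.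
  exact: FS.
have mMO t : measurable_fun setT (M t) by exact: (measurable_sub_sigma (@Fm t)).
have mX t : measurable (X t) by exact: Fm (FX t).
have mN t : measurable (N t) by exact: Fm (FN t).
have intX t A : measurable A -> A `<=` X t -> (c%:E * P A <= \int[P]_(w in A) (M t w)%:E)%E.
  move=> mA AX; rewrite -integral_cst//; apply: ge0_le_integral => //.
  - by move=> w _; rewrite lee_fin ltW.
  - by apply/measurable_EFinP; exact: measurable_funTS.
(* A lower bound for the mean of the process stopped when it first reaches [c]: paths that have
   crossed count for [c], the others for their present value. Paths leave [N t] with [M t.+1 >= c],
   and the supermartingale inequality is applied on [N t], which is in [F t]. *)
have key t : (c%:E * P (~` N t) + \int[P]_(w in N t) (M t w)%:E <= 1)%E.
  elim: t => [|t IH].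
    have -> : ~` N 0%N = X 0%N by rewrite N0 setCK.
    apply: (@le_trans _ _ (\int[P]_(w in X 0%N) (M 0%N w)%:E + \int[P]_(w in N 0%N) (M 0%N w)%:E)%E).
      by rewrite leeD2r// intX.
    rewrite -ge0_integral_setU//; last 3 first.
    - by apply/measurable_EFinP; exact: measurable_funTS.
    - by move=> w _; rewrite lee_fin.
    - by rewrite N0; apply/disj_setPS => w [].
    rewrite N0 setUv (eq_integral (cst 1%E)); last by move=> w _; rewrite M01.
    by rewrite integral_cst//= mul1e probability_setT.
  apply: le_trans IH.
  have E1 : ~` N t.+1 = ~` N t `|` (N t `&` X t.+1).
    rewrite NS setDE setCI setCK; apply/seteqP; split=> w /=; last tauto.
    by case: (pselect (N t w)); tauto.
  rewrite E1 measureU//; last 3 first.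
  - exact: measurableC.
  - exact: measurableI.
  - by rewrite -subset0 => w [] /= + [].
  rewrite ge0_muleDr// -addeA leeD2l//.
  apply: (le_trans _ (superM (FN t))).
  apply: (@le_trans _ _ (\int[P]_(w in N t `&` X t.+1) (M t.+1 w)%:E + \int[P]_(w in N t.+1) (M t.+1 w)%:E)%E).
    by rewrite leeD2r// intX//; exact: measurableI.
  rewrite -ge0_integral_setU//; last 4 first.
  - exact: measurableI.
  - by apply/measurable_EFinP; exact: measurable_funTS.
  - by move=> w _; rewrite lee_fin.
  - by rewrite NS; apply/disj_setPS => w [[_ h] [_]].
  by rewrite NS setUIDK.
have -> : [set w | exists2 t, (t <= T)%N & c <= M t w] = ~` N T.
  apply/seteqP; split=> w /=.
    by move=> [t tT ct] /(_ t tT); rewrite ltNge ct.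
  by move=> /existsNP[t /not_implyP[tT /negP]]; rewrite -leNgt; exists t.
have mCN : measurable (~` N T) by exact: measurableC.
have := key T; rewrite -(fineK (fin_num_measure P _ mCN)).
have : (0 <= \int[P]_(w in N T) (M T w)%:E)%E by apply: integral_ge0 => w _; rewrite lee_fin.
move=> I0 h.
have : (c%:E * (fine (P (~` N T)))%:E <= 1)%E by apply: le_trans h; rewrite leeDl.
by rewrite -EFinM !lee_fin mulrC -ler_pdivlMr// mul1r.
Qed.

End Ville.

(** * Ridge regression statistics *)

Section Dot.
Context {R : comNzRingType} {d : nat}.
Implicit Types u v w : 'cV[R]_d.

Lemma dotvE u v : dotv u v = (u^T *m v) 0 0.
Proof. by rewrite mxE; apply: eq_bigr => k _; rewrite mxE. Qed.

Lemma dotvC u v : dotv u v = dotv v u.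
Proof. by apply: eq_bigr => k _; rewrite mulrC. Qed.

Lemma dotvDr u v w : dotv u (v + w) = dotv u v + dotv u w.
Proof. by rewrite !dotvE mulmxDr mxE. Qed.

Lemma dotvDl u v w : dotv (u + v) w = dotv u w + dotv v w.
Proof. by rewrite dotvC dotvDr !(dotvC w). Qed.

Lemma dotvNr u v : dotv u (- v) = - dotv u v.
Proof. by rewrite !dotvE mulmxN mxE. Qed.

Lemma dotvNl u v : dotv (- u) v = - dotv u v.
Proof. by rewrite dotvC dotvNr dotvC. Qed.

Lemma dotvBr u v w : dotv u (v - w) = dotv u v - dotv u w.
Proof. by rewrite dotvDr dotvNr. Qed.

Lemma dotvBl u v w : dotv (u - v) w = dotv u w - dotv v w.
Proof. by rewrite dotvDl dotvNl. Qed.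

Lemma dotvZr a u v : dotv u (a *: v) = a * dotv u v.
Proof. by rewrite !dotvE -scalemxAr mxE. Qed.

Lemma dotvZl a u v : dotv (a *: u) v = a * dotv u v.
Proof. by rewrite dotvC dotvZr dotvC. Qed.

Lemma dotv0r u : dotv u 0 = 0.
Proof. by rewrite dotvE mulmx0 mxE. Qed.

Lemma dotv0l u : dotv 0 u = 0.
Proof. by rewrite dotvC dotv0r. Qed.

Lemma mulmx_dotv u v w : u *m (v^T *m w) = dotv v w *: u.
Proof. by rewrite [v^T *m w]mx11_scalar mul_mx_scalar dotvE. Qed.

Lemma dotv_sumr I (s : seq I) (p : pred I) u (f : I -> 'cV[R]_d) :
  dotv u (\sum_(i <- s | p i) f i) = \sum_(i <- s | p i) dotv u (f i).
Proof.
elim/big_rec2: _ => [|i y1 y2 _ <-]; first exact: dotv0r.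
by rewrite dotvDr.
Qed.

End Dot.

Lemma dotv_mulmxr {R : comNzRingType} {m n} (u : 'cV[R]_m) (M : 'M[R]_(m, n)) (v : 'cV[R]_n) :
  dotv u (M *m v) = dotv (M^T *m u) v.
Proof. by rewrite !dotvE trmx_mul trmxK mulmxA. Qed.

Section DotReal.
Context {R : realFieldType} {d : nat}.
Implicit Types u v : 'cV[R]_d.

Lemma sqnorm_ge0 u : 0 <= sqnorm u.
Proof. by apply: sumr_ge0 => k _; rewrite -expr2 sqr_ge0. Qed.

Lemma sqnorm_eq0 u : sqnorm u = 0 -> u = 0.
Proof.
move=> u0; apply/matrixP => k l; rewrite ord1 mxE.
have h : forall k : 'I_d, true -> 0 <= u k 0 * u k 0 by move=> j _; rewrite -expr2 sqr_ge0.
have := psumr_eq0P h u0 (isT : true).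
by move=> /(_ k)/eqP; rewrite mulf_eq0 orbb => /eqP.
Qed.

Lemma cauchy_schwarz u v : dotv u v ^+ 2 <= sqnorm u * sqnorm v.
Proof.
have [v0|v0] := eqVneq (sqnorm v) 0.
  by rewrite (sqnorm_eq0 v0) dotv0r expr0n /= mulr_ge0 ?sqnorm_ge0.
have vp : 0 < sqnorm v by rewrite lt_def v0 sqnorm_ge0.
have := sqnorm_ge0 (sqnorm v *: u - dotv u v *: v).
rewrite {1}/sqnorm !dotvBl !dotvBr !dotvZl !dotvZr -!/(sqnorm _) (dotvC v u).
rewrite (_ : _ - _ = sqnorm v * (sqnorm u * sqnorm v - dotv u v ^+ 2)); last by ring.
by rewrite pmulr_rge0// subr_ge0.
Qed.

End DotReal.

Lemma normr_dotv_le {R : realType} {d : nat} (u v : 'cV[R]_d) (a b : R) :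
  0 <= a -> 0 <= b -> sqnorm u <= a ^+ 2 -> sqnorm v <= b ^+ 2 -> `|dotv u v| <= a * b.
Proof.
move=> a0 b0 ua vb; rewrite -ler_sqr ?nnegrE ?mulr_ge0// real_normK ?num_real//.
apply: le_trans (cauchy_schwarz u v) _; rewrite exprMn.
by apply: ler_pM => //; exact: sqnorm_ge0.
Qed.

(** * Rank-one updates of determinants and inverses *)

Section RankOne.
Context {R : fieldType} {d : nat}.
Variables (A : 'M[R]_d) (x : 'cV[R]_d).
Hypothesis uA : A \in unitmx.

(** Matrix determinant lemma, from two triangular factorisations of the same block matrix [B]. *)
Lemma det_rank_one : \det (A + x *m x^T) = \det A * (1 + dotv x (invmx A *m x)).
Proof.
pose B := block_mx A (- x) x^T (1%:M : 'M[R]_1).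
have e1 : B = block_mx 1%:M 0 (x^T *m invmx A) 1%:M *m
    block_mx A (- x) 0 (1%:M + x^T *m invmx A *m x).
  rewrite mulmx_block !(mul1mx, mul0mx, mulmx0, addr0) mulmxKV// mulmxN.
  by rewrite addrC addrK.
have e2 : B = block_mx 1%:M (- x) 0 1%:M *m block_mx (A + x *m x^T) 0 x^T 1%:M.
  by rewrite mulmx_block !(mul1mx, mul0mx, mulmx0, mulmx1, add0r) mulNmx addrK.
have := congr1 determinant e1; rewrite e2 !det_mulmx !det_ublock !det_lblock !det1 !mul1r mulr1.
by move=> ->; congr (_ * _); rewrite det_mx11 mxE mxE eqxx dotvE mulmxA.
Qed.

(** Sherman-Morrison formula, verified by multiplying the claimed vector by [A + x x^T]. *)
Lemma invmx_rank_one : 1 + dotv x (invmx A *m x) != 0 -> A^T = A ->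
  A + x *m x^T \in unitmx /\
  forall u v, dotv u (invmx (A + x *m x^T) *m v) = dotv u (invmx A *m v)
    - dotv u (invmx A *m x) * dotv x (invmx A *m v) / (1 + dotv x (invmx A *m x)).
Proof.
move=> s0 sA.
have uB : A + x *m x^T \in unitmx.
  by rewrite unitmxE det_rank_one unitfE mulf_neq0// -unitfE -unitmxE.
split => // u v.
suff -> : invmx (A + x *m x^T) *m v = invmx A *m v -
    (dotv x (invmx A *m v) / (1 + dotv x (invmx A *m x))) *: (invmx A *m x).
  by rewrite dotvBr dotvZr; congr (_ - _); rewrite mulrC mulrA.
apply: (canLR (mulKmx uB)); rewrite mulmxBr -scalemxAr !mulmxDl !mulKVmx//.
rewrite -!(mulmxA x) !mulmx_dotv -[X in _ *: (X + _)]scale1r -scalerDl.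
by rewrite scalerA divfK// addrK.
Qed.

End RankOne.

(** Leibniz expansion. Only the logarithm of the bound is used later, where [d!] is a constant
    independent of the round. *)
Lemma det_le {R : realFieldType} {d : nat} (A : 'M[R]_d) (b : R) :
  (forall k l, `|A k l| <= b) -> `|\det A| <= d`!%:R * b ^+ d.
Proof.
move=> Ab; rewrite /determinant (le_trans (ler_norm_sum _ _ _))//.
rewrite -(perm.card_Sn d) mulr_natl -sumr_const; apply: ler_sum => s _.
rewrite normrM normrX normrN1 expr1n mul1r normr_prod.
rewrite -[d in X in _ <= X]card_ord -prodr_const; apply: ler_prod => k _.
by rewrite normr_ge0 Ab.
Qed.

(** * Gram matrix and ridge statistics of one arm along a path *)

Section GramSequence.
Context {R : realType} {Omega : Type} {d K : nat}.
Variables (x : nat -> 'I_K -> Omega -> 'cV[R]_d) (a : nat -> Omega -> 'I_K)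
          (L : nat -> 'M[R]_d) (i : 'I_K) (w : Omega).
Local Notation A t := (Amat x a i t w).
Local Notation xt t := (x t i w).
Hypothesis LA : forall t, L t *m (L t)^T = invmx (A t).
Hypothesis x1 : forall t, sqnorm (xt t) <= 1.

Lemma Amat0 : A 0 = 1%:M.
Proof. by rewrite /Amat big_geq// addr0. Qed.

Lemma AmatS t : A t.+1 = if pulled a i t w then A t + xt t *m (xt t)^T else A t.
Proof.
rewrite /Amat big_mkcond big_nat_recr//= -big_mkcond/=.
by case: ifP => _; rewrite ?addr0 ?addrA.
Qed.

Lemma Amat_sym t : (A t)^T = A t.
Proof.
elim: t => [|t IH]; first by rewrite Amat0 trmx1.
by rewrite AmatS; case: ifP => // _; rewrite linearD/= IH trmx_mul trmxK.
Qed.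

(** The square root used for sampling doubles as the witness that the inverse Gram matrix is
    symmetric and nonnegative. *)
Lemma dotv_Ainv t u v : dotv u (invmx (A t) *m v) = dotv ((L t)^T *m u) ((L t)^T *m v).
Proof. by rewrite -LA -mulmxA dotv_mulmxr. Qed.

Lemma Ainv_ge0 t u : 0 <= dotv u (invmx (A t) *m u).
Proof. by rewrite dotv_Ainv sqnorm_ge0. Qed.

Lemma Ainv_sym t u v : dotv u (invmx (A t) *m v) = dotv v (invmx (A t) *m u).
Proof. by rewrite !dotv_Ainv dotvC. Qed.

Lemma det_Amat_gt0 t : 0 < \det (A t).
Proof.
elim: t => [|t IH]; first by rewrite Amat0 det1.
rewrite AmatS; case: ifP => // _; rewrite det_rank_one; last first.
  by rewrite unitmxE unitfE gt_eqF.
by rewrite mulr_gt0// ltr_pwDl// Ainv_ge0.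
Qed.

Lemma Amat_unit t : A t \in unitmx.
Proof. by rewrite unitmxE unitfE gt_eqF// det_Amat_gt0. Qed.

Lemma det_AmatS t : \det (A t.+1) = if pulled a i t w
  then \det (A t) * (1 + dotv (xt t) (invmx (A t) *m xt t)) else \det (A t).
Proof. by rewrite AmatS; case: ifP => // _; rewrite det_rank_one// Amat_unit. Qed.

Lemma AinvS t u v : pulled a i t w ->
  dotv u (invmx (A t.+1) *m v) = dotv u (invmx (A t) *m v)
    - dotv u (invmx (A t) *m xt t) * dotv (xt t) (invmx (A t) *m v)
      / (1 + dotv (xt t) (invmx (A t) *m xt t)).
Proof.
move=> pt; rewrite AmatS pt; apply: (invmx_rank_one (Amat_unit t) _ (Amat_sym t)).2.
by rewrite gt_eqF// ltr_pwDl// Ainv_ge0.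
Qed.

(** Each update subtracts a nonnegative term from the form, which starts as the identity. *)
Lemma Ainv_le t u : dotv u (invmx (A t) *m u) <= sqnorm u.
Proof.
elim: t => [|t IH]; first by rewrite Amat0 invmx1 mul1mx.
apply: le_trans IH; case pt: (pulled a i t w); last by rewrite AmatS pt.
rewrite AinvS// gerBl Ainv_sym -expr2 divr_ge0 ?sqr_ge0// addr_ge0//.
exact: Ainv_ge0.
Qed.

Lemma det_Amat_le t : \det (A t) <= d`!%:R * t.+1%:R ^+ d.
Proof.
apply: le_trans (ler_norm _) _; apply: det_le => k l.
elim: t => [|t IH].
  by rewrite Amat0 mxE; case: eqP => _; rewrite ?normr1 ?normr0.
rewrite AmatS -(natr1 t.+1); case: ifP => _; last by rewrite (le_trans IH)// lerDl.
rewrite mxE (le_trans (ler_normD _ _))// lerD//.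
rewrite mxE big_ord1 mxE.
have xk (j : 'I_d) : `|xt t j 0| <= 1.
  rewrite -(@expr_le1 _ 2)// real_normK ?num_real//.
  apply: le_trans (x1 t); rewrite /sqnorm /dotv (bigD1 j)//= -expr2 lerDl.
  by apply: sumr_ge0 => m _; rewrite -expr2 sqr_ge0.
by rewrite normrM mulr_ile1.
Qed.

Variables (r : nat -> 'I_K -> Omega -> R) (mu : 'cV[R]_d).
Local Notation eta t := (r t i w - dotv (xt t) mu).
Local Notation S t := (\sum_(0 <= s < t | pulled a i s w) eta s *: xt s).

Lemma AmatB1 t : A t - 1%:M = \sum_(0 <= s < t | pulled a i s w) (xt s *m (xt s)^T).
Proof. by rewrite /Amat [LHS]addrC addKr. Qed.

Lemma bvecE t : bvec x r a i t w = (A t - 1%:M) *m mu + S t.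
Proof.
rewrite /bvec AmatB1 mulmx_suml -big_split/=; apply: eq_bigr => s _.
by rewrite -mulmxA mulmx_dotv -scalerDl addrC subrK.
Qed.

(** By [bvecE], [b = (A - I) mu + S]: the identity matrix of the regularisation leaves the bias
    [- mu], which the estimates below treat as one more noise term. *)
Lemma ridge_error t : invmx (A t) *m bvec x r a i t w = mu + invmx (A t) *m (S t - mu).
Proof.
rewrite bvecE mulmxBl mul1mx -addrA (addrC (- mu)) mulmxDr mulKmx//.
exact: Amat_unit.
Qed.

Lemma ridge_residual t :
  \sum_(0 <= s < t | pulled a i s w) r s i w ^+ 2
   - ((bvec x r a i t w)^T *m invmx (A t) *m bvec x r a i t w) 0 0
  = sqnorm mu + \sum_(0 <= s < t | pulled a i s w) eta s ^+ 2
    - dotv (S t - mu) (invmx (A t) *m (S t - mu)).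
Proof.
rewrite -mulmxA -dotvE ridge_error dotvDr.
set h := S t - mu.
have bE : bvec x r a i t w = A t *m mu + h by rewrite bvecE mulmxBl mul1mx /h addrAC -addrA.
have -> : dotv (bvec x r a i t w) (invmx (A t) *m h) = dotv mu h + dotv h (invmx (A t) *m h).
  rewrite bE dotvDl; congr (_ + _).
  by rewrite dotvC dotv_mulmxr Amat_sym mulKVmx ?Amat_unit// dotvC.
have -> : \sum_(0 <= s < t | pulled a i s w) r s i w ^+ 2 =
    dotv mu ((A t - 1%:M) *m mu) + 2 * dotv mu (S t)
    + \sum_(0 <= s < t | pulled a i s w) eta s ^+ 2.
  rewrite AmatB1 mulmx_suml !dotv_sumr mulr_sumr -!big_split/=.
  apply: eq_bigr => s _; rewrite -mulmxA mulmx_dotv !dotvZr (dotvC mu); ring.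
rewrite bE dotvDl mulmxBl mul1mx dotvBr /h dotvBl !dotvBr -/(sqnorm mu) (dotvC (A t *m mu)) (dotvC (S t) mu).
ring.
Qed.

End GramSequence.

(** * Self-normalised supermartingales *)

Lemma dotv_expand {R : comNzRingType} {d : nat} (M : 'M[R]_d) (u v : 'cV[R]_d) (e : R) :
  dotv (u + e *: v) (M *m (u + e *: v)) = dotv u (M *m u) + e * dotv u (M *m v)
    + e * dotv v (M *m u) + e ^+ 2 * dotv v (M *m v).
Proof.
rewrite mulmxDr -scalemxAr dotvDl !dotvDr !dotvZl !dotvZr; ring.
Qed.

(** Here [c = 1 + x^T A^-1 x], [q = S^T A^-1 x], [e] is the new noise, and [ld], [lc] are the
    logarithms of [det A] and [c]. The exponent of the next round is split into a part known
    beforehand and a quadratic polynomial in [e]; abstract scalars keep [field] away from the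
    matrices. *)
Lemma vec_mart_exponent {R : fieldType} (Q q e c ld lc sg : R) : c != 0 -> sg != 0 ->
  (2 : R) != 0 ->
  (Q + (2 * e * q - q ^+ 2 + e ^+ 2 * (c - 1)) / c) / (2 * sg ^+ 2) - (ld + lc) / 2 =
  Q / (2 * sg ^+ 2) - ld / 2 + (- (q ^+ 2 / (2 * sg ^+ 2 * c)) - lc / 2)
  + (q / (sg ^+ 2 * c) * e + (c - 1) / (c * sg ^+ 2) * e ^+ 2 / 2).
Proof. by move=> c0 sg0 n2; field; rewrite n2 c0 sg0. Qed.

(** The predictable factor is exactly the inverse of the Gaussian bound: [c] is the ratio of
    successive determinants, and [2 / c] is [2 (1 - b^2 sg^2)] for the tilt chosen in
    [vec_mart_super]. *)
Lemma vec_mart_cancel {R : realType} (q c lc sg : R) : c != 0 -> sg != 0 ->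
  expR (- (q ^+ 2 / (2 * sg ^+ 2 * c)) - lc / 2) *
    (expR (lc / 2) * expR ((q / (sg ^+ 2 * c)) ^+ 2 * sg ^+ 2 / (2 / c))) = 1.
Proof.
move=> c0 sg0; rewrite -!expRD (_ : _ + _ = 0) ?expR0//; field.
by rewrite ?c0 ?sg0.
Qed.

(** * Measurability of the statistics with respect to the history *)

Section Adapted.
Context {dO : measure_display} {Omega : measurableType dO} {R : realType} {d K : nat}.
Variables (F : nat -> set (set Omega)) (x : nat -> 'I_K -> Omega -> 'cV[R]_d)
  (r : nat -> 'I_K -> Omega -> R) (a : nat -> Omega -> 'I_K)
  (L : nat -> 'I_K -> Omega -> 'M[R]_d) (mu : 'I_K -> 'cV[R]_d) (s2 : 'I_K -> R).
Hypothesis sF : forall t, sigma_algebra [set: Omega] (F t).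
Hypothesis FS : forall t, F t `<=` F t.+1.
Hypothesis Fx : forall t i (k : 'I_d), Fmeas (F t) (fun w => x t i w k 0).
Hypothesis Fr0 : forall i, Fmeas (F 1) (r 0 i).
Hypothesis Fa : forall t, (0 < t)%N -> forall j : 'I_K, F t.+1 [set w | a t w = j].
Hypothesis Fr : forall t, (0 < t)%N -> Fmeas (F t.+1) (fun w => r t (a t w) w).
Hypothesis FL : forall t i (k l : 'I_d), Fmeas (F t) (fun w => L t i w k l).
Hypothesis LA : forall t i w, L t i w *m (L t i w)^T = invmx (Amat x a i t w).

Local Notation ad t f := (measurable_fun [set: g_sigma_algebraType (F t)] f).
Local Notation eta t i w := (r t i w - dotv (x t i w) (mu i)).

Lemma adS (t : nat) (d' : measure_display) (Y : measurableType d') (f : Omega -> Y) :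
  ad t f -> ad t.+1 f.
Proof.
move=> mf _ B mB; have := mf measurableT B mB; rewrite !setTI => h.
by apply: sub_sigma_algebra; apply: FS; exact: sigma_in h.
Qed.

Lemma pulled_in (t : nat) i : F t.+1 [set w | pulled a i t w].
Proof.
case: t => [|t].
  have -> : [set w | pulled a i 0 w] = setT by apply/seteqP.
  have [h0 hD _] := sF 1; by have := hD _ h0; rewrite setD0.
have -> : [set w | pulled a i t.+1 w] = [set w | a t.+1 w = i].
  by apply/seteqP; split=> w /=; rewrite /pulled/= => /eqP.
exact: Fa.
Qed.

Lemma ad_pulled (t : nat) i : ad t.+1 (pulled a i t).
Proof.
apply: (measurable_fun_bool true); rewrite setTI.
apply: sub_sigma_algebra; have := pulled_in t i; congr (F _ _).
Qed.

Lemma ad_sum_pulled t i (f : nat -> Omega -> R) :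
  (forall s, (s < t)%N -> ad s.+1 (fun w => if pulled a i s w then f s w else 0)) ->
  ad t (fun w => \sum_(0 <= s < t | pulled a i s w) f s w).
Proof.
elim: t => [|t IH] mf.
  by under eq_fun do rewrite big_geq//; exact: measurable_cst.
have -> : (fun w => \sum_(0 <= s < t.+1 | pulled a i s w) f s w) =
  (fun w => \sum_(0 <= s < t | pulled a i s w) f s w + if pulled a i t w then f t w else 0).
  by apply/funext => w; rewrite big_mkcond big_nat_recr//= -big_mkcond.
apply: measurable_funD; last exact: mf.
by apply: adS; apply: IH => s st; apply: mf; exact: ltnW.
Qed.

Lemma ad_x t i k : ad t (fun w => x t i w k 0).
Proof. by apply/FmeasP => //; exact: Fx. Qed.

Lemma ad_dotv t (u v : Omega -> 'cV[R]_d) : (forall k, ad t (fun w => u w k 0)) ->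
  (forall k, ad t (fun w => v w k 0)) -> ad t (fun w => dotv (u w) (v w)).
Proof. by move=> mu' mv; apply: measurable_sum => k; exact: measurable_funM. Qed.

(** Only the reward of the arm pulled is observed, so the noise of arm [i] becomes known only when
    masked by [pulled]; at round 0 all rewards are observed. *)
Lemma ad_eta t i : ad t.+1 (fun w => if pulled a i t w then eta t i w else 0).
Proof.
have mxmu : ad t.+1 (fun w => dotv (x t i w) (mu i)).
  by apply: adS; apply: ad_dotv => k; [exact: ad_x|exact: measurable_cst].
case: t mxmu => [|t] mxmu.
  by apply: measurable_funB => //; apply/FmeasP => //; exact: Fr0.
have -> : (fun w => if pulled a i t.+1 w then eta t.+1 i w else 0) =
   (fun w => if pulled a i t.+1 w then r t.+1 (a t.+1 w) w - dotv (x t.+1 i w) (mu i) else 0).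
  by apply/funext => w; rewrite /pulled/=; case: eqP => // ->.
apply: measurable_fun_ifT; [exact: ad_pulled| |exact: measurable_cst].
by apply: measurable_funB => //; apply/FmeasP => //; exact: Fr.
Qed.

Lemma ad_pulled_comp t i (g : Omega -> R -> R) :
  (forall f, ad t.+1 f -> ad t.+1 (fun w => g w (f w))) ->
  ad t.+1 (fun w => if pulled a i t w then g w (eta t i w) else 0).
Proof.
move=> mg.
have -> : (fun w => if pulled a i t w then g w (eta t i w) else 0) =
  (fun w => if pulled a i t w then g w (if pulled a i t w then eta t i w else 0) else 0).
  by apply/funext => w; case: pulled.
apply: measurable_fun_ifT; [exact: ad_pulled| |exact: measurable_cst].
by apply: mg; exact: ad_eta.
Qed.

Definition noise_vec t i w : 'cV[R]_d := \sum_(0 <= s < t | pulled a i s w) eta s i w *: x s i w.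
Definition noise_sq t i w : R := \sum_(0 <= s < t | pulled a i s w) (eta s i w ^+ 2 - s2 i).
Definition snorm2 t i w : R := dotv (x t i w) (invmx (Amat x a i t w) *m x t i w).
Definition noise_norm2 t i w : R := dotv (noise_vec t i w) (invmx (Amat x a i t w) *m noise_vec t i w).

Lemma ad_noise_vec t i k : ad t (fun w => noise_vec t i w k 0).
Proof.
have -> : (fun w => noise_vec t i w k 0) =
    (fun w => \sum_(0 <= s < t | pulled a i s w) eta s i w * x s i w k 0).
  by apply/funext => w; rewrite summxE; apply: eq_bigr => s _; rewrite mxE.
apply: ad_sum_pulled => s _.
apply: (@ad_pulled_comp s i (fun w z => z * x s i w k 0)) => f mf.
by apply: measurable_funM => //; apply: adS; exact: ad_x.
Qed.

Lemma ad_noise_sq t i : ad t (noise_sq t i).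
Proof.
apply: ad_sum_pulled => s _.
apply: (@ad_pulled_comp s i (fun w z => z ^+ 2 - s2 i)) => f mf.
by apply: measurable_funB => //; exact: measurable_funX.
Qed.

Lemma ad_LT t i (u : Omega -> 'cV[R]_d) k : (forall k, ad t (fun w => u w k 0)) ->
  ad t (fun w => ((L t i w)^T *m u w) k 0).
Proof.
move=> mu'; have -> : (fun w => ((L t i w)^T *m u w) k 0) = (fun w => \sum_l L t i w l k * u w l 0).
  by apply/funext => w; rewrite mxE; apply: eq_bigr => l _; rewrite mxE.
apply: measurable_sum => l; apply: measurable_funM => //.
by apply/FmeasP.
Qed.

(** Measurability of the inverse is obtained through its square root [L], whose entries are known at
    round [t]. *)
Lemma ad_Ainv t i (u v : Omega -> 'cV[R]_d) : (forall k, ad t (fun w => u w k 0)) ->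
  (forall k, ad t (fun w => v w k 0)) -> ad t (fun w => dotv (u w) (invmx (Amat x a i t w) *m v w)).
Proof.
move=> mu' mv.
have -> : (fun w => dotv (u w) (invmx (Amat x a i t w) *m v w)) =
    (fun w => dotv ((L t i w)^T *m u w) ((L t i w)^T *m v w)).
  by apply/funext => w; rewrite (dotv_Ainv (L := fun t => L t i w)).
by apply: ad_dotv => k; exact: ad_LT.
Qed.

Lemma ad_snorm2 t i : ad t (snorm2 t i).
Proof. by apply: ad_Ainv => k; exact: ad_x. Qed.

Lemma ad_noise_norm2 t i : ad t (noise_norm2 t i).
Proof. by apply: ad_Ainv => k; exact: ad_noise_vec. Qed.

Lemma ad_det t i : ad t (fun w => \det (Amat x a i t w)).
Proof.
elim: t => [|t IH].
  by under eq_fun do rewrite Amat0 det1; exact: measurable_cst.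
have -> : (fun w => \det (Amat x a i t.+1 w)) = (fun w => if pulled a i t w
    then \det (Amat x a i t w) * (1 + snorm2 t i w) else \det (Amat x a i t w)).
  by apply/funext => w; rewrite (det_AmatS (L := fun t => L t i w)).
apply: measurable_fun_ifT; [exact: ad_pulled| |exact: adS].
apply: measurable_funM; first exact: adS.
by apply: measurable_funD => //; apply: adS; exact: ad_snorm2.
Qed.

Lemma ad_Tcount t i : ad t (fun w => (Tcount a i t w)%:R : R).
Proof.
have -> : (fun w => (Tcount a i t w)%:R : R) =
    (fun w => \sum_(0 <= s < t | pulled a i s w) 1).
  by apply/funext => w; rewrite /Tcount natr_sum.
apply: ad_sum_pulled => s _.
by apply: measurable_fun_ifT => //; exact: ad_pulled.
Qed.

Lemma noise_vecS t i w : noise_vec t.+1 i w =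
  if pulled a i t w then noise_vec t i w + eta t i w *: x t i w else noise_vec t i w.
Proof.
rewrite /noise_vec big_mkcond big_nat_recr//= -big_mkcond/=.
by case: ifP => _ //; rewrite addr0.
Qed.

Lemma noise_sqS t i w : noise_sq t.+1 i w =
  if pulled a i t w then noise_sq t i w + (eta t i w ^+ 2 - s2 i) else noise_sq t i w.
Proof.
rewrite /noise_sq big_mkcond big_nat_recr//= -big_mkcond/=.
by case: ifP => _ //; rewrite addr0.
Qed.

Lemma TcountS t i w : Tcount a i t.+1 w = (Tcount a i t w + pulled a i t w)%N.
Proof.
rewrite /Tcount big_mkcond big_nat_recr//= -big_mkcond/=.
by case: ifP.
Qed.

(** Sherman-Morrison applied to the form at [S + eta x]. The result is quadratic in the new noise,
    which is the shape that [subG_quadratic] integrates. *)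
Lemma noise_norm2S t i w : pulled a i t w ->
  noise_norm2 t.+1 i w = noise_norm2 t i w
    + (2 * eta t i w * dotv (noise_vec t i w) (invmx (Amat x a i t w) *m x t i w)
       - dotv (noise_vec t i w) (invmx (Amat x a i t w) *m x t i w) ^+ 2
       + eta t i w ^+ 2 * snorm2 t i w) / (1 + snorm2 t i w).
Proof.
move=> pt; rewrite /noise_norm2 noise_vecS pt dotv_expand.
have LAw u := LA u i w.
rewrite !(AinvS LAw _ _ pt) (Ainv_sym LAw t (x t i w) (noise_vec t i w)).
have := Ainv_ge0 LAw t (x t i w); rewrite /snorm2.
move: (dotv (x t i w) (invmx _ *m x t i w)) => s.
move: (dotv (noise_vec t i w) (invmx _ *m x t i w)) => q.
move: (dotv (noise_vec t i w) (invmx _ *m noise_vec t i w)) => Q.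
move: (r t i w - _) => e s0; have c0 : 1 + s != 0 by rewrite gt_eqF// ltr_pwDl.
by field.
Qed.

(** * The two exponential supermartingales *)

Section Supermartingales.
Variables (P : probability Omega R) (sg : R).
Hypothesis sg0 : 0 < sg.
Hypothesis Fm : forall t, F t `<=` measurable.
Hypothesis mr : forall t i, measurable_fun [set: Omega] (r t i).
Hypothesis subG1 : forall t i, cond_subG P (condsets F a t) sg (fun w => eta t i w).
Hypothesis subG2 : forall t i, cond_subG P (condsets F a t) sg (fun w => eta t i w ^+ 2 - s2 i).

Lemma condsets_pulled t i A : F t A -> condsets F a t (A `&` [set w | pulled a i t w]).
Proof.
move=> FA; exists A => //; case: t FA => [|t] FA.
  by left; have -> : [set w | pulled a i 0 w] = setT; [apply/seteqP|rewrite setIT].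
right; split => //; exists i; congr (_ `&` _).
by apply/seteqP; split=> w /=; rewrite /pulled/= => /eqP.
Qed.

(** An arm that is not pulled keeps its statistics, so the supermartingale inequality has content
    only on the event that it is pulled. *)
Lemma integral_pulled_split t i (B : set Omega) (M M' : Omega -> R) :
  F t B -> measurable_fun setT M -> measurable_fun setT M' ->
  (forall w, 0 <= M w) -> (forall w, 0 <= M' w) ->
  (forall w, ~~ pulled a i t w -> M' w = M w) ->
  (\int[P]_(w in B `&` [set w | pulled a i t w]) (M' w)%:E <=
   \int[P]_(w in B `&` [set w | pulled a i t w]) (M w)%:E)%E ->
  (\int[P]_(w in B) (M' w)%:E <= \int[P]_(w in B) (M w)%:E)%E.
Proof.
move=> FB mM mM' M0 M0' eqM le; set Pl := [set w | pulled a i t w].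
have mPl : measurable Pl by apply: Fm (pulled_in t i).
have mB : measurable B by exact: Fm FB.
have mBP : measurable (B `&` Pl) by exact: measurableI.
have mBD : measurable (B `\` Pl) by exact: measurableD.
have dBP : [disjoint B `&` Pl & B `\` Pl] by apply/disj_setPS => w [[_ ?] [_ ?]].
have E (f : Omega -> R) : measurable_fun setT f -> (forall w, 0 <= f w) ->
    (\int[P]_(w in B) (f w)%:E = \int[P]_(w in B `&` Pl) (f w)%:E + \int[P]_(w in B `\` Pl) (f w)%:E)%E.
  move=> mf f0; rewrite -ge0_integral_setU ?setUIDK//.
  - by apply/measurable_EFinP; exact: measurable_funTS.
  - by move=> w _; rewrite lee_fin.
rewrite E// [leRHS]E//; apply: leeD => //.
rewrite (eq_integral (fun w => (M w)%:E))// => w; rewrite inE => -[_ /negP h].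
by rewrite eqM.
Qed.

Let meta t i : measurable_fun setT (fun w => eta t i w).
Proof.
apply: measurable_funB => //; apply: (measurable_sub_sigma (@Fm t)).
by apply: ad_dotv => k; [exact: ad_x|exact: measurable_cst].
Qed.

Definition sq_mart (l : R) t i w : R :=
  expR (l * noise_sq t i w - l ^+ 2 * sg ^+ 2 / 2 * (Tcount a i t w)%:R).

Lemma ad_sq_mart l t i : ad t (sq_mart l t i).
Proof.
apply: measurableT_comp => //; apply: measurable_funB; apply: measurable_funM => //.
  exact: ad_noise_sq.
exact: ad_Tcount.
Qed.

Lemma sq_mart_super l t i B : F t B ->
  (\int[P]_(w in B) (sq_mart l t.+1 i w)%:E <= \int[P]_(w in B) (sq_mart l t i w)%:E)%E.
Proof.
move=> FB; apply: (@integral_pulled_split t i B (sq_mart l t i) (sq_mart l t.+1 i) FB) => //.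
- by apply: (measurable_sub_sigma (@Fm t)); exact: ad_sq_mart.
- by apply: (measurable_sub_sigma (@Fm t.+1)); exact: ad_sq_mart.
- by move=> w; exact: expR_ge0.
- by move=> w; exact: expR_ge0.
- by move=> w /negbTE pt; rewrite /sq_mart noise_sqS TcountS pt addn0.
set D := B `&` _; have mD : measurable D by apply: measurableI; [exact: Fm FB|exact: Fm (pulled_in t i)].
rewrite (eq_integral (fun w => (sq_mart l t i w * expR (cst l w * (eta t i w ^+ 2 - s2 i)
    - cst l w ^+ 2 * sg ^+ 2 / 2))%:E)); last first.
  move=> w; rewrite inE => -[_ /= pt]; rewrite /sq_mart noise_sqS TcountS pt -expRD.
  by congr (expR _)%:E; rewrite natrD/=; ring.
apply: (subG_weight1 (@Fm t) (sF t) mD) => //.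
- by apply: measurable_funB => //; exact: measurable_funX.
- move=> A FA l'; rewrite /D setIA; apply: subG2; apply: condsets_pulled.
  exact: filtration_setI.
- exact: ad_sq_mart.
- by move=> w; exact: expR_ge0.
Qed.

Definition vec_mart t i w : R :=
  expR (noise_norm2 t i w / (2 * sg ^+ 2) - ln (\det (Amat x a i t w)) / 2).

Lemma ad_vec_mart t i : ad t (vec_mart t i).
Proof.
apply: measurableT_comp => //; apply: measurable_funB; apply: measurable_funM => //.
  exact: ad_noise_norm2.
by apply: measurableT_comp => //; exact: ad_det.
Qed.

Lemma vec_mart_super t i B : F t B ->
  (\int[P]_(w in B) (vec_mart t.+1 i w)%:E <= \int[P]_(w in B) (vec_mart t i w)%:E)%E.
Proof.
move=> FB; apply: (@integral_pulled_split t i B (vec_mart t i) (vec_mart t.+1 i) FB).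
- by apply: (measurable_sub_sigma (@Fm t)); exact: ad_vec_mart.
- by apply: (measurable_sub_sigma (@Fm t.+1)); exact: ad_vec_mart.
- by move=> w; exact: expR_ge0.
- by move=> w; exact: expR_ge0.
- by move=> w /negbTE pt; rewrite /vec_mart /noise_norm2 noise_vecS AmatS pt.
set D := B `&` _; have mD : measurable D by apply: measurableI; [exact: Fm FB|exact: Fm (pulled_in t i)].
pose q w := dotv (noise_vec t i w) (invmx (Amat x a i t w) *m x t i w).
pose c w := 1 + snorm2 t i w.
have s0 w : 0 <= snorm2 t i w by exact: (Ainv_ge0 (L := fun t => L t i w)).
have c0 w : 0 < c w by rewrite /c ltr_pwDl.
have adq : ad t q by apply: ad_Ainv => k; [exact: ad_noise_vec|exact: ad_x].
have adc : ad t c by apply: measurable_funD => //; exact: ad_snorm2.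
(* [al] and [b] are read off the linear and quadratic coefficients of the noise in
   [vec_mart_exponent], and [W] collects the rest. With this [b], [1 - b^2 sg^2 = 1 / c]: it is
   positive, and its square root compensates the growth of the determinant. *)
pose W w := vec_mart t i w * expR (- (q w ^+ 2 / (2 * sg ^+ 2 * c w)) - ln (c w) / 2).
pose al w := q w / (sg ^+ 2 * c w).
pose b w := Num.sqrt (snorm2 t i w / c w) / sg.
have sg2 : sg ^+ 2 != 0 by rewrite expf_neq0// gt_eqF.
have bE w : b w ^+ 2 = snorm2 t i w / (c w * sg ^+ 2).
  by rewrite /b expr_div_n sqr_sqrtr ?(divr_ge0 (s0 w) (ltW (c0 w)))// (invfM (c w) (sg ^+ 2)) mulrA.
have kE w : 1 - b w ^+ 2 * sg ^+ 2 = (c w)^-1.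
  have cn : c w != 0 by rewrite gt_eqF.
  have -> : b w ^+ 2 * sg ^+ 2 = (c w - 1) / c w.
    rewrite bE (_ : snorm2 t i w = c w - 1); last by rewrite /c addrC addKr.
    move: (c w) (sg ^+ 2) cn sg2 => cc gg cc0 gg0; field.
    by rewrite cc0 gg0.
  by rewrite mulrBl divff// mul1r opprB addrC subrK.
rewrite (eq_integral (fun w => (W w * expR (al w * eta t i w + (b w * eta t i w) ^+ 2 / 2))%:E)); last first.
  move=> w; rewrite inE => -[_ /= pt]; congr EFin.
  rewrite /W /vec_mart -!expRD; congr expR.
  have LAw u := LA u i w.
  rewrite (det_AmatS LAw) pt lnM ?posrE; last 2 first.
  - exact: det_Amat_gt0 LAw t.
  - exact: c0.
  rewrite noise_norm2S// -/(q w) exprMn bE.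
  have cE : snorm2 t i w = c w - 1 by rewrite /c addrC addKr.
  have -> : 1 + dotv (x t i w) (invmx (Amat x a i t w) *m x t i w) = c w by [].
  rewrite cE.
  by apply: vec_mart_exponent; rewrite ?gt_eqF.
rewrite [leRHS](eq_integral (fun w => (W w * ((Num.sqrt (1 - b w ^+ 2 * sg ^+ 2))^-1 *
        expR (al w ^+ 2 * sg ^+ 2 / (2 * (1 - b w ^+ 2 * sg ^+ 2)))))%:E)); last first.
  move=> w _; congr EFin; rewrite kE sqrtrV ?ltW// invrK.
  have -> : Num.sqrt (c w) = expR (ln (c w) / 2).
    rewrite -[in LHS](@lnK _ (c w)) ?posrE// [in LHS](_ : ln (c w) = ln (c w) / 2 + ln (c w) / 2); last by field.
    by rewrite expRD -expr2 sqrtr_sqr ger0_norm// expR_ge0.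
  have E := vec_mart_cancel (q w) (ln (c w)) (lt0r_neq0 (c0 w)) (lt0r_neq0 sg0).
  by rewrite /W -[RHS]mulrA /al E mulr1.
apply: (subG_quadratic (@Fm t) (sF t) mD).
- exact: meta.
- move=> A FA l'; rewrite /D setIA; apply: subG1; apply: condsets_pulled.
  exact: filtration_setI.
- apply: measurable_funM; first exact: adq.
  apply: measurable_funVr; apply: measurable_funM; [exact: measurable_cst|exact: adc].
- apply: measurable_funM; last exact: measurable_cst.
  apply: (measurableT_comp measurable_sqrtr).
  by apply: measurable_funM; [exact: ad_snorm2|apply: measurable_funVr; exact: adc].
- apply: measurable_funM; first exact: ad_vec_mart.
  apply: (measurableT_comp (@measurable_expR R)); apply: measurable_funB; last first.
    by apply: measurable_funM; [apply: (measurableT_comp (@measurable_ln R)); exact: adc|exact: measurable_cst].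
  apply: measurable_funN; apply: measurable_funM; first by apply: measurable_funX; exact: adq.
  by apply: measurable_funVr; apply: measurable_funM; [exact: measurable_cst|exact: adc].
- by move=> w; rewrite mulr_ge0 ?expR_ge0.
- by move=> w; rewrite -subr_gt0 kE invr_gt0.
Qed.

Lemma noise_norm2_whp (c : R) (T : nat) i : 0 < c ->
  (P [set w | exists2 t, (t <= T)%N & (c <= vec_mart t i w)%R] <= (c^-1)%:E)%E.
Proof.
move=> c0; apply: (@ville _ _ _ P F Fm sF FS (fun t w => vec_mart t i w)); last exact: c0.
- by move=> t; exact: ad_vec_mart.
- by move=> t w; exact: expR_ge0.
- by move=> w; rewrite /vec_mart /noise_norm2 /noise_vec big_geq// dotv0l mul0r Amat0 det1 ln1 mul0r subr0 expR0.
- by move=> t A FA; exact: vec_mart_super.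
Qed.

Lemma noise_sq_whp (c l : R) (T : nat) i : 0 < c ->
  (P [set w | exists2 t, (t <= T)%N & (c <= sq_mart l t i w)%R] <= (c^-1)%:E)%E.
Proof.
move=> c0; apply: (@ville _ _ _ P F Fm sF FS (fun t w => sq_mart l t i w)); last exact: c0.
- by move=> t; exact: ad_sq_mart.
- by move=> t w; exact: expR_ge0.
- by move=> w; rewrite /sq_mart /noise_sq /Tcount !big_geq// !mulr0 subr0 expR0.
- by move=> t A FA; exact: sq_mart_super.
Qed.

End Supermartingales.
End Adapted.

(** * Gaussian boxes at a random location *)

Lemma normal_prob_itv_ge {R : realType} (y m : R) : 0 <= m ->
  (forall z, y <= z <= y + 1 -> `|z| <= m) ->
  ((normal_peak 1 * expR (- (m ^+ 2 / 2)))%:E <= (normal_prob 0 1 `[y, (y + 1)]%classic)%R)%E.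
Proof.
move=> m0 zm; rewrite /normal_prob; set I : set R := `[y, y + 1]%classic%R.
have E : ((normal_peak 1 * expR (- (m ^+ 2 / 2)))%:E =
    \int[lebesgue_measure]_(z in I) (cst (normal_peak 1 * expR (- (m ^+ 2 / 2)))%:E z))%E.
  have mI : (lebesgue_measure I = 1)%E.
    by rewrite lebesgue_measure_itv/= lte_fin ltrDl ltr01 -EFinB addrAC subrr add0r.
  transitivity ((normal_peak 1 * expR (- (m ^+ 2 / 2)))%:E * lebesgue_measure I)%E.
    by rewrite mI mule1.
  by rewrite integral_cst//; exact: measurable_itv.
rewrite E; apply: ge0_le_integral => //.
- exact: measurable_itv.
- by move=> z _; rewrite lee_fin mulr_ge0 ?expR_ge0 ?normal_peak_ge0.
- by apply/measurable_EFinP; apply: measurable_funTS; exact: measurable_normal_pdf.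
- move=> z; rewrite /I /= in_itv/= => /zm zm'; rewrite lee_fin normal_pdfE ?oner_eq0//.
  rewrite ler_wpM2l ?normal_peak_ge0// /normal_fun ler_expR subr0 expr1n mulNr lerN2.
  rewrite ler_wpM2r// -[z ^+ 2]real_normK ?num_real//.
  by rewrite ler_sqr ?nnegrE.
Qed.

(** Chernoff bound with tilt 1 instead of the optimal [q]: an exponent linear in [q] is enough
    because [qmax] contains a full logarithm. The sign [b] treats both tails at once. *)
Lemma normal_prob_gt_le {R : realType} (q b : R) : b ^+ 2 = 1 ->
  (normal_prob 0 1 [set z : R | q <= b * z]%R <= (expR (2^-1 - q))%:E)%E.
Proof.
move=> b1; rewrite /normal_prob; set S : set R := [set z : R | q <= b * z]%R.
have mS : measurable S.
  by rewrite -[X in measurable X]setTI; apply: measurable_fun_le => //; exact: measurable_funM.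
apply: (@le_trans _ _ (\int[lebesgue_measure]_(z in S)
    ((expR (2^-1 - q))%:E * (normal_pdf b 1 z)%:E))%E).
  apply: ge0_le_integral => //.
  - by move=> z _; rewrite lee_fin normal_pdf_ge0.
  - by apply/measurable_EFinP; apply: measurable_funTS; exact: measurable_normal_pdf.
  - apply: measurable_funTS; apply/measurable_EFinP; apply: measurable_funM => //.
    exact: measurable_normal_pdf.
  - move=> z /= qz; rewrite -EFinM lee_fin.
    have := gauss_mgf_id b z; rewrite b1 mul1r => E.
    rewrite expRD mulrAC -E -mulrA -expRD ler_peMr ?normal_pdf_ge0//.
    by rewrite -expR0 ler_expR subr_ge0.
apply: (@le_trans _ _ (\int[lebesgue_measure]_z
    ((expR (2^-1 - q))%:E * (normal_pdf b 1 z)%:E))%E).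
  apply: ge0_subset_integral => //.
    apply/measurable_EFinP; apply: measurable_funM => //.
    exact: measurable_normal_pdf.
  by move=> z _; rewrite lee_fin mulr_ge0 ?expR_ge0 ?normal_pdf_ge0.
rewrite ge0_integralZl_EFin ?expR_ge0//.
- by rewrite integral_normal_pdf mule1.
- by move=> z _; rewrite lee_fin normal_pdf_ge0.
- by apply/measurable_EFinP; exact: measurable_normal_pdf.
Qed.

Lemma normal_prob_tail {R : realType} (q : R) :
  ((normal_prob 0 1 (~` `[- q, q]%classic))%R <= (2 * expR (2^-1 - q))%:E)%E.
Proof.
have h1 := normal_prob_gt_le q (expr1n R 2).
have h2 := @normal_prob_gt_le R q (-1) (sqrr_sign _ 1).
have mS (b : R) : measurable [set z : R | q <= b * z].
  by rewrite -[X in measurable X]setTI; apply: measurable_fun_le => //; exact: measurable_funM.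
apply: (@le_trans _ _ (normal_prob 0 1 ([set z : R | q <= 1 * z] `|` [set z : R | q <= (-1) * z]))%R).
  apply: le_measure; rewrite ?inE//.
  - exact: measurableC.
  - by apply: measurableU; exact: mS.
  - move=> z /=; rewrite in_itv/= => /negP; rewrite negb_and -!ltNge mul1r mulN1r lerNr => /orP[h|h].
      by right; exact: ltW.
    by left; exact: ltW.
apply: le_trans (measureU2 _ _ _) _; [exact: mS|exact: mS|].
by rewrite mulr_natl EFinD; exact: leeD.
Qed.

Lemma prode_ge {R : realType} (I : Type) (s : seq I) (f : I -> \bar R) (g : I -> R) :
  (forall i, 0 <= g i) -> (forall i, (g i)%:E <= f i)%E ->
  ((\prod_(i <- s) g i)%:E <= \prod_(i <- s) f i)%E.
Proof.
move=> g0 gf; elim: s => [|i s IH]; first by rewrite !big_nil.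
rewrite !big_cons EFinM; apply: lee_pmul => //.
- by rewrite lee_fin g0.
- by rewrite lee_fin prodr_ge0.
Qed.

Section Rectangles.
Context {dO : measure_display} {Omega : measurableType dO} {R : realType} {d K : nat}.
Variables (P : probability Omega R) (G : set (set Omega)).
Variables (Z : 'I_K -> Omega -> 'cV[R]_d) (xi : 'I_K -> Omega -> R).
Hypothesis Gm : G `<=` measurable.
Hypothesis sG : sigma_algebra [set: Omega] G.
Hypothesis mZ : forall i (k : 'I_d), measurable_fun [set: Omega] (fun w => Z i w k 0).
Hypothesis mxi : forall i, measurable_fun [set: Omega] (xi i).

Definition rect (B : 'I_K -> 'I_d -> set R) (C : 'I_K -> set R) : set Omega :=
  [set w | forall i : 'I_K, (forall k : 'I_d, B i k (Z i w k 0)) /\ C i (xi i w)].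

Hypothesis indep : forall A, G A ->
  forall (B : 'I_K -> 'I_d -> set R) (C : 'I_K -> set R),
  (forall i k, measurable (B i k)) -> (forall i, measurable (C i)) ->
  P (A `&` rect B C) = (P A * \prod_(i < K) ((\prod_(k < d) normal_prob 0 1 (B i k))
                               * normal_prob 0 1 (C i)))%E.

Lemma measurable_rect (B : 'I_K -> 'I_d -> set R) (C : 'I_K -> set R) :
  (forall i k, measurable (B i k)) -> (forall i, measurable (C i)) ->
  measurable (rect B C).
Proof.
move=> mB mC.
have -> : rect B C = \bigcap_(i in [set: 'I_K])
    ((\bigcap_(k in [set: 'I_d]) ((fun w => Z i w k 0) @^-1` B i k)) `&` (xi i @^-1` C i)).
  apply/seteqP; split=> w h.
    by move=> i _; have [h1 h2] := h i; split => // k _; exact: h1.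
  by move=> i; have [h1 h2] := h i I; split => // k; exact: h1.
apply: fin_bigcap_measurable => // i _; apply: measurableI.
  apply: fin_bigcap_measurable => // k _.
  by rewrite -[_ @^-1` _]setTI; exact: mZ.
by rewrite -[_ @^-1` _]setTI; exact: mxi.
Qed.

Section RandomRectangle.
Variables (I : countType) (c : Omega -> I) (B : I -> 'I_K -> 'I_d -> set R) (C : I -> 'I_K -> set R).
Variable p : R.
Hypothesis p0 : 0 <= p.
Hypothesis Gc : forall j, G (c @^-1` [set j]).
Hypothesis mB : forall j i k, measurable (B j i k).
Hypothesis mC : forall j i, measurable (C j i).
Hypothesis pBC : forall w, (p%:E <= \prod_(i < K) ((\prod_(k < d) normal_prob 0 1 (B (c w) i k))
                               * normal_prob 0 1 (C (c w) i)))%E.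

Definition random_rect : set Omega := [set w | rect (B (c w)) (C (c w)) w].

Lemma random_rect_cell j :
  random_rect `&` c @^-1` [set j] = c @^-1` [set j] `&` rect (B j) (C j).
Proof.
apply/seteqP; split=> w [] /=; rewrite /random_rect/=; first by move=> h cj; rewrite -cj.
by move=> <- h.
Qed.

Lemma measurable_random_rect : measurable random_rect.
Proof.
have -> : random_rect = \bigcup_n (if unpickle n is Some j
    then c @^-1` [set j] `&` rect (B j) (C j) else set0).
  apply/seteqP; split=> w.
    by move=> h; exists (pickle (c w)) => //; rewrite pickleK.
  move=> [n _]; case: unpickle => // j; rewrite -random_rect_cell.
  by case.
apply: bigcupT_measurable => n; case: unpickle => // j.
by apply: measurableI; [exact: Gm|exact: measurable_rect].
Qed.

(** The box depends on the past only through the countable code [c]. On a cell of the code it is a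
    fixed rectangle, to which the product formula applies; [le_integral_weight] then inserts the
    predictable weight. *)
Lemma integral_random_rect_ge (W : Omega -> R) :
  measurable_fun [set: g_sigma_algebraType G] W -> (forall w, 0 <= W w) ->
  (\int[P]_w (W w * p)%:E <= \int[P]_w (W w * \1_random_rect w)%:E)%E.
Proof.
move=> mW W0; have mR := measurable_random_rect.
apply: (@le_integral_weight _ _ _ P G Gm sG _ (cst p)) => //.
- rewrite integral_indic// setIT (le_lt_trans (probability_le1 _ _))//.
  exact: ltry.
move=> A GA; rewrite setIT.
have mA := Gm GA.
apply: (ge0_le_integral_partition (mu := P) (c := c)) => //.
- by move=> j; exact: Gm.
- by apply/measurable_EFinP; exact: measurable_cst.
- by apply/measurable_EFinP; apply: measurable_funTS; exact: measurable_indic.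
move=> j; have mAj : measurable (A `&` c @^-1` [set j]) by apply: measurableI => //; exact: Gm.
have -> : (\int[P]_(w in A `&` c @^-1` [set j]) (cst p w)%:E = p%:E * P (A `&` c @^-1` [set j]))%E.
  exact: (integral_cst P mAj p%:E).
rewrite integral_indic//.
have -> : random_rect `&` (A `&` c @^-1` [set j]) = (A `&` c @^-1` [set j]) `&` rect (B j) (C j).
  by rewrite setICA random_rect_cell setIA.
have GAj : G (A `&` c @^-1` [set j]).
  by apply: sigma_in => //; apply: (@measurableI _ (g_sigma_algebraType G)); exact: sub_sigma_algebra.
(* [pBC] speaks of the codes that are attained, so an empty cell is treated apart. *)
have [->|/set0P[w [Aw /= cw]]] := eqVneq (A `&` c @^-1` [set j]) set0.
  by rewrite set0I measure0 mule0.
rewrite indep// muleC; apply: lee_wpmul2l => //.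
by rewrite -cw; exact: pBC.
Qed.

End RandomRectangle.

Let GT : G setT.
Proof. by have [h0 hD _] := sG; have := hD _ h0; rewrite setD0. Qed.

(** The marginal law of one coordinate is read off the product formula by leaving all the others
    free. *)
Lemma coord_tail_Z (q : R) i k :
  (P [set w | ~ (`|Z i w k 0| <= q)%R] <= (2 * expR (2^-1 - q))%:E)%E.
Proof.
pose B (i' : 'I_K) (k' : 'I_d) : set R := if (i' == i) && (k' == k) then ~` `[- q, q]%classic else setT.
have -> : [set w | ~ (`|Z i w k 0| <= q)%R] = setT `&` rect B (fun=> setT).
  rewrite setTI; apply/seteqP; split=> w /=.
    move=> h i'; split => // k'; rewrite /B; case: ifP => // /andP[/eqP -> /eqP ->] /=.
    by rewrite in_itv/= -ler_norml.
  by move=> /(_ i)[/(_ k) + _]; rewrite /B !eqxx/= in_itv/= -ler_norml.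
rewrite indep//; last by move=> i' k'; rewrite /B; case: ifP => // _; exact: measurableC.
rewrite probability_setT mul1e (bigD1 i)//= [X in (_ * X)%E]big1 ?mule1; last first.
  move=> i' /negbTE i'i; rewrite probability_setT mule1 big1// => k' _.
  by rewrite /B i'i probability_setT.
rewrite probability_setT mule1 (bigD1 k)//= [X in (_ * X)%E]big1 ?mule1; last first.
  by move=> k' /negbTE k'k; rewrite /B k'k andbF probability_setT.
by rewrite /B !eqxx; exact: normal_prob_tail.
Qed.

Lemma coord_tail_xi (q : R) i :
  (P [set w | ~ (`|xi i w| <= q)%R] <= (2 * expR (2^-1 - q))%:E)%E.
Proof.
pose C (i' : 'I_K) : set R := if i' == i then ~` `[- q, q]%classic else setT.
have -> : [set w | ~ (`|xi i w| <= q)%R] = setT `&` rect (fun _ _ => setT) C.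
  rewrite setTI; apply/seteqP; split=> w /=.
    move=> h i'; split => //; rewrite /C; case: ifP => // /eqP -> /=.
    by rewrite in_itv/= -ler_norml.
  by move=> /(_ i)[_]; rewrite /C !eqxx/= in_itv/= -ler_norml.
rewrite indep//; last by move=> i'; rewrite /C; case: ifP => // _; exact: measurableC.
rewrite probability_setT mul1e (bigD1 i)//= [X in (_ * X)%E]big1 ?mule1; last first.
  move=> i' /negbTE i'i; rewrite /C i'i probability_setT mule1 big1//.
rewrite big1 ?mul1e; last by move=> k' _; rewrite probability_setT.
by rewrite /C !eqxx; exact: normal_prob_tail.
Qed.

End Rectangles.

(* A box carrying mass at least [p], inside which [<Z, y> >= c1 |y|] and [xi <= - c2]. The
   integer code [j k] is the floor of [c1 y_k / |y|]. *)
Section Box.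
Context {R : realType} {d K : nat}.

(** A unit interval lying beyond every real of floor [j], on the side away from 0 and within
    distance 2 of it. When that real is a positive multiple of [y], moving outward increases the
    product with [y], so inner products can be bounded below coordinate by coordinate. *)
Definition code_itv (j : int) : set R :=
  if 0 <= j then `[j%:~R + 1, j%:~R + 1 + 1]%classic else `[j%:~R - 1, j%:~R - 1 + 1]%classic.

Lemma measurable_code_itv j : measurable (code_itv j).
Proof. by rewrite /code_itv; case: ifP. Qed.

Lemma code_itvP (th : R) : exists y, code_itv (Num.floor th) = `[y, y + 1]%classic /\
  (forall z, y <= z <= y + 1 -> (`|z| <= `|th| + 2) /\ (if 0 <= th then th <= z else z <= th)).
Proof.
have h1 := floor_le th; have h2 := floorD1_gt th; rewrite intrD in h2.
rewrite /code_itv floor_ge0; case: ifPn => [th0|].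
  exists ((Num.floor th)%:~R + 1); split => // z /andP[z1 z2].
  by rewrite (ger0_norm th0) ger0_norm; lra.
rewrite -ltNge => th0; exists ((Num.floor th)%:~R - 1); split => // z /andP[z1 z2].
by rewrite (ltr0_norm th0) ler0_norm; lra.
Qed.

Lemma code_itv_sign (a y z : R) : 0 < a -> code_itv (Num.floor (a * y)) z -> a * y * y <= z * y.
Proof.
move=> a0; have [b [-> h]] := code_itvP (a * y); rewrite /= in_itv/= => /h[_].
rewrite pmulr_rge0//; case: ifPn => [y0 le|]; first exact: ler_wpM2r.
by rewrite -ltNge => y0 le; apply: ler_wnM2r => //; exact: ltW.
Qed.

Lemma code_itv_norm (th z : R) : code_itv (Num.floor th) z -> `|z| <= `|th| + 2.
Proof. by have [b [-> h]] := code_itvP th; rewrite /= in_itv/= => /h[]. Qed.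

Lemma code_itv_neg (th z : R) : th < 0 -> code_itv (Num.floor th) z -> z <= th.
Proof. by move=> th0; have [b [-> h]] := code_itvP th; rewrite /= in_itv/= => /h[_]; rewrite leNgt th0. Qed.

(** The 4 comes from [(c + 2)^2 / 2 <= c^2 + 4], applied to an interval within distance 2 of a
    threshold of absolute value [c]. *)
Definition kap : R := normal_peak 1 * expR (- 4).

Lemma kap_gt0 : 0 < kap.
Proof. by rewrite mulr_gt0 ?expR_gt0// normal_peak_gt0. Qed.

Lemma normal_prob_code (th : R) :
  ((kap * expR (- th ^+ 2))%:E <= (normal_prob 0 1 (code_itv (Num.floor th)))%R)%E.
Proof.
have [b [-> h]] := code_itvP th.
apply: le_trans (@normal_prob_itv_ge _ b (`|th| + 2) _ _); last 2 first.
- by rewrite addr_ge0.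
- by move=> z /h[].
rewrite lee_fin /kap -mulrA -expRD ler_wpM2l ?normal_peak_ge0// ler_expR.
rewrite -[th ^+ 2]real_normK ?num_real//; have := sqr_ge0 (`|th| - 2).
by move: `|th| => c; rewrite sqrrB sqrrD; lra.
Qed.

Lemma normal_prob_sym (q : R) : 1 <= q -> (kap%:E <= (normal_prob 0 1 `[- q, q]%classic)%R)%E.
Proof.
move=> q1; apply: (@le_trans _ _ (normal_prob 0 1 (`[0, 0 + 1]%classic%R : set R))).
  apply: le_trans (@normal_prob_itv_ge _ 0 1 _ _) => //.
    by rewrite lee_fin /kap ler_wpM2l ?normal_peak_ge0// ler_expR expr1n; lra.
  by move=> z; rewrite add0r => /andP[z0 z1]; rewrite ger0_norm.
apply: le_measure; rewrite ?inE//.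
by apply: subset_itv; rewrite bnd_simp; lra.
Qed.

(** Arms other than [i0] are merely truncated, at a cost that does not depend on [q]; the box thus
    bounds all the draws, which keeps the scores of the other arms close to their mean-variances. *)
Definition boxB (q : R) (i0 : 'I_K) (j : 'I_d -> int) (i : 'I_K) (k : 'I_d) : set R :=
  if i == i0 then code_itv (j k) else `[- q, q]%classic.

Definition boxC (q c2 : R) (i0 i : 'I_K) : set R :=
  if i == i0 then code_itv (Num.floor (- c2)) else `[- q, q]%classic.

Lemma measurable_boxB q i0 j i k : measurable (boxB q i0 j i k).
Proof. by rewrite /boxB; case: ifP => // _; exact: measurable_code_itv. Qed.

Lemma measurable_boxC q c2 i0 i : measurable (boxC q c2 i0 i).
Proof. by rewrite /boxC; case: ifP => // _; exact: measurable_code_itv. Qed.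

(** Each of the [(d + 1) K] coordinates costs a factor [kap], while exponentials come only from arm
    [i0], where the squares of the thresholds add up to at most [c1^2 + c2^2] whatever the
    dimension. *)
Lemma box_prob (q c1 c2 : R) (i0 : 'I_K) (th : 'I_d -> R) :
  1 <= q -> \sum_k th k ^+ 2 <= c1 ^+ 2 ->
  ((kap ^+ (d.+1 * K) * expR (- (c1 ^+ 2 + c2 ^+ 2)))%:E <=
   \prod_(i < K) ((\prod_(k < d) normal_prob 0 1 (boxB q i0 (fun k => Num.floor (th k)) i k))
      * normal_prob 0 1 (boxC q c2 i0 i)))%E.
Proof.
move=> q1 thc; have k0 := kap_gt0.
pose g (i : 'I_K) : R := (\prod_(k < d) (kap * expR (- (if i == i0 then th k else 0) ^+ 2)))
  * (kap * expR (- (if i == i0 then c2 else 0) ^+ 2)).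
have g0 (b : R) : 0 <= kap * expR b by rewrite mulr_ge0 ?expR_ge0// ltW.
apply: (@le_trans _ _ (\prod_(i < K) g i)%:E); last first.
  apply: prode_ge => i; first by rewrite mulr_ge0// prodr_ge0.
  rewrite /g EFinM; apply: lee_pmul.
  - by rewrite lee_fin prodr_ge0.
  - by rewrite lee_fin.
  - apply: prode_ge => // k; rewrite /boxB; case: ifP => _; first exact: normal_prob_code.
    by rewrite expr0n oppr0 expR0 mulr1; exact: normal_prob_sym.
  - rewrite /boxC; case: ifP => _; first by rewrite -sqrrN; exact: normal_prob_code.
    by rewrite expr0n oppr0 expR0 mulr1; exact: normal_prob_sym.
rewrite lee_fin; have -> : \prod_(i < K) g i = \prod_(i < K) (kap ^+ d.+1 *
    expR (- (if i == i0 then \sum_k th k ^+ 2 + c2 ^+ 2 else 0))).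
  apply: eq_bigr => i _; rewrite /g big_split/= prodr_const card_ord -expR_sum.
  rewrite mulrACA -exprSr -expRD; congr (_ * expR _); case: ifP => _.
    by rewrite sumrN opprD.
  by rewrite big1 ?expr0n ?oppr0 ?addr0// => k _; rewrite expr0n oppr0.
rewrite big_split/= prodr_const card_ord -exprM.
rewrite -expR_sum.
apply: ler_wpM2l; first by rewrite exprn_ge0// ltW.
rewrite ler_expR.
rewrite sumrN lerN2 -big_mkcond/= big_pred1_eq.
by rewrite lerD2r.
Qed.

End Box.

Section Codes.
Context {Omega : pointedType}.
Variable G : set (set Omega).
Hypothesis sG : sigma_algebra [set: Omega] G.

Lemma sigma_setI (A B : set Omega) : G A -> G B -> G (A `&` B).
Proof.
move=> GA GB; apply: sigma_in => //.
by apply: (@measurableI _ (g_sigma_algebraType G)); exact: sub_sigma_algebra.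
Qed.

Lemma sigma_ffun (I : finType) (T : countType) (f : I -> Omega -> T) :
  (forall i j, G (f i @^-1` [set j])) ->
  forall j, G ((fun w => [ffun i => f i w]) @^-1` [set j : {ffun I -> T}]).
Proof.
move=> Gf j.
have -> : (fun w => [ffun i => f i w]) @^-1` [set j] = \bigcap_(i in [set: I]) (f i @^-1` [set j i]).
  apply/seteqP; split=> w /=; first by move=> <- i _ /=; rewrite ffunE.
  by move=> h; apply/ffunP => i; rewrite ffunE; exact: h.
apply: sigma_in => //; apply: (@fin_bigcap_measurable _ (g_sigma_algebraType G)) => // i _.
exact: sub_sigma_algebra.
Qed.

Lemma sigma_pair (I J : eqType) (f : Omega -> I) (g : Omega -> J) :
  (forall j, G (f @^-1` [set j])) -> (forall j, G (g @^-1` [set j])) ->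
  forall j, G ((fun w => (f w, g w)) @^-1` [set j]).
Proof.
move=> Gf Gg [i j].
have -> : (fun w => (f w, g w)) @^-1` [set (i, j)] = (f @^-1` [set i]) `&` (g @^-1` [set j]).
  by apply/seteqP; split=> w /= [-> ->].
exact: sigma_setI.
Qed.

End Codes.

(** * Regret along a path *)

Section Round.
Context {R : realType} {K : nat}.
Variables (MVi score wd : 'I_K -> R) (a0 : 'I_K) (W0 : R).

Definition gap (j : 'I_K) : R := \big[Num.max/0]_(i < K) (MVi i - MVi j).
(** [W0] will dominate all the widths, so that saturated arms and the initial value are neutral in
    the minimum. *)
Definition min_unsat : R := \big[Num.min/W0]_(i < K) (if gap i <= wd i then wd i else W0).

Lemma gap_ge0 j : 0 <= gap j.
Proof. by apply: bigmax_ge_id. Qed.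

Lemma gap_opt (o j : 'I_K) : gap o = 0 -> gap j = MVi o - MVi j.
Proof.
move=> g0; have h i : MVi i <= MVi o.
  by rewrite -subr_le0 -g0; exact: le_bigmax_cond.
apply/le_anti/andP; split; last exact: (le_bigmax_cond _ (fun i => MVi i - MVi j)).
by apply/bigmax_leP; split=> [|i _]; rewrite ?subr_ge0 ?lerD2r.
Qed.

Lemma exists_opt : exists o, gap o = 0.
Proof.
pose o := [arg max_(i > a0) MVi i]%O; exists o.
apply/le_anti; rewrite gap_ge0 andbT; apply/bigmax_leP; split => // i _.
rewrite subr_le0 /o; case: arg_maxP => // j _ h; exact: h.
Qed.

Hypothesis wd0 : forall i, 0 <= wd i.
Hypothesis wdW : forall i, wd i <= W0.
Hypothesis close : forall i, `|score i - MVi i| <= wd i.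
Hypothesis amax : forall i, score i <= score a0.

(** For an unsaturated [j] and an optimal [b], go from [MVi b] to [MVi j] at cost [wd j], to
    [score j] at cost [wd j], to [score a0] for free, and to [MVi a0] at cost [wd a0]. *)
Lemma gap_le_min_unsat : gap a0 <= 2 * min_unsat + wd a0.
Proof.
have [b g0] := exists_opt.
have key j : gap j <= wd j -> (gap a0 - wd a0) / 2 <= wd j.
  rewrite !(gap_opt _ g0); have := close j; have := close a0; have := amax j.
  rewrite !ler_norml => h /andP[h1 h2] /andP[h3 h4]; lra.
suff : (gap a0 - wd a0) / 2 <= min_unsat by lra.
apply/bigmin_geP; split.
  (* An optimal arm has gap 0 and is unsaturated, and its width is at most [W0]; this settles the
     default value. *)
  by apply: le_trans (wdW b); apply: key; rewrite g0.
move=> i _; case: ifP => [/key //|_].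
by apply: le_trans (wdW b); apply: key; rewrite g0.
Qed.

Lemma min_unsat_le (o : 'I_K) : gap o = 0 -> MVi o <= score o -> min_unsat <= wd a0.
Proof.
move=> g0 opt; have un : gap a0 <= wd a0.
  rewrite (gap_opt _ g0); have := close a0; rewrite ler_norml => /andP[_ h].
  have := amax o; lra.
by rewrite /min_unsat; apply: (@bigmin_inf _ _ _ _ a0) => //; rewrite un.
Qed.

Lemma min_unsat_ge0 : 0 <= W0 -> 0 <= min_unsat.
Proof. by move=> h; apply/bigmin_geP; split => // i _; case: ifP. Qed.

End Round.

(** * Sums of widths along a path *)

Lemma ln1Dx_ge {R : realType} (y : R) : 0 <= y <= 1 -> y <= 2 * ln (1 + y).
Proof.
move=> /andP[y0 y1]; rewrite mulrC -ler_pdivrMr//.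
rewrite -ler_expR lnK ?posrE; last by rewrite ltr_pwDl.
have h := expR_ge1Dx (- (y / 2)).
have e0 : 0 < expR (y / 2) by exact: expR_gt0.
have : expR (y / 2) * expR (- (y / 2)) = 1 by rewrite expRN divff// gt_eqF.
nra.
Qed.

(** The difference of the two roots is the inverse of their sum, and the larger root is at most
    twice the smaller, whence the 3. In this form the sum telescopes. *)
Lemma inv_sqrt_le {R : realType} (n : nat) : (0 < n)%N ->
  (Num.sqrt n%:R)^-1 <= 3 * (Num.sqrt n.+1%:R - Num.sqrt n%:R) :> R.
Proof.
move=> n0; have a0 : 0 < Num.sqrt n%:R :> R by rewrite sqrtr_gt0 ltr0n.
have b0 : 0 < Num.sqrt n.+1%:R :> R by rewrite sqrtr_gt0 ltr0n.
have aa : Num.sqrt n%:R ^+ 2 = n%:R :> R by rewrite sqr_sqrtr.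
have bb : Num.sqrt n.+1%:R ^+ 2 = n%:R + 1 :> R by rewrite sqr_sqrtr// natr1.
have n1 : 1 <= n%:R :> R by rewrite ler1n.
rewrite -[leLHS]mul1r ler_pdivrMr//.
move: (Num.sqrt _) (Num.sqrt _) aa bb a0 b0 => b a aa bb a0 b0.
have ba : b <= 2 * a by rewrite -ler_sqr ?nnegrE ?mulr_ge0 ?ltW// exprMn aa bb; lra.
have e : (b - a) * (b + a) = 1 by rewrite -subr_sqr aa bb; lra.
have ab : 0 <= b - a by nra.
nra.
Qed.

Section Paths.
Context {R : realType} {dO : measure_display} {Omega : measurableType dO} {d K : nat}.
Variables (x : nat -> 'I_K -> Omega -> 'cV[R]_d) (r : nat -> 'I_K -> Omega -> R)
  (a : nat -> Omega -> 'I_K) (L : nat -> 'I_K -> Omega -> 'M[R]_d)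
  (mu : 'I_K -> 'cV[R]_d) (s2 : 'I_K -> R)
  (Z : nat -> 'I_K -> Omega -> 'cV[R]_d) (xi : nat -> 'I_K -> Omega -> R) (w : Omega).
Hypothesis LA : forall t i w, L t i w *m (L t i w)^T = invmx (Amat x a i t w).
Hypothesis x1 : forall t i w, sqnorm (x t i w) <= 1.
Hypothesis mu1 : forall i, sqnorm (mu i) <= 1.
Local Notation sn t i := (Num.sqrt (snorm2 x a t i w)).
Local Notation cnt t i := (Tcount a i t w).
Let LAw i u : L u i w *m (L u i w)^T = invmx (Amat x a i u w). Proof. exact: LA. Qed.
Let x1w i u : sqnorm (x u i w) <= 1. Proof. exact: x1. Qed.

Lemma snorm2_ge0 t i : 0 <= snorm2 x a t i w.
Proof. exact: (Ainv_ge0 (LAw i)). Qed.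

Lemma snorm2_le1 t i : snorm2 x a t i w <= 1.
Proof. by apply: le_trans (x1w i t); exact: (Ainv_le (LAw i)). Qed.

Lemma snorm2E t i : snorm2 x a t i w = sqnorm ((L t i w)^T *m x t i w).
Proof. exact: (dotv_Ainv (LAw i)). Qed.

Lemma sn_le1 t i : sn t i <= 1.
Proof. by rewrite -[leRHS]sqrtr1 ler_wsqrtr// snorm2_le1. Qed.

Lemma Tcount_gt0 t i : (0 < t)%N -> (0 < cnt t i)%N.
Proof.
case: t => // t _; rewrite /Tcount big_mkcond big_nat_recl//= {1}/pulled/=.
Qed.

Lemma Tcount_le t i : (cnt t i <= t)%N.
Proof.
elim: t => [|t IH]; first by rewrite /Tcount big_geq.
rewrite TcountS -addn1; apply: leq_add => //; exact: leq_b1.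
Qed.

Lemma sum_snorm2_le T : \sum_(1 <= t < T.+1) snorm2 x a t (a t w) w
  <= 2 * K%:R * ln (d`!%:R * T.+2%:R ^+ d).
Proof.
(* The potential is summed over all arms: the arm pulled pays for its own term, the other terms do
   not decrease, and one telescoping sum serves all arms. *)
pose f t := \sum_(i < K) ln (\det (Amat x a i t w)).
have mono t i : ln (\det (Amat x a i t w)) <= ln (\det (Amat x a i t.+1 w)).
  rewrite ler_ln ?posrE; try exact: (det_Amat_gt0 (LAw i)).
  rewrite (det_AmatS (LAw i)); case: ifP => _ //.
  by rewrite ler_peMr ?lerDl ?(Ainv_ge0 (LAw i))// ltW// (det_Amat_gt0 (LAw i)).
have step t : (1 <= t < T.+1)%N -> snorm2 x a t (a t w) w <= 2 * (f t.+1 - f t).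
  move=> /andP[t1 _]; rewrite /f -sumrB (bigD1 (a t w))//=.
  apply: (@le_trans _ _ (2 * (ln (\det (Amat x a (a t w) t.+1 w)) - ln (\det (Amat x a (a t w) t w))))); last first.
    by rewrite ler_pM2l// lerDl; apply: sumr_ge0 => i _; rewrite subr_ge0.
  have pt : pulled a (a t w) t w by rewrite /pulled eqxx orbT.
  rewrite (det_AmatS (LAw _)) pt lnM ?posrE; last 2 first.
  - exact: (det_Amat_gt0 (LAw _)).
  - by rewrite ltr_pwDl//; exact: snorm2_ge0.
  rewrite addrAC subrr add0r; apply: ln1Dx_ge.
  by apply/andP; split; [exact: snorm2_ge0|exact: snorm2_le1].
apply: (le_trans (ler_sum_nat step)); rewrite -mulr_sumr telescope_sumr// -mulrA ler_pM2l//.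
have f0 : 0 <= f 1%N.
  apply: sumr_ge0 => i _; apply: le_trans (mono 0%N i).
  by rewrite Amat0 det1 ln1.
apply: (@le_trans _ _ (f T.+1)); first by rewrite gerBl.
rewrite -[X in _ <= X%:R * _]card_ord mulr_natl -sumr_const; apply: ler_sum => i _.
rewrite ler_ln ?posrE ?(det_Amat_gt0 (LAw _))//; first by apply: det_Amat_le => u; exact: x1w.
Qed.

(** The same telescoping with the roots of the counts as potential. Each count is bounded
    separately, which loses a factor [sqrt K], harmless since [K] is fixed while [T] grows. *)
Lemma sum_inv_sqrt_count_le T : \sum_(1 <= t < T.+1) (Num.sqrt (cnt t (a t w))%:R)^-1
  <= 3 * K%:R * Num.sqrt T.+1%:R :> R.
Proof.
pose f t : R := \sum_(i < K) Num.sqrt (cnt t i)%:R.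
have mono t i : Num.sqrt (cnt t i)%:R <= Num.sqrt (cnt t.+1 i)%:R :> R.
  by rewrite ler_wsqrtr// ler_nat TcountS leq_addr.
have step t : (1 <= t < T.+1)%N -> (Num.sqrt (cnt t (a t w))%:R)^-1 <= 3 * (f t.+1 - f t).
  move=> /andP[t1 _]; rewrite /f -sumrB (bigD1 (a t w))//=.
  apply: (@le_trans _ _ (3 * (Num.sqrt (cnt t.+1 (a t w))%:R - Num.sqrt (cnt t (a t w))%:R))); last first.
    by rewrite ler_pM2l// lerDl; apply: sumr_ge0 => i _; rewrite subr_ge0.
  have pt : pulled a (a t w) t w by rewrite /pulled eqxx orbT.
  by rewrite TcountS pt addn1; apply: inv_sqrt_le; exact: Tcount_gt0.
apply: (le_trans (ler_sum_nat step)); rewrite -mulr_sumr telescope_sumr// -mulrA ler_pM2l//.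
apply: (@le_trans _ _ (f T.+1)).
  by rewrite gerBl; apply: sumr_ge0 => i _; exact: sqrtr_ge0.
rewrite -[X in _ <= X%:R * _]card_ord mulr_natl -sumr_const; apply: ler_sum => i _.
by rewrite ler_wsqrtr// ler_nat Tcount_le.
Qed.

Lemma sum_width_le (g1 g2 : R) T : 0 <= g1 -> 0 <= g2 -> (0 < T)%N ->
  \sum_(1 <= t < T.+1) (g1 * sn t (a t w) + g2 / Num.sqrt (cnt t (a t w))%:R)
  <= g1 * (Num.sqrt T%:R * (K%:R * ln (d`!%:R * T.+2%:R ^+ d) + 1)) + g2 * (3 * K%:R * Num.sqrt T.+1%:R).
Proof.
move=> g10 g20 T0; rewrite big_split/= -!mulr_sumr; apply: lerD; last first.
  by apply: ler_wpM2l => //; exact: sum_inv_sqrt_count_le.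
apply: ler_wpM2l => //.
have sT : 0 < Num.sqrt T%:R :> R by rewrite sqrtr_gt0 ltr0n.
(* The inequality [2 z sqrt T <= T z^2 + 1], used round by round, takes the place of Cauchy-Schwarz
   on the sum. *)
have step t : (1 <= t < T.+1)%N -> sn t (a t w) <=
    Num.sqrt T%:R / 2 * snorm2 x a t (a t w) w + (Num.sqrt T%:R)^-1.
  move=> _; have s0 := snorm2_ge0 t (a t w).
  have [z -> [z0 ->]] : exists2 z, sn t (a t w) = z & 0 <= z /\ snorm2 x a t (a t w) w = z ^+ 2.
    by exists (sn t (a t w)) => //; split; [exact: sqrtr_ge0|rewrite sqr_sqrtr].
  rewrite -(ler_pM2l sT) mulrDr divff ?gt_eqF//.
  by have := sqr_ge0 (Num.sqrt T%:R * z - 1); rewrite sqrrB !expr2; nra.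
apply: (le_trans (ler_sum_nat step)); rewrite big_split/= -mulr_sumr sumr_const_nat subn1/=.
have -> : (Num.sqrt T%:R)^-1 *+ T = Num.sqrt T%:R :> R.
  rewrite -(mulr_natr (Num.sqrt T%:R)^-1 T) mulrC; apply: (mulIf (lt0r_neq0 sT)).
  by rewrite divfK ?lt0r_neq0// -expr2 sqr_sqrtr ?ler0n.
rewrite mulrDr mulr1 lerD2r -mulrA ler_pM2l//.
have := sum_snorm2_le T; move: (\sum_(_ <= _ < _) _) => S0; lra.
Qed.

Section Estimates.
Variables (t : nat) (i : 'I_K) (bQ bX : R).
Hypothesis t0 : (0 < t)%N.
Hypothesis bQ0 : 0 <= bQ.
Hypothesis hQ : noise_norm2 x r a mu t i w <= bQ.
Hypothesis hX : `|noise_sq x r a mu s2 t i w| <= bX * Num.sqrt (cnt t i)%:R.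

Let h := noise_vec x r a mu t i w - mu i.

Lemma noise_shift_norm : sqnorm ((L t i w)^T *m h) <= (Num.sqrt bQ + 1) ^+ 2.
Proof.
have q0 : sqnorm ((L t i w)^T *m noise_vec x r a mu t i w) <= Num.sqrt bQ ^+ 2.
  by rewrite sqr_sqrtr// /sqnorm -(dotv_Ainv (LAw i)).
have m0 : sqnorm ((L t i w)^T *m mu i) <= 1 ^+ 2.
  by rewrite expr1n /sqnorm -(dotv_Ainv (LAw i)); apply: le_trans (mu1 i); exact: (Ainv_le (LAw i)).
have := normr_dotv_le (sqrtr_ge0 bQ) ler01 q0 m0; rewrite ler_norml => /andP[h1 h2].
rewrite /h mulmxBr {1}/sqnorm dotvBl !dotvBr -!/(sqnorm _).
rewrite (dotvC ((L t i w)^T *m mu i)) sqrrD expr1n mulr1; rewrite expr1n in m0.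
move: (sqnorm _) (sqnorm _) (dotv _ _) q0 m0 h1 h2 => A B C; lra.
Qed.

Lemma mean_error : `|dotv (x t i w) (invmx (Amat x a i t w) *m bvec x r a i t w) - dotv (x t i w) (mu i)|
  <= sn t i * (Num.sqrt bQ + 1).
Proof.
rewrite (ridge_error (LAw i) r (mu i)) dotvDr addrAC subrr add0r -/(noise_vec x r a mu t i w) -/h.
rewrite (dotv_Ainv (LAw i)); apply: normr_dotv_le.
- exact: sqrtr_ge0.
- by rewrite addr_ge0// sqrtr_ge0.
- by rewrite sqr_sqrtr ?snorm2_ge0// snorm2E.
- exact: noise_shift_norm.
Qed.

(** The quadratic form in the residual can only lower the estimate, so [bQ] appears on the lower
    side alone. Optimism uses the upper side; closeness uses both. *)
Lemma var_error : let e := Dstat x r a i t w / @Cstat R Omega K a i t w - s2 i in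
  e <= (1 + bX) / Num.sqrt (cnt t i)%:R /\
  - ((bX + (Num.sqrt bQ + 1) ^+ 2) / Num.sqrt (cnt t i)%:R) <= e.
Proof.
rewrite /Dstat /Cstat (ridge_residual (LAw i) r (mu i)) -/(noise_vec x r a mu t i w) -/h.
have H1 := noise_shift_norm; have H0 := sqnorm_ge0 ((L t i w)^T *m h).
rewrite (dotv_Ainv (LAw i)) -/(sqnorm ((L t i w)^T *m h)).
have n1 : 1 <= (cnt t i)%:R :> R by rewrite ler1n; exact: Tcount_gt0.
have n0 : 0 < (cnt t i)%:R :> R by exact: lt_le_trans n1.
have E : \sum_(0 <= s < t | pulled a i s w) (r s i w - dotv (x s i w) (mu i)) ^+ 2 =
    noise_sq x r a mu s2 t i w + (cnt t i)%:R * s2 i.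
  have Es : \sum_(0 <= s < t | pulled a i s w) s2 i = (cnt t i)%:R * s2 i.
    by rewrite /Tcount natr_sum mulr_suml; apply: eq_bigr => s _; rewrite mul1r.
  by rewrite /noise_sq sumrB Es subrK.
rewrite E; have m1 := mu1 i; have m0 := sqnorm_ge0 (mu i).
have X1 := hX; move: X1; rewrite ler_norml => /andP[X1 X2].
have c0 : 0 < Num.sqrt (cnt t i)%:R :> R by rewrite sqrtr_gt0.
have c1 : 1 <= Num.sqrt (cnt t i)%:R :> R by rewrite -[leLHS]sqrtr1 ler_wsqrtr.
have cc : (cnt t i)%:R = Num.sqrt (cnt t i)%:R * Num.sqrt (cnt t i)%:R :> R by rewrite -expr2 sqr_sqrtr// ltW.
move: (sqnorm (mu i)) (sqnorm (_ *m h)) (noise_sq _ _ _ _ _ _ _ _) m0 m1 H0 H1 X1 X2 => M H N m0 m1 H0 H1.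
move: cc c0 c1; move: (Num.sqrt (cnt t i)%:R) => c -> c0 c1 X1 X2.
have -> : (M + (N + c * c * s2 i) - H) / 2 / (c * c / 2) - s2 i = (M + N - H) / c / c.
  by field; rewrite gt_eqF.
have cn : c != 0 by rewrite gt_eqF.
split.
  rewrite ler_pM2r ?invr_gt0// ler_pdivrMr//.
  by have : 1 * 1 <= 1 * c; nra.
rewrite -mulNr ler_pM2r ?invr_gt0// ler_pdivlMr//.
have : (Num.sqrt bQ + 1) ^+ 2 * 1 <= (Num.sqrt bQ + 1) ^+ 2 * c.
  by apply: ler_wpM2l => //; exact: sqr_ge0.
nra.
Qed.

Variables (v u rho q : R).
Hypothesis v0 : 0 < v.
Hypothesis u0 : 0 < u.
Hypothesis rho0 : 0 < rho.
Hypothesis q0 : 0 <= q.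

Definition score_ := dotv (x t i w) (mu_tilde x r a Z L v t i w) - rho * sig_tilde x r a xi u t i w.

Let scoreE : score_ - MV x mu s2 rho i t w =
  (dotv (x t i w) (invmx (Amat x a i t w) *m bvec x r a i t w) - dotv (x t i w) (mu i))
  + v * dotv ((L t i w)^T *m x t i w) (Z t i w)
  - rho * (Dstat x r a i t w / @Cstat R Omega K a i t w - s2 i + u * xi t i w / Num.sqrt (cnt t i)%:R).
Proof.
rewrite /score_ /mu_tilde /sig_tilde /MV dotvDr dotvZr (dotv_mulmxr _ (L t i w)).
set A1 := dotv _ _; set A2 := dotv _ _; set A3 := dotv _ _; set D1 := _ / _.
by rewrite [u / _ * _]mulrAC; ring.
Qed.

Lemma score_close : (forall k, `|Z t i w k 0| <= q) -> `|xi t i w| <= q ->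
  `|score_ - MV x mu s2 rho i t w| <=
    (Num.sqrt bQ + 1 + v * (Num.sqrt d%:R * q)) * sn t i
    + rho * (1 + bX + (Num.sqrt bQ + 1) ^+ 2 + u * q) / Num.sqrt (cnt t i)%:R.
Proof.
move=> hZ hxi; rewrite scoreE.
have E1 := mean_error; have [E2 E3] := var_error.
have Zn : sqnorm (Z t i w) <= (Num.sqrt d%:R * q) ^+ 2.
  rewrite exprMn sqr_sqrtr// -[d in X in _ <= X](card_ord d) mulr_natl -sumr_const.
  apply: ler_sum => k _; rewrite -expr2 -real_normK ?num_real// ler_sqr ?nnegrE//.
have E4 : `|dotv ((L t i w)^T *m x t i w) (Z t i w)| <= sn t i * (Num.sqrt d%:R * q).
  apply: normr_dotv_le => //; rewrite ?sqrtr_ge0 ?mulr_ge0 ?sqrtr_ge0//.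
  by rewrite sqr_sqrtr ?snorm2_ge0// snorm2E.
have c0 : 0 < (Num.sqrt (cnt t i)%:R)^-1 :> R by rewrite invr_gt0 sqrtr_gt0 ltr0n; exact: Tcount_gt0.
move: E1 E2 E3 E4 hxi.
move: (dotv (x t i w) _ - _) (dotv (_^T *m _) _) (_ / _ - s2 i) => e1 e4 e2.
move: (sn t i) (Num.sqrt bQ) (Num.sqrt d%:R * q) (xi t i w) c0 => s b dq z.
move: (Num.sqrt (cnt t i)%:R)^-1 => c c0 E1 E2 E3 E4 hz.
have vE4 : v * `|e4| <= v * (s * dq) by rewrite ler_pM2l.
have E5 : `|e2 + u * z * c| <= (1 + bX + (b + 1) ^+ 2 + u * q) * c.
  have : `|u * z * c| <= u * q * c by rewrite !normrM (gtr0_norm u0) (gtr0_norm c0) ler_pM2r// ler_pM2l.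
  rewrite !ler_norml => /andP[h1 h2].
  have h3 : 0 <= (b + 1) ^+ 2 * c by rewrite mulr_ge0 ?sqr_ge0// ltW.
  have h4 : 0 <= c by exact: ltW.
  apply/andP; split; nra.
have rE5 : rho * `|e2 + u * z * c| <= rho * ((1 + bX + (b + 1) ^+ 2 + u * q) * c) by rewrite ler_pM2l.
apply: le_trans (ler_normB _ _) _; rewrite normrM (gtr0_norm rho0).
apply: (@le_trans _ _ (`|e1| + v * `|e4| + rho * `|e2 + u * z * c|)).
  by rewrite lerD2r; apply: le_trans (ler_normD _ _) _; rewrite normrM (gtr0_norm v0).
move: E1 vE4 rE5; move: `|e1| (v * `|e4|) (rho * `|_|) => a1 a2 a3; nra.
Qed.

(** The two draws are asked to outweigh separately the worst errors of the two centres; the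
    thresholds, confidence radius over sampling scale, become [cQ] and [cX]. *)
Lemma score_optimistic :
  (Num.sqrt bQ + 1) / v * sn t i <= dotv ((L t i w)^T *m x t i w) (Z t i w) ->
  xi t i w <= - ((1 + bX) / u) -> MV x mu s2 rho i t w <= score_.
Proof.
move=> hZ hxi; rewrite -subr_ge0 scoreE.
have E1 := mean_error; have [E2 _] := var_error.
have c0 : 0 < (Num.sqrt (cnt t i)%:R)^-1 :> R by rewrite invr_gt0 sqrtr_gt0 ltr0n; exact: Tcount_gt0.
move: E1 E2 hZ hxi.
move: (dotv (x t i w) _ - _) (dotv (_^T *m _) _) (_ / _ - s2 i) => e1 e4 e2.
move: (sn t i) (Num.sqrt bQ) (xi t i w) c0 => s b z.
move: (Num.sqrt (cnt t i)%:R)^-1 => c c0 E1 E2 E4 hz.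
have h1 : (b + 1) * s <= v * e4.
  by have : v * ((b + 1) / v * s) <= v * e4 by [rewrite ler_pM2l|]; rewrite mulrA mulrCA divff ?mulr1 ?gt_eqF.
have h2 : u * z <= - (1 + bX).
  by have : u * z <= u * (- ((1 + bX) / u)) by [rewrite ler_pM2l|]; rewrite mulrN mulrCA divff ?mulr1 ?gt_eqF.
have h3 : u * z * c <= - (1 + bX) * c by rewrite ler_pM2r.
have h4 : rho * (e2 + u * z * c) <= 0 by rewrite pmulr_rle0//; nra.
by move: E1; rewrite ler_norml => /andP[E1 _]; nra.
Qed.

End Estimates.
End Paths.

(** * The high-probability bound *)

Lemma measurable_bigmaxr {d : measure_display} {T : measurableType d} {R : realType}
    (I : Type) (s : seq I) (c : R) (f : I -> T -> R) :
  (forall i, measurable_fun setT (f i)) ->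
  measurable_fun setT (fun w => \big[Num.max/c]_(i <- s) f i w).
Proof.
move=> mf; elim: s => [|i s IH].
  by under eq_fun do rewrite big_nil; exact: measurable_cst.
by under eq_fun do rewrite big_cons; exact: measurable_maxr.
Qed.

Lemma measurable_bigminr {d : measure_display} {T : measurableType d} {R : realType}
    (I : Type) (s : seq I) (c : R) (f : I -> T -> R) :
  (forall i, measurable_fun setT (f i)) ->
  measurable_fun setT (fun w => \big[Num.min/c]_(i <- s) f i w).
Proof.
move=> mf; elim: s => [|i s IH].
  by under eq_fun do rewrite big_nil; exact: measurable_cst.
by under eq_fun do rewrite big_cons; exact: measurable_minr.
Qed.

Lemma union_bound {dO : measure_display} {Omega : measurableType dO} {R : realType}
    (P : probability Omega R) (I : finType) (A : I -> set Omega) (e : R) :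
  (forall i, measurable (A i)) -> (forall i, P (A i) <= e%:E)%E ->
  measurable [set w | exists i, A i w] /\ (P [set w | exists i, A i w] <= (#|I|%:R * e)%:E)%E.
Proof.
move=> mA Ae.
have -> : [set w | exists i, A i w] = \big[setU/set0]_(i <- enum I) A i.
  rewrite -bigcup_seq; apply/seteqP; split=> w /=.
    by move=> [i Ai]; exists i => //=; rewrite mem_enum.
  by move=> [i _ Ai]; exists i.
rewrite cardE; elim: (enum I) => [|i s [mU IH]].
  by rewrite big_nil measure0 mul0r; split.
rewrite big_cons; split; first exact: measurableU.
apply: le_trans (measureU2 _ _ _) _ => //.
by rewrite /= -natr1 mulrDl mul1r [X in X%:E]addrC EFinD; exact: leeD.
Qed.

(** * From the supermartingales to confidence radii *)

Section Concentration.
Context {R : realType} {dO : measure_display} {Omega : measurableType dO} {d K : nat}.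
Variables (x : nat -> 'I_K -> Omega -> 'cV[R]_d) (r : nat -> 'I_K -> Omega -> R)
  (a : nat -> Omega -> 'I_K) (L : nat -> 'I_K -> Omega -> 'M[R]_d)
  (mu : 'I_K -> 'cV[R]_d) (s2 : 'I_K -> R) (sg c : R) (t T : nat) (i : 'I_K) (w : Omega).
Hypothesis LA : forall t i w, L t i w *m (L t i w)^T = invmx (Amat x a i t w).
Hypothesis x1 : forall t i w, sqnorm (x t i w) <= 1.
Hypothesis sg0 : 0 < sg.
Hypothesis c1 : 1 <= c.
Hypothesis tT : (t <= T)%N.

Lemma noise_norm2_le : vec_mart x r a mu sg t i w < c ->
  noise_norm2 x r a mu t i w <= 2 * sg ^+ 2 * (ln c + ln (d`!%:R * T.+2%:R ^+ d) / 2).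
Proof.
have c0 : 0 < c by exact: lt_le_trans c1.
rewrite /vec_mart -{1}(lnK (x := c)) ?posrE// ltr_expR => h.
have dt0 : 0 < \det (Amat x a i t w) by exact: (det_Amat_gt0 (fun u => LA u i w)).
have : ln (\det (Amat x a i t w)) <= ln (d`!%:R * T.+2%:R ^+ d).
  have ub : \det (Amat x a i t w) <= d`!%:R * T.+2%:R ^+ d.
    apply: le_trans (det_Amat_le a (fun u => x1 u i w) t) _.
    apply: ler_wpM2l => //; apply: lerXn2r; rewrite ?nnegrE// ler_nat.
    by rewrite ltnS; exact: leqW.
  by rewrite ler_ln ?posrE//; exact: lt_le_trans ub.
move: h; move: (ln (\det (Amat x a i t w))) (ln (d`!%:R * T.+2%:R ^+ d)) (ln c) => D D' lc h DD.
have s0 : 0 < 2 * sg ^+ 2 by rewrite mulr_gt0// exprn_gt0.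
by rewrite mulrC -ler_pdivrMr//; lra.
Qed.

(** The best tilt for [n] observations is of order [1 / sqrt n], but [n] is random. The largest
    power of 2 not exceeding [n] gives a tilt within a constant of it, so a logarithmic number of
    scales suffices; [b] provides both signs. *)
Lemma noise_sq_le : (0 < Tcount a i t w)%N ->
  (forall (k : 'I_(trunc_log 2 T.+1).+1) (b : bool),
     sq_mart x r a mu s2 sg ((-1) ^+ b / Num.sqrt (2 ^+ k)) t i w < c) ->
  `|noise_sq x r a mu s2 t i w| <= (ln c + sg ^+ 2) * Num.sqrt (Tcount a i t w)%:R.
Proof.
move=> n0 h; set n := Tcount a i t w; have c0 : 0 < c by exact: lt_le_trans c1.
have lc : 0 <= ln c by exact: ln_ge0.
have kN : (trunc_log 2 n < (trunc_log 2 T.+1).+1)%N.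
  by rewrite ltnS leq_trunc_log// (leq_trans (Tcount_le a w t i))// ltnW.
have kl : (2 ^ trunc_log 2 n)%:R <= n%:R :> R by rewrite ler_nat; exact: trunc_logP.
have ku : n%:R <= (2 ^ (trunc_log 2 n).+1)%:R :> R by rewrite ler_nat ltnW// trunc_log_ltn.
rewrite expnS natrM in ku.
pose m : R := Num.sqrt (2 ^+ trunc_log 2 n).
have m0 : 0 < m by rewrite sqrtr_gt0 exprn_gt0.
have mm : m ^+ 2 = (2 ^ trunc_log 2 n)%:R by rewrite sqr_sqrtr ?exprn_ge0// natrX.
have sn0 : 0 <= Num.sqrt n%:R :> R by exact: sqrtr_ge0.
have sn2 : Num.sqrt n%:R ^+ 2 = n%:R :> R by rewrite sqr_sqrtr.
rewrite -mm -sn2 in kl ku.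
have ms : m <= Num.sqrt n%:R by rewrite -ler_sqr ?nnegrE// ltW.
have sm : Num.sqrt n%:R <= 2 * m.
  rewrite -ler_sqr ?nnegrE ?mulr_ge0 ?(ltW m0)// exprMn; have := sqr_ge0 m; lra.
have key (b : bool) : (-1) ^+ b * noise_sq x r a mu s2 t i w <= (ln c + sg ^+ 2) * Num.sqrt n%:R.
  have := h (Ordinal kN) b; rewrite /= -/m /sq_mart -[X in _ < X -> _](lnK (x := c)) ?posrE// ltr_expR.
  rewrite expr_div_n sqrr_sign mul1r -/n -[X in _ - _ * X < _]sn2.
  rewrite (mulrAC _ m^-1); set N := _ * noise_sq _ _ _ _ _ _ _ _.
  move: (Num.sqrt n%:R) sn0 ms sm => s s0 ms sm h1.
  have h2 : N <= m * ln c + sg ^+ 2 * (s ^+ 2 / (2 * m)).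
    have : m * (N / m - (m ^+ 2)^-1 * sg ^+ 2 / 2 * s ^+ 2) <= m * ln c by rewrite ler_pM2l// ltW.
    have -> : m * (N / m - (m ^+ 2)^-1 * sg ^+ 2 / 2 * s ^+ 2) = N - sg ^+ 2 * (s ^+ 2 / (2 * m)).
      by field; rewrite gt_eqF.
    lra.
  apply: le_trans h2 _; rewrite [leRHS]mulrDl; apply: lerD; first by rewrite mulrC ler_wpM2l.
  apply: ler_wpM2l; first exact: sqr_ge0.
  by rewrite ler_pdivrMr ?mulr_gt0// expr2 ler_wpM2l.
have := key false; have := key true; rewrite expr0 expr1 mul1r mulN1r ler_norml => h1 h2.
by rewrite h2 andbT lerNl.
Qed.

End Concentration.

(** * Failure events and the regret bound *)

Section Assembly.
Context {R : realType} {dO : measure_display} {Omega : measurableType dO} {d K : nat}.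
Variables (P : probability Omega R) (sg rho eps delta : R) (F : nat -> set (set Omega))
  (x : nat -> 'I_K -> Omega -> 'cV[R]_d) (r : nat -> 'I_K -> Omega -> R)
  (mu : 'I_K -> 'cV[R]_d) (s2 : 'I_K -> R) (a : nat -> Omega -> 'I_K)
  (Z : nat -> 'I_K -> Omega -> 'cV[R]_d) (xi : nat -> 'I_K -> Omega -> R)
  (L : nat -> 'I_K -> Omega -> 'M[R]_d) (T : nat).
Hypothesis sg0 : 0 < sg.
Hypothesis rho0 : 0 < rho.
Hypothesis delta01 : 0 < delta < 1.
Hypothesis K0 : (0 < K)%N.
Hypothesis T0 : (0 < T)%N.
Let v := vpar sg eps delta d K.
Let u := upar sg eps delta d K.
Hypothesis v0 : 0 < v.
Hypothesis u0 : 0 < u.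
Hypothesis setting : mvts_dn_setting P sg rho eps delta F x r mu s2 a Z xi L.

Definition logdet : R := ln (d`!%:R * T.+2%:R ^+ d).
(** The failure probability is split into four parts [delta / 4]. The [K] arms share one here; the
    [2 K nscale] signed scales share another, whence the 8 in [bX]; the third goes to the Gaussian
    draws and the last to Markov's inequality. *)
Definition bQ : R := 2 * sg ^+ 2 * (ln (4 * K%:R / delta) + logdet / 2).
Definition nscale : nat := (trunc_log 2 T.+1).+1.
Definition bX : R := ln (8 * K%:R * nscale%:R / delta) + sg ^+ 2.
Definition cQ : R := (Num.sqrt bQ + 1) / v.
Definition cX : R := (1 + bX) / u.
(** Large enough to contain the optimism box, whose coordinates are at most [cQ + 2] or [cX + 2],
    and to make the tails of all [T K (d + 1)] draws sum to at most [delta / 4]. *)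
Definition qmax : R := cQ + cX + 3 + ln (8 * T%:R * K%:R * d.+1%:R / delta).
Definition g1 : R := Num.sqrt bQ + 1 + v * (Num.sqrt d%:R * qmax).
Definition g2 : R := rho * (1 + bX + (Num.sqrt bQ + 1) ^+ 2 + u * qmax).
Definition wtot : R := g1 * (Num.sqrt T%:R * (K%:R * logdet + 1)) + g2 * (3 * K%:R * Num.sqrt T.+1%:R).
Definition popt : R := kap ^+ (d.+1 * K) * expR (- (cQ ^+ 2 + cX ^+ 2)).
(** Markov's inequality gives [4 wtot / (popt delta)] for the sum of the smallest unsaturated
    widths, which count twice in the gap; the last [wtot] pays for the widths of the arms pulled. *)
Definition rbound : R := (8 / (popt * delta) + 1) * wtot.

Let d0 : 0 < delta. Proof. by case/andP: delta01. Qed.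
Let d1 : delta < 1. Proof. by case/andP: delta01. Qed.

Let ge1_div (y : R) : 1 <= y -> 1 <= y / delta.
Proof. by move=> y1; rewrite ler_pdivlMr// mul1r (le_trans (ltW d1)). Qed.

Lemma logdet_ge0 : 0 <= logdet.
Proof.
apply: ln_ge0; rewrite -natrX -natrM ler1n muln_gt0 fact_gt0/= expn_gt0.
by [].
Qed.

Let cQ1 : 1 <= 4 * K%:R / delta. Proof. by apply: ge1_div; rewrite -natrM ler1n muln_gt0 K0. Qed.
Let cX1 : 1 <= 8 * K%:R * nscale%:R / delta.
Proof. by apply: ge1_div; rewrite -!natrM ler1n !muln_gt0 K0. Qed.

Lemma bQ_ge0 : 0 <= bQ.
Proof.
apply: mulr_ge0; first by rewrite mulr_ge0 ?sqr_ge0.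
by apply: addr_ge0; [exact: ln_ge0|rewrite divr_ge0 ?logdet_ge0].
Qed.

Lemma bX_ge0 : 0 <= bX.
Proof. by rewrite addr_ge0 ?sqr_ge0//; exact: ln_ge0. Qed.

Lemma cQ_gt0 : 0 < cQ.
Proof. by rewrite divr_gt0// ltr_wpDl// sqrtr_ge0. Qed.

Lemma cX_gt0 : 0 < cX.
Proof. by rewrite divr_gt0// ltr_pwDl// bX_ge0. Qed.

Let lnq_ge0 : 0 <= ln (8 * T%:R * K%:R * d.+1%:R / delta).
Proof. by apply/ln_ge0/ge1_div; rewrite -!natrM ler1n !muln_gt0 K0 T0. Qed.

Lemma qmax_ge1 : 1 <= qmax.
Proof. by have := cQ_gt0; have := cX_gt0; rewrite /qmax; have := lnq_ge0; lra. Qed.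

Let qmax_ge0 : 0 <= qmax. Proof. exact: le_trans qmax_ge1. Qed.

Lemma g1_ge0 : 0 <= g1.
Proof. by rewrite !addr_ge0 ?sqrtr_ge0// !mulr_ge0 ?sqrtr_ge0// ltW. Qed.

Lemma g2_gt0 : 0 < g2.
Proof.
have b0 := bX_ge0; have s0 := sqr_ge0 (Num.sqrt bQ + 1).
have q0 : 0 <= u * qmax by rewrite mulr_ge0// ltW.
by rewrite mulr_gt0//; move: bX (_ ^+ 2) (u * qmax) b0 s0 q0 => *; lra.
Qed.

Lemma wtot_gt0 : 0 < wtot.
Proof.
rewrite ltr_wpDl// ?mulr_ge0 ?g1_ge0 ?sqrtr_ge0 ?addr_ge0 ?mulr_ge0 ?logdet_ge0//.
by apply: mulr_gt0; [exact: g2_gt0|apply: mulr_gt0; [rewrite mulr_gt0// ltr0n|rewrite sqrtr_gt0 ltr0n]].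
Qed.

Lemma popt_gt0 : 0 < popt.
Proof. by rewrite mulr_gt0 ?expR_gt0// exprn_gt0// kap_gt0. Qed.

Let sF t : sigma_algebra [set: Omega] (F t). Proof. by case: setting. Qed.
Let Fm t : F t `<=` measurable. Proof. by case: setting => _ []. Qed.
Let FS t : F t `<=` F t.+1. Proof. by case: setting => _ [_ []]. Qed.
Let Fx t i (k : 'I_d) : Fmeas (F t) (fun w => x t i w k 0).
Proof. by case: setting => _ [_ [_ []]]. Qed.
Let mr t i : measurable_fun [set: Omega] (r t i).
Proof. by case: setting => _ [_ [_ [_ []]]]. Qed.
Let Fr0 i : Fmeas (F 1) (r 0 i).
Proof. by case: setting => _ [_ [_ [_ [_ []]]]]. Qed.
Let Fa t : (0 < t)%N -> forall j : 'I_K, F t.+1 [set w | a t w = j].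
Proof. by case: setting => _ [_ [_ [_ [_ [_ []]]]]] h _; exact: h. Qed.
Let Fr t : (0 < t)%N -> Fmeas (F t.+1) (fun w => r t (a t w) w).
Proof. by case: setting => _ [_ [_ [_ [_ [_ [_ []]]]]]] h _; exact: h. Qed.
Let FL t i (k l : 'I_d) : Fmeas (F t) (fun w => L t i w k l).
Proof. by case: setting => _ [_ [_ [_ [_ [_ [_ [_ []]]]]]]]. Qed.
Let LA t i w : L t i w *m (L t i w)^T = invmx (Amat x a i t w).
Proof. by case: setting => _ [_ [_ [_ [_ [_ [_ [_ [_ []]]]]]]]]. Qed.
Let mZ t i (k : 'I_d) : measurable_fun [set: Omega] (fun w => Z t i w k 0).
Proof. by case: setting => _ [_ [_ [_ [_ [_ [_ [_ [_ [_ []]]]]]]]]]. Qed.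
Let mxi t i : measurable_fun [set: Omega] (xi t i).
Proof. by case: setting => _ [_ [_ [_ [_ [_ [_ [_ [_ [_ [_ []]]]]]]]]]]. Qed.
Let indep t : (0 < t)%N -> forall A, F t A ->
  forall (B : 'I_K -> 'I_d -> set R) (C : 'I_K -> set R),
  (forall i k, measurable (B i k)) -> (forall i, measurable (C i)) ->
  P (A `&` rect (Z t) (xi t) B C) = (P A * \prod_(i < K) ((\prod_(k < d) normal_prob 0 1 (B i k))
                               * normal_prob 0 1 (C i)))%E.
Proof. by case: setting => _ [_ [_ [_ [_ [_ [_ [_ [_ [_ [_ [_ []]]]]]]]]]]] h _ t0; exact: h. Qed.
Let amax t : (0 < t)%N -> forall w i,
  score_ x r a L Z xi w t i v u rho <= score_ x r a L Z xi w t (a t w) v u rho.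
Proof. by case: setting => _ [_ [_ [_ [_ [_ [_ [_ [_ [_ [_ [_ [_ []]]]]]]]]]]]] h _ t0 w i; exact: h. Qed.
Let subG1 t i : cond_subG P (condsets F a t) sg (fun w => r t i w - dotv (x t i w) (mu i)).
Proof. by case: setting => _ [_ [_ [_ [_ [_ [_ [_ [_ [_ [_ [_ [_ [_ []]]]]]]]]]]]]] h _; exact: h. Qed.
Let subG2 t i : cond_subG P (condsets F a t) sg
  (fun w => (r t i w - dotv (x t i w) (mu i)) ^+ 2 - s2 i).
Proof. by case: setting => _ [_ [_ [_ [_ [_ [_ [_ [_ [_ [_ [_ [_ [_ [_ []]]]]]]]]]]]]]] h _; exact: h. Qed.
Let x1 t i w : sqnorm (x t i w) <= 1.
Proof. by case: setting => _ [_ [_ [_ [_ [_ [_ [_ [_ [_ [_ [_ [_ [_ [_ [_ [_ []]]]]]]]]]]]]]]]] h _; exact: h. Qed.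
Let mu1 i : sqnorm (mu i) <= 1.
Proof. by case: setting => _ [_ [_ [_ [_ [_ [_ [_ [_ [_ [_ [_ [_ [_ [_ [_ [_ [_ []]]]]]]]]]]]]]]]]] h _; exact: h. Qed.

Let MVw t w i := MV x mu s2 rho i t w.
Let wd t w i : R := g1 * Num.sqrt (snorm2 x a t i w) + g2 / Num.sqrt (Tcount a i t w)%:R.
Let W0 : R := g1 + g2.
Let mun t w := min_unsat (MVw t w) (wd t w) W0.

Definition good t : set Omega := [set w | forall i : 'I_K, noise_norm2 x r a mu t i w <= bQ /\
  `|noise_sq x r a mu s2 t i w| <= bX * Num.sqrt (Tcount a i t w)%:R].

Let wd_ge0 t w i : 0 <= wd t w i.
Proof.
by apply: addr_ge0; [exact: (mulr_ge0 g1_ge0 (sqrtr_ge0 _))|exact: (divr_ge0 (ltW g2_gt0) (sqrtr_ge0 _))].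
Qed.

Let wd_le t w i : (0 < t)%N -> wd t w i <= W0.
Proof.
move=> t0; apply: lerD.
  by rewrite -[leRHS]mulr1 ler_wpM2l ?g1_ge0//; exact: sn_le1.
have c1 : 1 <= Num.sqrt (Tcount a i t w)%:R :> R.
  by rewrite -[leLHS]sqrtr1 ler_wsqrtr// ler1n; exact: Tcount_gt0.
rewrite ler_pdivrMr ?(lt_le_trans _ c1)// -[leLHS]mulr1 ler_wpM2l// ltW// g2_gt0//.
Qed.

Let W00 : 0 <= W0. Proof. by rewrite addr_ge0 ?g1_ge0// ltW// g2_gt0. Qed.

Let close t w : (0 < t)%N -> good t w -> (forall i k, `|Z t i w k 0| <= qmax) ->
  (forall i, `|xi t i w| <= qmax) ->
  forall i, `|score_ x r a L Z xi w t i v u rho - MVw t w i| <= wd t w i.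
Proof.
move=> t0 gw hZ hxi i; have [h1 h2] := gw i.
rewrite /wd /g1 /g2; apply: (score_close LA mu1 t0 bQ_ge0 h1 h2 v0 u0 rho0 qmax_ge0) => //.
Qed.

Let ad_MV t i : measurable_fun [set: g_sigma_algebraType (F t)] (fun w => MVw t w i).
Proof.
apply: measurable_funB => //; apply: ad_dotv => k; last exact: measurable_cst.
exact: (ad_x sF Fx).
Qed.

Let ad_wd t i : measurable_fun [set: g_sigma_algebraType (F t)] (fun w => wd t w i).
Proof.
apply: measurable_funD; apply: measurable_funM; try exact: measurable_cst.
  apply: (measurableT_comp measurable_sqrtr).
  exact: (ad_snorm2 sF Fx FL LA).
apply: measurable_funVr; apply: (measurableT_comp measurable_sqrtr).
exact: (ad_Tcount sF FS Fa).
Qed.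

Let ad_gap t i : measurable_fun [set: g_sigma_algebraType (F t)] (fun w => gap (MVw t w) i).
Proof. by apply: measurable_bigmaxr => j; apply: measurable_funB; exact: ad_MV. Qed.

Let ad_mun t : measurable_fun [set: g_sigma_algebraType (F t)] (mun t).
Proof.
apply: measurable_bigminr => i; apply: measurable_fun_ifT; [|exact: ad_wd|exact: measurable_cst].
by apply: measurable_realfun.measurable_fun_ler; [exact: ad_gap|exact: ad_wd].
Qed.

Let F_good t : F t (good t).
Proof.
have -> : good t = \bigcap_(i in [set: 'I_K]) ([set w | noise_norm2 x r a mu t i w <= bQ] `&`
    [set w | `|noise_sq x r a mu s2 t i w| <= bX * Num.sqrt (Tcount a i t w)%:R]).
  by apply/seteqP; split=> w h; [move=> i _; exact: h|move=> i; exact: h].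
apply: sigma_in => //; apply: (@fin_bigcap_measurable _ (g_sigma_algebraType (F t))) => // i _.
apply: (@measurableI _ (g_sigma_algebraType (F t))); rewrite -[X in measurable X]setTI; apply: measurable_fun_le => //.
- exact: (ad_noise_norm2 mu sF FS Fx Fr0 Fa Fr FL LA).
- by apply: measurableT_comp => //; exact: (ad_noise_sq mu s2 sF FS Fx Fr0 Fa Fr).
- apply: measurable_funM => //; apply: (measurableT_comp measurable_sqrtr).
  exact: (ad_Tcount sF FS Fa).
Qed.

(** The good event belongs to [F t], so it may enter the predictable weight before the draws of
    round [t] are made. *)
Let Wt t w : R := \1_(good t) w * mun t w.

Let Wt_ge0 t w : 0 <= Wt t w.
Proof. by rewrite mulr_ge0//; apply: min_unsat_ge0 => // i; exact: wd_ge0. Qed.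

Let ad_Wt t : measurable_fun [set: g_sigma_algebraType (F t)] (Wt t).
Proof.
apply: measurable_funM; last exact: ad_mun.
apply: (@measurable_indic _ (g_sigma_algebraType (F t)) R setT (good t)).
by apply: sub_sigma_algebra; exact: F_good.
Qed.

Let dir t i w : 'cV[R]_d := (L t i w)^T *m x t i w.
Let th t i k w : R := cQ / Num.sqrt (snorm2 x a t i w) * dir t i w k 0.
(** The optimal arm varies with the contexts, so the code records which arms are optimal along with
    the floors of the thresholds of every arm; [star] selects one of the recorded optimal arms. *)
Let code t w : {ffun 'I_K -> bool} * {ffun 'I_K -> {ffun 'I_d -> int}} :=
  ([ffun i => gap (MVw t w) i <= 0], [ffun i => [ffun k => Num.floor (th t i k w)]]).
Let star (b : {ffun 'I_K -> bool}) : 'I_K := odflt (Ordinal K0) [pick i | b i].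
Let boxBc (j : {ffun 'I_K -> bool} * {ffun 'I_K -> {ffun 'I_d -> int}}) :=
  boxB qmax (star j.1) (j.2 (star j.1)).
Let boxCc (j : {ffun 'I_K -> bool} * {ffun 'I_K -> {ffun 'I_d -> int}}) : 'I_K -> set R :=
  boxC qmax cX (star j.1).
Let opt t : set Omega := random_rect (Z t) (xi t) (code t) boxBc boxCc.

Let ad_th t i k : measurable_fun [set: g_sigma_algebraType (F t)] (th t i k).
Proof.
apply: measurable_funM.
  apply: measurable_funM => //; apply: measurable_funVr.
  apply: (measurableT_comp measurable_sqrtr); exact: (ad_snorm2 sF Fx FL LA).
by apply: (ad_LT sF FL) => l; exact: (ad_x sF Fx).
Qed.

Let F_code t j : F t (code t @^-1` [set j]).
Proof.
apply: (sigma_pair (sF t)) j => j; apply: (sigma_ffun (sF t)) => i b.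
  apply: sigma_in => //; rewrite -[X in measurable X]setTI.
  have mb : measurable_fun [set: g_sigma_algebraType (F t)] (fun w => gap (MVw t w) i <= 0).
    by apply: measurable_realfun.measurable_fun_ler; [exact: ad_gap|exact: measurable_cst].
  exact: mb.
apply: (sigma_ffun (sF t)) => k z; apply: sigma_in => //.
by apply: measurable_preimage_floor; exact: ad_th.
Qed.

Let starP t w : gap (MVw t w) (star (code t w).1) = 0.
Proof.
have [b g0] := @exists_opt R K (MVw t w) (Ordinal K0).
apply/le_anti; rewrite gap_ge0 andbT /star; case: pickP => [i|/(_ b)].
  by rewrite /code ffunE.
by rewrite /code ffunE g0 lexx.
Qed.

Let th_sum t i w : \sum_k th t i k w ^+ 2 <= cQ ^+ 2.
Proof.
have -> : \sum_k th t i k w ^+ 2 = (cQ / Num.sqrt (snorm2 x a t i w)) ^+ 2 * snorm2 x a t i w.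
  have sE : snorm2 x a t i w = \sum_k dir t i w k 0 * dir t i w k 0 by rewrite (snorm2E w LA).
  rewrite [X in _ * X]sE mulr_sumr; apply: eq_bigr => k _.
  by rewrite /th exprMn (expr2 (dir t i w k 0)).
have s0 := snorm2_ge0 w LA t i.
(* At zero width the quotient by 0 is 0 and the bound is trivial. *)
have [->|sn0] := eqVneq (snorm2 x a t i w) 0; first by rewrite mulr0 sqr_ge0.
by rewrite expr_div_n sqr_sqrtr// divfK.
Qed.

Let opt_prob t w : (popt%:E <= \prod_(i < K) ((\prod_(k < d) normal_prob 0 1 (boxBc (code t w) i k))
                               * normal_prob 0 1 (boxCc (code t w) i)))%E.
Proof.
have := box_prob cX (star (code t w).1) qmax_ge1 (th_sum t (star (code t w).1) w).
rewrite /boxBc /boxCc => h; apply: (le_trans h); rewrite le_eqVlt; apply/orP; left; apply/eqP; apply: eq_bigr => i _.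
by congr (_ * _)%E; apply: eq_bigr => k _; rewrite /boxB; case: ifP => // _; rewrite /code /= !ffunE.
Qed.

Let int_opt t : (0 < t)%N ->
  (\int[P]_w (Wt t w * popt)%:E <= \int[P]_w (Wt t w * \1_(opt t) w)%:E)%E.
Proof.
move=> t0; apply: (@integral_random_rect_ge _ _ _ _ _ P (F t) (Z t) (xi t) (Fm (t := t)) (sF t)
  (mZ t) (mxi t) (indep t0) _ (code t) boxBc boxCc popt (ltW popt_gt0)).
- exact: F_code.
- by move=> j i k; exact: measurable_boxB.
- by move=> j i; exact: measurable_boxC.
- exact: opt_prob.
- exact: ad_Wt.
- exact: Wt_ge0.
Qed.

Let opt_facts t w : opt t w -> let o := star (code t w).1 in
  [/\ forall i k, `|Z t i w k 0| <= qmax, forall i, `|xi t i w| <= qmax,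
   cQ * Num.sqrt (snorm2 x a t o w) <= dotv (dir t o w) (Z t o w) & xi t o w <= - cX].
Proof.
move=> h o; have cQ0 := cQ_gt0; have cX0 := cX_gt0.
have c3 : cQ + cX + 3 <= qmax by rewrite /qmax lerDl.
have hB k : code_itv (Num.floor (th t o k w)) (Z t o w k 0).
  by have [/(_ k) + _] := h o; rewrite /boxBc /boxB eqxx /code /= !ffunE.
have hC : code_itv (Num.floor (- cX)) (xi t o w) by have [_] := h o; rewrite /boxCc /boxC eqxx.
split.
- move=> i k; have [/(_ k) + _] := h i; rewrite /boxBc /boxB -/o.
  case: eqP => [-> _|_]; last by rewrite /= in_itv/= ler_norml.
  apply: le_trans (code_itv_norm (hB k)) _.
  have : `|th t o k w| <= cQ.
    rewrite -ler_sqr ?nnegrE ?(ltW cQ0)// real_normK ?num_real//.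
    apply: le_trans (th_sum t o w); rewrite (bigD1 k)//= lerDl.
    by apply: sumr_ge0 => k' _; exact: sqr_ge0.
  lra.
- move=> i; have [_] := h i; rewrite /boxCc /boxC -/o.
  case: eqP => [-> _|_]; last by rewrite /= in_itv/= ler_norml.
  by apply: le_trans (code_itv_norm hC) _; rewrite normrN gtr0_norm//; lra.
- have s0 := snorm2_ge0 w LA t o.
  have sE : snorm2 x a t o w = \sum_k dir t o w k 0 * dir t o w k 0 by rewrite (snorm2E w LA).
  have [sz|sn0] := eqVneq (snorm2 x a t o w) 0.
    have -> : dir t o w = 0 by apply: sqnorm_eq0; rewrite -[LHS]/(sqnorm _) /sqnorm /dotv -sE.
    by rewrite sz sqrtr0 mulr0 dotv0l.
  have sp : 0 < Num.sqrt (snorm2 x a t o w) by rewrite sqrtr_gt0 lt_def sn0.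
  have a0 : 0 < cQ / Num.sqrt (snorm2 x a t o w) by rewrite divr_gt0.
  apply: (@le_trans _ _ (\sum_k cQ / Num.sqrt (snorm2 x a t o w) * dir t o w k 0 * dir t o w k 0)).
    rewrite (eq_bigr (fun k => cQ / Num.sqrt (snorm2 x a t o w) * (dir t o w k 0 * dir t o w k 0))); last first.
      by move=> k _; rewrite mulrA.
    rewrite -mulr_sumr -sE -mulrA ler_pM2l//.
    rewrite -[X in _ <= _ * X](sqr_sqrtr s0) expr2 mulrA mulVf ?mul1r// gt_eqF//.
  rewrite dotvC; apply: ler_sum => k _; apply: code_itv_sign => //.
  exact: hB.
- by apply: (code_itv_neg (th := - cX)) => //; rewrite oppr_lt0.
Qed.

(** The inequality is pointwise, with no exceptional event: [opt] itself bounds the draws of all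
    arms, and outside [good] or [opt] the left side is 0. *)
Let Wt_opt_le t w : (0 < t)%N -> Wt t w * \1_(opt t) w <= wd t w (a t w).
Proof.
move=> t0; rewrite /Wt !indicE; have [gw|_] := boolP (w \in good t); last by rewrite !mul0r wd_ge0.
have [ow|_] := boolP (w \in opt t); last by rewrite mulr0 wd_ge0.
rewrite inE in gw; rewrite inE in ow; rewrite mul1r mulr1.
have [hZ hxi h1 h2] := opt_facts ow; have [Q1 Q2] := gw (star (code t w).1).
rewrite /mun; apply: (@min_unsat_le R K (MVw t w) (fun i => score_ x r a L Z xi w t i v u rho) (wd t w)
  (a t w) W0 _ _ (star (code t w).1)).
- exact: close.
- by move=> i; exact: amax.
- exact: starP.
- exact: (score_optimistic LA mu1 t0 bQ_ge0 Q1 Q2 v0 u0 rho0).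
Qed.

Let Delta_le t w : (0 < t)%N -> good t w -> (forall i k, `|Z t i w k 0| <= qmax) ->
  (forall i, `|xi t i w| <= qmax) ->
  Delta x mu s2 rho (a t w) t w <= 2 * Wt t w + wd t w (a t w).
Proof.
move=> t0 gw hZ hxi; rewrite /Wt indicE mem_set// mul1r.
apply: (gap_le_min_unsat (score := fun i => score_ x r a L Z xi w t i v u rho)) => //.
- by move=> i; exact: wd_le.
- exact: close.
- by move=> i; exact: amax.
Qed.

Let sum_wd_le w : \sum_(t < T) wd t.+1 w (a t.+1 w) <= wtot.
Proof.
have := @sum_width_le R dO Omega d K x a L w LA x1 g1 g2 T g1_ge0 (ltW g2_gt0) T0.
by rewrite big_add1 big_mkord.
Qed.

Let Y w : R := \sum_(t < T) Wt t.+1 w.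
Let Mth : R := 4 * wtot / (popt * delta).

Let mWt t : measurable_fun [set: Omega] (Wt t).
Proof. by apply: (measurable_sub_sigma (Fm (t := t))); exact: ad_Wt. Qed.

Let mopt t : (0 < t)%N -> measurable (opt t).
Proof.
move=> t0; apply: (measurable_random_rect (Fm (t := t)) (mZ t) (mxi t)).
- exact: F_code.
- by move=> j i k; exact: measurable_boxB.
- by move=> j i; exact: measurable_boxC.
Qed.

Let int_Y : (\int[P]_w (Y w * popt)%:E <= wtot%:E)%E.
Proof.
have p0 := popt_gt0.
under eq_integral do rewrite /Y mulr_suml -sumEFin.
rewrite ge0_integral_sum//; last 2 first.
- by move=> t; apply/measurable_EFinP; exact: measurable_funM.
- by move=> t w _; rewrite lee_fin mulr_ge0 ?Wt_ge0// ltW.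
apply: (@le_trans _ _ (\sum_(t < T) \int[P]_w (Wt t.+1 w * \1_(opt t.+1) w)%:E)%E).
  by apply: lee_sum => t _; exact: int_opt.
rewrite -ge0_integral_sum//; last 2 first.
- move=> t; apply/measurable_EFinP; apply: measurable_funM => //.
  by apply: measurable_indic; exact: mopt.
- by move=> t w _; rewrite lee_fin mulr_ge0 ?Wt_ge0.
have -> : (wtot%:E = \int[P]_w cst wtot%:E w)%E.
  by rewrite integral_cst//= probability_setT mule1.
apply: ge0_le_integral => //.
- by move=> w _; apply: sume_ge0 => t _; rewrite lee_fin mulr_ge0 ?Wt_ge0.
- apply: emeasurable_sum => t; apply/measurable_EFinP; apply: measurable_funM => //.
  by apply: measurable_indic; exact: mopt.
- move=> w _; rewrite sumEFin lee_fin; apply: le_trans (sum_wd_le w).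
  by apply: ler_sum => t _; exact: Wt_opt_le.
Qed.

Let mY : measurable_fun [set: Omega] Y.
Proof. by apply: measurable_sum => t; exact: mWt. Qed.

Let B4 : set Omega := [set w | Mth <= Y w].

Let mB4 : measurable B4.
Proof. by rewrite -[X in measurable X]setTI; apply: measurable_fun_le => //; exact: measurable_cst. Qed.

Let PB4 : (P B4 <= (delta / 4)%:E)%E.
Proof.
have p0 := popt_gt0; have w0 := wtot_gt0.
have Y0 w : 0 <= Y w by apply: sumr_ge0 => t _; exact: Wt_ge0.
have M0 : 0 < Mth * popt by apply: mulr_gt0 => //; apply: divr_gt0; rewrite mulr_gt0.
have h : ((Mth * popt)%:E * P B4 <= wtot%:E)%E.
  apply: le_trans int_Y; rewrite -integral_cst//.
  apply: (@le_trans _ _ (\int[P]_(w in B4) (Y w * popt)%:E)%E).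
    apply: ge0_le_integral => //.
    - by move=> w _; rewrite lee_fin ltW.
    - by apply/measurable_EFinP; apply: measurable_funTS; exact: measurable_funM.
    - by move=> w Bw; rewrite lee_fin ler_pM2r.
  apply: ge0_subset_integral => //.
    by apply/measurable_EFinP; exact: measurable_funM.
  by move=> w _; rewrite lee_fin mulr_ge0// ltW.
move: h; rewrite -(fineK (fin_num_measure P _ mB4)) -EFinM !lee_fin -ler_pdivlMl//.
have -> // : (Mth * popt)^-1 * wtot = delta / 4.
by rewrite /Mth; field; rewrite !gt_eqF.
Qed.

Let measurable_exists_le (c : R) (M : nat -> Omega -> R) :
  (forall t, measurable_fun [set: Omega] (M t)) ->
  measurable [set w | exists2 t, (t <= T)%N & c <= M t w].
Proof.
move=> mM; have -> : [set w | exists2 t, (t <= T)%N & c <= M t w] =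
    \bigcup_(t in [set t | (t <= T)%N]) [set w | c <= M t w] by [].
apply: bigcup_measurable => t _; rewrite -[X in measurable X]setTI.
by apply: measurable_fun_le => //; exact: measurable_cst.
Qed.

Let B1 (i : 'I_K) : set Omega :=
  [set w | exists2 t, (t <= T)%N & 4 * K%:R / delta <= vec_mart x r a mu sg t i w].
Let B2 (j : 'I_K * ('I_nscale * bool)) : set Omega :=
  [set w | exists2 t, (t <= T)%N & 8 * K%:R * nscale%:R / delta <=
    sq_mart x r a mu s2 sg ((-1) ^+ j.2.2 / Num.sqrt (2 ^+ j.2.1)) t j.1 w].
(** [None] stands for the variance draw, so that there are [d + 1] draws per arm and round. *)
Let B3 (j : 'I_T * 'I_K * option 'I_d) : set Omega :=
  if j.2 is Some k then [set w | ~ (`|Z j.1.1.+1 j.1.2 w k 0| <= qmax)]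
  else [set w | ~ (`|xi j.1.1.+1 j.1.2 w| <= qmax)].

Let PB1 : measurable [set w | exists i, B1 i w] /\ (P [set w | exists i, B1 i w] <= (delta / 4)%:E)%E.
Proof.
have mB i : measurable (B1 i).
  apply: measurable_exists_le => t; apply: (measurable_sub_sigma (Fm (t := t))).
  exact: (ad_vec_mart mu sF FS Fx Fr0 Fa Fr FL LA).
have [m PB] := union_bound mB (fun i => noise_norm2_whp sF FS Fx Fr0 Fa Fr FL LA sg0 Fm mr subG1 T i (lt_le_trans ltr01 cQ1)).
split => //; apply: (le_trans PB); rewrite lee_fin card_ord le_eqVlt; apply/orP; left; apply/eqP.
by field; rewrite pnatr_eq0 -lt0n K0 gt_eqF.
Qed.

Let PB2 : measurable [set w | exists j, B2 j w] /\ (P [set w | exists j, B2 j w] <= (delta / 4)%:E)%E.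
Proof.
have mB j : measurable (B2 j).
  apply: measurable_exists_le => t; apply: (measurable_sub_sigma (Fm (t := t))).
  exact: (ad_sq_mart mu s2 sF FS Fx Fr0 Fa Fr).
have [m PB] := union_bound mB (fun j => noise_sq_whp sF FS Fx Fr0 Fa Fr Fm mr subG2 ((-1) ^+ j.2.2 / Num.sqrt (2 ^+ j.2.1)) T j.1 (lt_le_trans ltr01 cX1)).
split => //; apply: (le_trans PB); rewrite lee_fin !card_prod !card_ord card_bool !natrM.
rewrite le_eqVlt; apply/orP; left; apply/eqP.
have : nscale%:R != 0 :> R by rewrite pnatr_eq0.
have : K%:R != 0 :> R by rewrite pnatr_eq0 -lt0n.
by move: (K%:R) (nscale%:R) => k n k0 n0; field; rewrite k0 n0 gt_eqF.
Qed.

Let PB3 : measurable [set w | exists j, B3 j w] /\ (P [set w | exists j, B3 j w] <= (delta / 4)%:E)%E.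
Proof.
have mabs (f : Omega -> R) : measurable_fun setT f -> measurable [set w | ~ (`|f w| <= qmax)].
  move=> mf; have -> : [set w | ~ (`|f w| <= qmax)] = ~` (setT `&` [set w | `|f w| <= qmax]).
    by rewrite setTI.
  by apply: measurableC; apply: measurable_fun_le => //; exact: measurableT_comp.
have mB j : measurable (B3 j).
  by case: j => [[t i] [k|]]; apply: mabs; [exact: mZ|exact: mxi].
have PBj j : (P (B3 j) <= (2 * expR (2^-1 - qmax))%:E)%E.
  case: j => [[t i] [k|]].
    exact: (coord_tail_Z (sF t.+1) (indep (ltn0Sn t))).
  exact: (coord_tail_xi (sF t.+1) (indep (ltn0Sn t))).
have [m PB] := union_bound mB PBj.
split => //; apply: (le_trans PB); rewrite lee_fin !card_prod !card_ord card_option card_ord !natrM.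
set N : R := T%:R * K%:R * d.+1%:R.
have N0 : 0 < N by rewrite !mulr_gt0 ?ltr0n.
have NE : 8 * T%:R * K%:R * d.+1%:R / delta = 8 * N / delta by rewrite /N !mulrA.
have le : expR (2^-1 - qmax) <= delta / (8 * N).
  have dN : 0 < delta / (8 * N) by apply: divr_gt0 => //; exact: mulr_gt0.
  have Nd : 0 < 8 * N / delta by apply: divr_gt0 => //; exact: mulr_gt0.
  rewrite -[leRHS](lnK (x := delta / (8 * N))) ?posrE// ler_expR.
  have -> : ln (delta / (8 * N)) = - ln (8 * N / delta) by rewrite -lnV ?posrE// invf_div.
  rewrite /qmax NE; have := cQ_gt0; have := cX_gt0; lra.
apply: (@le_trans _ _ (N * (2 * (delta / (8 * N))))); first by rewrite !ler_pM2l.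
rewrite le_eqVlt; apply/orP; left; apply/eqP; field.
by rewrite gt_eqF.
Qed.

Lemma regret_whp : exists E : set Omega, measurable E /\ ((1 - delta)%:E <= P E)%E /\
  E `<=` [set w | regret x mu s2 rho a T w <= rbound].
Proof.
have [m1 P1] := PB1; have [m2 P2] := PB2; have [m3 P3] := PB3.
set U1 := [set w | exists i, B1 i w] in m1 P1; set U2 := [set w | exists i, B2 i w] in m2 P2.
set U3 := [set w | exists i, B3 i w] in m3 P3.
have mU12 : measurable (U1 `|` U2) by exact: measurableU.
have mU123 : measurable (U1 `|` U2 `|` U3) by exact: measurableU.
have mU : measurable (U1 `|` U2 `|` U3 `|` B4) by exact: measurableU.
exists (~` (U1 `|` U2 `|` U3 `|` B4)); split; first exact: measurableC.
split.
  have PU : (P (U1 `|` U2 `|` U3 `|` B4) <= delta%:E)%E.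
    have -> : delta = delta / 4 + delta / 4 + delta / 4 + delta / 4 by field.
    rewrite !EFinD; apply: (le_trans (measureU2 _ mU123 mB4)); apply: leeD => //.
    apply: (le_trans (measureU2 _ mU12 m3)); apply: leeD => //.
    by apply: (le_trans (measureU2 _ m1 m2)); apply: leeD.
  rewrite probability_setC// EFinB; apply: leeB => //.
move=> w nU; have [n1 n2 n3 n4] : [/\ ~ U1 w, ~ U2 w, ~ U3 w & ~ B4 w].
  by split=> h; apply: nU; [left; left; left|left; left; right|left; right|right].
have gw (t : 'I_T) : good t.+1 w.
  move=> i; split.
    apply: (noise_norm2_le LA x1 sg0 cQ1 (ltn_ord t)); rewrite ltNge; apply/negP => h.
    by apply: n1; exists i; exists t.+1.
  rewrite /bX; apply: (@noise_sq_le _ _ _ _ _ x r a mu s2 sg _ t.+1 T i w cX1 (ltn_ord t)).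
    exact: Tcount_gt0.
  move=> k b; rewrite ltNge; apply/negP => h.
  by apply: n2; exists (i, (k, b)); exists t.+1.
have zw (t : 'I_T) i k : `|Z t.+1 i w k 0| <= qmax.
  by have [//|/negP h] := boolP (`|Z t.+1 i w k 0| <= qmax); exfalso; apply: n3; exists (t, i, Some k).
have xw (t : 'I_T) i : `|xi t.+1 i w| <= qmax.
  by have [//|/negP h] := boolP (`|xi t.+1 i w| <= qmax); exfalso; apply: n3; exists (t, i, None).
have Yw : Y w <= Mth by apply: ltW; rewrite ltNge; apply/negP.
rewrite /= /regret big_add1 big_mkord.
apply: (@le_trans _ _ (\sum_(t < T) (2 * Wt t.+1 w + wd t.+1 w (a t.+1 w)))).
  by apply: ler_sum => t _; exact: Delta_le.
rewrite big_split/= -mulr_sumr -/(Y w) /rbound [leRHS]mulrDl mul1r; apply: lerD; last exact: sum_wd_le.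
apply: (@le_trans _ _ (2 * Mth)); first by rewrite ler_pM2l.
by rewrite /Mth le_eqVlt; apply/orP; left; apply/eqP; field; rewrite !gt_eqF// popt_gt0.
Qed.

End Assembly.

(** * Asymptotics *)

Section Subpolynomial.
Context {R : realType}.

Definition lam (T : nat) : R := ln T.+2%:R.

Lemma lam_ge0 T : 0 <= lam T.
Proof. by apply: ln_ge0; rewrite ler1n. Qed.

Lemma expR_lam T : expR (lam T) = T.+2%:R.
Proof. by rewrite /lam lnK// posrE. Qed.

(** Growth slower than every positive power of [T]: such factors are absorbed at the price of an
    arbitrarily small exponent. *)
Definition subpoly (f : nat -> R) : Prop :=
  forall g, 0 < g -> exists C, 0 <= C /\ forall T, (0 < T)%N -> f T <= C * expR (g * lam T).

Lemma subpoly_le (f h : nat -> R) : (forall T, (0 < T)%N -> f T <= h T) -> subpoly h -> subpoly f.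
Proof.
move=> fh sh g g0; have [C [C0 hC]] := sh g g0; exists C; split => // T T0.
by apply: le_trans (hC T T0); exact: fh.
Qed.

Lemma subpoly_cst (c : R) : subpoly (fun=> c).
Proof.
move=> g g0; exists `|c|; split => // T _; apply: (le_trans (ler_norm c)).
by rewrite ler_peMr// -expR0 ler_expR mulr_ge0 ?lam_ge0// ltW.
Qed.

Lemma subpoly_lam : subpoly lam.
Proof.
move=> g g0; exists g^-1; split; first by rewrite invr_ge0 ltW.
move=> T _; rewrite mulrC ler_pdivlMr// mulrC; have := expR_ge1Dx (g * lam T).
by apply: le_trans; rewrite lerDr.
Qed.

Lemma subpolyD (f h : nat -> R) : subpoly f -> subpoly h -> subpoly (fun T => f T + h T).
Proof.
move=> sf sh g g0; have [C [C0 hC]] := sf g g0; have [D [D0 hD]] := sh g g0.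
exists (C + D); split; first by rewrite addr_ge0.
by move=> T T0; rewrite mulrDl; apply: lerD; [exact: hC|exact: hD].
Qed.

Lemma subpolyM (f h : nat -> R) : (forall T, (0 < T)%N -> 0 <= f T) ->
  (forall T, (0 < T)%N -> 0 <= h T) -> subpoly f -> subpoly h -> subpoly (fun T => f T * h T).
Proof.
move=> f0 h0 sf sh g g0; have g2 : 0 < g / 2 by rewrite divr_gt0.
have [C [C0 hC]] := sf _ g2; have [D [D0 hD]] := sh _ g2.
exists (C * D); split; first by rewrite mulr_ge0.
move=> T T0; have -> : g * lam T = g / 2 * lam T + g / 2 * lam T by field.
by rewrite expRD mulrACA; apply: ler_pM; [exact: f0|exact: h0|exact: hC|exact: hD].
Qed.

Lemma subpolyZ (c : R) (f : nat -> R) : 0 <= c -> (forall T, (0 < T)%N -> 0 <= f T) ->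
  subpoly f -> subpoly (fun T => c * f T).
Proof. by move=> c0 f0 sf; apply: subpolyM => //; exact: subpoly_cst. Qed.

Lemma sqr_ln_le (g : R) : 0 < g -> exists C, forall y : R, 1 <= y -> ln y ^+ 2 <= C + g * y.
Proof.
(* From [exp t >= (t / 3)^3]: beyond [M] one has [t^2 <= g t^3 / 27], and up to [M] the constant
   [M^2] suffices. *)
move=> g0; pose M := 27 / g; have M0 : 0 < M by rewrite divr_gt0.
exists (M ^+ 2) => y y1; have y0 : 0 < y by exact: lt_le_trans y1.
have t0 := ln_ge0 y1; rewrite -[y in g * y](lnK (x := y)) ?posrE//.
move: (ln y) t0 => t t0.
have [tM|tM] := leP t M.
  apply: (@le_trans _ _ (M ^+ 2)); first by rewrite ler_sqr ?nnegrE// ltW.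
  by rewrite lerDl mulr_ge0 ?expR_ge0// ltW.
have e3 : t ^+ 3 / 27 <= expR t.
  have -> : expR t = expR (t / 3) ^+ 3.
    by rewrite -expRM_natl; congr expR; rewrite mulrC divfK.
  have -> : t ^+ 3 / 27 = (t / 3) ^+ 3 by field.
  apply: lerXn2r; rewrite ?nnegrE ?expR_ge0 ?divr_ge0//.
  by apply: le_trans (expR_ge1Dx _); rewrite lerDr.
have gt : t ^+ 2 <= g * (t ^+ 3 / 27).
  have gM : g * M = 27 by rewrite /M mulrC divfK// gt_eqF.
  have -> : g * (t ^+ 3 / 27) = t ^+ 2 * (g * t / 27) by field.
  rewrite ler_peMr ?sqr_ge0// ler_pdivlMr// mul1r -gM ler_pM2l//.
  exact: ltW.
apply: (le_trans gt); apply: (@le_trans _ _ (g * expR t)); first by rewrite ler_pM2l.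
by rewrite lerDr sqr_ge0.
Qed.

Lemma ln2_ge : 2^-1 <= ln 2 :> R.
Proof.
have := @ln1Dx_ge R 1; rewrite lexx ler01 => /(_ isT).
have -> : 1 + 1 = 2 :> R by [].
by move=> h; lra.
Qed.

Lemma ln4_ge : 1 <= ln 4 :> R.
Proof.
have -> : 4 = 2 ^+ 2 :> R by rewrite expr2; ring.
by rewrite lnXn// mulr2n; have := ln2_ge; lra.
Qed.

Lemma sqrtD1_sqr_le (b : R) : 0 <= b -> (Num.sqrt b + 1) ^+ 2 <= 2 * b + 2.
Proof.
move=> b0; rewrite -[X in 2 * X](sqr_sqrtr b0) -subr_ge0.
have -> : 2 * Num.sqrt b ^+ 2 + 2 - (Num.sqrt b + 1) ^+ 2 = (Num.sqrt b - 1) ^+ 2 by ring.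
exact: sqr_ge0.
Qed.

Lemma nscale_le (T : nat) : (nscale T)%:R <= 1 + 2 * lam T.
Proof.
rewrite /nscale -natr1 addrC lerD2l.
have h : (2 ^ trunc_log 2 T.+1)%:R <= T.+2%:R :> R.
  by rewrite ler_nat (leq_trans (trunc_logP _ _)).
have : ln ((2 ^ trunc_log 2 T.+1)%:R) <= lam T :> R.
  by rewrite /lam ler_ln ?posrE ?ltr0n ?expn_gt0.
rewrite natrX lnXn// -(mulr_natr (ln 2) (trunc_log 2 T.+1)).
have k0 : 0 <= (trunc_log 2 T.+1)%:R :> R by [].
have h2 : 2^-1 * (trunc_log 2 T.+1)%:R <= ln 2 * (trunc_log 2 T.+1)%:R :> R.
  by rewrite ler_wpM2r// ln2_ge.
by move=> h3; have := le_trans h2 h3; rewrite ler_pdivrMl.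
Qed.

End Subpolynomial.

(** * Growth of the regret bound with the horizon *)

Section Growth.
Context {R : realType} {d K : nat}.
Variables (sg rho eps delta : R).
Hypothesis sg0 : 0 < sg.
Hypothesis rho0 : 0 < rho.
Hypothesis eps0 : 0 < eps.
Hypothesis delta01 : 0 < delta < 1.
Hypothesis d_gt0 : (0 < d)%N.
Hypothesis K0 : (0 < K)%N.

Let d0 : 0 < delta. Proof. by case/andP: delta01. Qed.
Let d1 : delta < 1. Proof. by case/andP: delta01. Qed.
Let KR : 1 <= K%:R :> R. Proof. by rewrite ler1n. Qed.
Let dR : 0 < d%:R :> R. Proof. by rewrite ltr0n. Qed.

Let ln4K : 1 <= ln (4 * K%:R / delta).
Proof.
have h : 4 <= 4 * K%:R / delta.
  rewrite ler_pdivlMr//; apply: (@le_trans _ _ 4); last by rewrite ler_peMr.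
  by rewrite ler_piMr// ltW.
apply: le_trans ln4_ge _; rewrite ler_ln ?posrE//.
exact: lt_le_trans h.
Qed.

Lemma vpar_gt0 : 0 < vpar sg eps delta d K.
Proof.
rewrite mulr_gt0// sqrtr_gt0 !mulr_gt0 ?invr_gt0//.
exact: lt_le_trans ln4K.
Qed.

Lemma upar_gt0 : 0 < upar sg eps delta d K.
Proof.
rewrite !mulr_gt0 ?exprn_gt0 ?sqrtr_gt0 ?mul1r ?invr_gt0//.
exact: lt_le_trans ln4K.
Qed.

Let v0 := vpar_gt0.
Let u0 := upar_gt0.
Let ld T : R := @logdet R d T.
Let bq T : R := @bQ R d K sg delta T.
Let bx T : R := @bX R K sg delta T.
Let cq T : R := @cQ R d K sg eps delta T.
Let cx T : R := @cX R d K sg eps delta T.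

Lemma logdetE T : ld T = ln (d`!%:R) + d%:R * lam T.
Proof. by rewrite /ld /logdet lnM ?posrE ?ltr0n ?fact_gt0 ?exprn_gt0// lnXn// mulr_natl. Qed.

Lemma subpoly_logdet : subpoly ld.
Proof.
apply: (@subpoly_le _ _ (fun T => ln (d`!%:R) + d%:R * lam T)).
  by move=> T _; rewrite logdetE.
apply: subpolyD; first exact: subpoly_cst.
by apply: subpolyZ => //; [move=> T _; exact: lam_ge0|exact: subpoly_lam].
Qed.

Lemma subpoly_bQ : subpoly bq.
Proof.
apply: subpolyZ; first by rewrite mulr_ge0 ?sqr_ge0.
  move=> T _; rewrite addr_ge0 ?divr_ge0 ?logdet_ge0//.
  exact: le_trans ln4K.
apply: subpolyD; first exact: subpoly_cst.
apply: (@subpoly_le _ _ (fun T => 2^-1 * ld T)); first by move=> T _; rewrite mulrC.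
by apply: subpolyZ => //; [move=> T _; exact: logdet_ge0|exact: subpoly_logdet].
Qed.

Let nsc1 T : 1 <= (nscale T)%:R :> R. Proof. by rewrite ler1n. Qed.
Let A : R := ln (8 * K%:R / delta) + sg ^+ 2.

Lemma bX_E T : bx T = ln (nscale T)%:R + A.
Proof.
rewrite /bx /bX /A addrA; congr (_ + _).
have -> : 8 * K%:R * (nscale T)%:R / delta = (nscale T)%:R * (8 * K%:R / delta) by rewrite mulrC !mulrA; ring.
by rewrite lnM// posrE ?divr_gt0 ?mulr_gt0// (lt_le_trans ltr01).
Qed.

Let ln_nsc_sq (g : R) : 0 < g -> exists C, forall T, ln (nscale T)%:R ^+ 2 <= C + g * lam T.
Proof.
move=> g0; have g2 : 0 < g / 2 by rewrite divr_gt0.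
have [C hC] := sqr_ln_le g2; exists (C + g / 2) => T; apply: (le_trans (hC _ (nsc1 T))).
have h : g / 2 * (nscale T)%:R <= g / 2 * (1 + 2 * lam T) by rewrite ler_pM2l// nscale_le.
by move: h; move: (lam T) ((nscale T)%:R) => l n h; lra.
Qed.

(** [u] does not depend on [T], and [bX] grows like the logarithm of the number of scales, so the
    square is of order [(ln ln T)^2]. *)
Lemma cX_sq_small (g : R) : 0 < g -> exists C, forall T, (0 < T)%N -> cx T ^+ 2 <= C + g * lam T.
Proof.
move=> g0; pose u := upar sg eps delta d K.
have gu : 0 < g * u ^+ 2 / 2 by rewrite divr_gt0// mulr_gt0// exprn_gt0.
have [C hC] := ln_nsc_sq gu; exists ((2 * (1 + A) ^+ 2 + 2 * C) / u ^+ 2) => T _.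
rewrite /cx /cX -/(bx T) bX_E expr_div_n ler_pdivrMr ?exprn_gt0//.
have un : u ^+ 2 != 0 by rewrite gt_eqF// exprn_gt0.
rewrite mulrDl divfK//.
have := hC T; have := sqr_ge0 (ln (nscale T)%:R - (1 + A)).
by move: (ln _) (lam T) (u ^+ 2) => l lm uu; nra.
Qed.

(** Here the size of [v] matters: [2 bQ] grows like [2 sg^2 d ln T], while [v^2] is at least
    [4 sg^2 d / eps] because [ln (4 K / delta) >= 1]. *)
Lemma cQ_sq_le : exists C, forall T, (0 < T)%N -> cq T ^+ 2 <= C + eps / 2 * lam T.
Proof.
pose v := vpar sg eps delta d K.
exists ((2 * (2 * sg ^+ 2 * (ln (4 * K%:R / delta) + ln (d`!%:R) / 2)) + 2) / v ^+ 2) => T T0.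
rewrite /cq /cQ -/(bq T) expr_div_n ler_pdivrMr ?exprn_gt0//.
have vn : v ^+ 2 != 0 by rewrite gt_eqF// exprn_gt0.
rewrite mulrDl divfK//.
have b0 : 0 <= bq T by exact: bQ_ge0.
have h1 := sqrtD1_sqr_le b0.
apply: (le_trans h1).
rewrite /bq /bQ -/(ld T) logdetE.
have vE : v ^+ 2 = sg ^+ 2 * (4 / eps * d%:R * ln (4 * K%:R / delta)).
  rewrite /v /vpar exprMn sqr_sqrtr// !mulr_ge0 ?invr_ge0 ?ltW//.
  exact: lt_le_trans ln4K.
rewrite vE.
have -> : eps / 2 * lam T * (sg ^+ 2 * (4 / eps * d%:R * ln (4 * K%:R / delta))) =
   2 * sg ^+ 2 * (d%:R * lam T) * ln (4 * K%:R / delta) by field; rewrite gt_eqF.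
have : 2 * sg ^+ 2 * (d%:R * lam T) * 1 <= 2 * sg ^+ 2 * (d%:R * lam T) * ln (4 * K%:R / delta).
  apply: ler_wpM2l; last exact: ln4K.
  by apply: mulr_ge0; rewrite mulr_ge0 ?sqr_ge0 ?lam_ge0.
by move: (2 * sg ^+ 2) (d%:R * lam T) (ln (4 * K%:R / delta)) (ln d`!%:R : R) => a b c e; lra.
Qed.

Let cQ0 T : 0 < cq T. Proof. exact: cQ_gt0. Qed.
Let cX0 T : 0 < cx T. Proof. exact: cX_gt0. Qed.
Let bQ0 T : 0 <= bq T. Proof. exact: bQ_ge0. Qed.
Let bX0 T : 0 <= bx T. Proof. exact: bX_ge0. Qed.

Lemma subpoly_sqrt (f : nat -> R) : (forall T, 0 <= f T) -> subpoly f -> subpoly (fun T => Num.sqrt (f T)).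
Proof.
move=> f0 sf; apply: (@subpoly_le _ _ (fun T => 1 + f T)).
  move=> T _; have := sqrtD1_sqr_le (f0 T); rewrite sqrrD mulr1 sqr_sqrtr//.
  have := f0 T; move: (f T) (Num.sqrt (f T)) => b z; lra.
by apply: subpolyD => //; exact: subpoly_cst.
Qed.

Lemma subpoly_lt_sq (f : nat -> R) (C g : R) : 0 <= g -> (forall T, (0 < T)%N -> f T ^+ 2 <= C + g * lam T) -> subpoly f.
Proof.
move=> g0 h; apply: (@subpoly_le _ _ (fun T => (1 + C) + g * lam T)).
  move=> T T0; have := h T T0; have := sqr_ge0 (f T - 1).
  by rewrite sqrrB; move: (f T) => z; nra.
apply: subpolyD; first exact: subpoly_cst.
by apply: subpolyZ => //; [move=> T _; exact: lam_ge0|exact: subpoly_lam].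
Qed.

Lemma subpoly_cQ : subpoly cq.
Proof. by have [C h] := cQ_sq_le; apply: subpoly_lt_sq h; rewrite divr_ge0// ltW. Qed.

Lemma subpoly_cX : subpoly cx.
Proof. by have [C h] := cX_sq_small ltr01; apply: subpoly_lt_sq h. Qed.

Lemma subpoly_bX : subpoly bx.
Proof.
have u0' := ltW u0.
apply: (@subpoly_le _ _ (fun T => upar sg eps delta d K * cx T)).
  by move=> T _; rewrite /cx /cX mulrC divfK ?gt_eqF// lerDr.
by apply: subpolyZ => //; [move=> T _; exact: ltW (cX0 T)|exact: subpoly_cX].
Qed.

Let qm T : R := @qmax R d K sg eps delta T.
Let g1_ T : R := @g1 R d K sg eps delta T.
Let g2_ T : R := @g2 R d K sg rho eps delta T.
Let qm0 T : (0 < T)%N -> 0 <= qm T.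
Proof. by move=> T0; apply: (le_trans ler01); exact: qmax_ge1. Qed.

Lemma subpoly_qmax : subpoly qm.
Proof.
apply: (@subpoly_le _ _ (fun T => cq T + cx T + 3 + (ln (8 * K%:R * d.+1%:R / delta) + lam T))).
  move=> T T0; rewrite /qm /qmax lerD2l.
  have p0 : 0 < 8 * K%:R * d.+1%:R / delta :> R.
    by rewrite divr_gt0// !mulr_gt0// (lt_le_trans ltr01).
  rewrite /lam -lnM ?posrE// ler_ln ?posrE; last 2 first.
  - by rewrite divr_gt0// !mulr_gt0 ?ltr0n.
  - exact: mulr_gt0.
  have -> : 8 * T%:R * K%:R * d.+1%:R / delta = (8 * K%:R * d.+1%:R / delta) * T%:R :> R by ring.
  by rewrite ler_pM2l// ler_nat -addn2 leq_addr.
do !apply: subpolyD; try exact: subpoly_cst.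
- exact: subpoly_cQ.
- exact: subpoly_cX.
- exact: subpoly_lam.
Qed.

Lemma subpoly_g1 : subpoly g1_.
Proof.
apply: subpolyD.
  apply: subpolyD; last exact: subpoly_cst.
  by apply: subpoly_sqrt => //; exact: subpoly_bQ.
apply: subpolyZ; first exact: ltW.
  by move=> T T0; rewrite mulr_ge0 ?sqrtr_ge0// qm0.
by apply: subpolyZ; [exact: sqrtr_ge0|exact: qm0|exact: subpoly_qmax].
Qed.

Lemma subpoly_g2 : subpoly g2_.
Proof.
apply: (@subpoly_le _ _ (fun T => rho * (1 + bx T + (2 * bq T + 2) + upar sg eps delta d K * qm T))).
  move=> T T0; rewrite /g2_ /g2 ler_pM2l// lerD2r lerD2l.
  exact: sqrtD1_sqr_le (bQ0 T).
apply: subpolyZ; first exact: ltW.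
  move=> T T0; have := bX0 T; have := bQ0 T; have : 0 <= upar sg eps delta d K * qm T.
    by rewrite mulr_ge0 ?qm0// ltW.
  lra.
apply: subpolyD.
  apply: subpolyD; first by apply: subpolyD; [exact: subpoly_cst|exact: subpoly_bX].
  by apply: subpolyD; [apply: subpolyZ => //; exact: subpoly_bQ|exact: subpoly_cst].
by apply: subpolyZ; [exact: ltW|exact: qm0|exact: subpoly_qmax].
Qed.

Let g10 T : (0 < T)%N -> 0 <= g1_ T. Proof. by move=> T0; exact: g1_ge0. Qed.
Let g20 T : (0 < T)%N -> 0 <= g2_ T. Proof. by move=> T0; apply: ltW; exact: g2_gt0. Qed.

Let wfac T : R := g1_ T * (K%:R * ld T + 1) + g2_ T * (3 * K%:R).

Lemma subpoly_wfac : subpoly wfac.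
Proof.
have KR0 : 0 <= K%:R :> R by [].
have l0 T : (0 < T)%N -> 0 <= K%:R * ld T + 1.
  by move=> _; rewrite addr_ge0 ?mulr_ge0 ?logdet_ge0.
apply: subpolyD.
  apply: subpolyM => //; first exact: subpoly_g1.
  apply: subpolyD; last exact: subpoly_cst.
  by apply: subpolyZ => //; [move=> T _; exact: logdet_ge0|exact: subpoly_logdet].
by apply: subpolyM => //; [exact: subpoly_g2|exact: subpoly_cst].
Qed.

Lemma wtot_le T : (0 < T)%N -> @wtot R d K sg rho eps delta T <= wfac T * expR (2^-1 * lam T).
Proof.
move=> T0; have -> : expR (2^-1 * lam T) = Num.sqrt T.+2%:R :> R.
  rewrite -(@expR_lam R T).
  have lE : @lam R T = 2^-1 * lam T + 2^-1 * lam T by field.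
  by rewrite [X in Num.sqrt (expR X)]lE expRD -expr2 sqrtr_sqr ger0_norm// expR_ge0.
have s1 : Num.sqrt T%:R <= Num.sqrt T.+2%:R :> R by rewrite ler_wsqrtr// ler_nat -addn2 leq_addr.
have s2 : Num.sqrt T.+1%:R <= Num.sqrt T.+2%:R :> R by rewrite ler_wsqrtr// ler_nat.
have l0 : 0 <= K%:R * ld T + 1 by rewrite addr_ge0 ?mulr_ge0 ?logdet_ge0.
rewrite /wtot /wfac [leRHS]mulrDl; apply: lerD; rewrite -[leRHS]mulrA; apply: ler_wpM2l.
- exact: g10.
- by rewrite mulrC ler_wpM2l.
- exact: g20.
- by rewrite ler_wpM2l// mulr_ge0.
Qed.

(** Budget of exponents: [eps / 2] from [cQ], [eps / 8] from [cX] and [eps / 8] from the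
    subpolynomial factors, on top of the 1/2 of [sqrt T]. A reserve of [eps / 4] below the target
    remains. *)
Lemma rbound_le : exists C, 0 <= C /\ forall T, (0 < T)%N ->
  @rbound R d K sg rho eps delta T <= C * expR ((2^-1 + 3 / 4 * eps) * lam T).
Proof.
have e8 : 0 < eps / 8 by rewrite divr_gt0.
have [C1 [C10 hw]] := subpoly_wfac e8.
have [C2 hX] := cX_sq_small e8; have [C3 hQ] := cQ_sq_le.
have k0 : 0 < (kap ^+ (d.+1 * K))^-1 :> R by rewrite invr_gt0 exprn_gt0// kap_gt0.
pose D := 8 / delta * (kap ^+ (d.+1 * K))^-1 * expR (C2 + C3).
have D0 : 0 <= D.
  apply: mulr_ge0; last exact: expR_ge0.
  by apply: mulr_ge0; [rewrite divr_ge0// ltW|exact: ltW].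
exists ((D + 1) * C1); split; first by rewrite mulr_ge0// addr_ge0.
move=> T T0; have l0 := @lam_ge0 R T.
have w0 : 0 <= @wtot R d K sg rho eps delta T by apply: ltW; exact: wtot_gt0.
have hp : 8 / (@popt R d K sg eps delta T * delta) + 1 <= (D + 1) * expR (5 / 8 * eps * lam T).
  rewrite [leRHS]mulrDl mul1r; apply: lerD; last first.
    by rewrite -expR0 ler_expR !mulr_ge0// ltW.
  have -> : 8 / (@popt R d K sg eps delta T * delta) =
      8 / delta * (kap ^+ (d.+1 * K))^-1 * expR (cq T ^+ 2 + cx T ^+ 2).
    rewrite /popt -/(cq T) -/(cx T) expRN !invfM invrK; ring.
  rewrite /D -[leRHS]mulrA; apply: ler_wpM2l.
    by apply: mulr_ge0; [rewrite divr_ge0// ltW|exact: ltW].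
  rewrite -expRD ler_expR; have := hX T T0; have := hQ T T0.
  by move: (cq T ^+ 2) (cx T ^+ 2) (lam T) => a b c; lra.
have hw' : @wtot R d K sg rho eps delta T <= C1 * expR ((eps / 8 + 2^-1) * lam T).
  apply: (le_trans (wtot_le T0)); rewrite [(eps / 8 + _) * _]mulrDl expRD mulrA.
  by rewrite ler_wpM2r ?expR_ge0// hw.
rewrite /rbound.
apply: (@le_trans _ _ (((D + 1) * expR (5 / 8 * eps * lam T)) * (C1 * expR ((eps / 8 + 2^-1) * lam T)))).
  apply: ler_pM => //; rewrite addr_ge0// divr_ge0// mulr_ge0 ?(ltW d0)//.
  by apply: ltW; exact: popt_gt0.
rewrite mulrACA -expRD le_eqVlt; apply/orP; left; apply/eqP; congr (_ * expR _); by field.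
Qed.

Lemma rbound_eventually (c : R) : 0 < c -> exists T0 : nat, forall T, (T0 <= T)%N -> (0 < T)%N /\
  @rbound R d K sg rho eps delta T <= c * (ln T%:R * Num.sqrt (T%:R `^ (1 + 2 * eps))).
Proof.
move=> c0; have [C [C0 hC]] := rbound_le.
pose al := 2^-1 + 3 / 4 * eps; have al0 : 0 <= al by rewrite addr_ge0// mulr_ge0// ltW.
pose C' := C * expR (al * 2); have C'0 : 0 <= C' by rewrite mulr_ge0 ?expR_ge0.
(* From [ln T = M] on, the spare power [T^(eps / 4)] exceeds [C' / c]. The summand 1 ensures
   [ln T >= 1], which is all that the factor [ln T] of the target contributes. *)
pose M := 1 + 4 * C' / (eps * c).
have M0 : 0 <= M by rewrite addr_ge0// divr_ge0 ?mulr_ge0// ltW.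
exists (Num.bound (expR M)) => T hT.
have TM : expR M <= T%:R.
  apply: (@le_trans _ _ (Num.bound (expR M))%:R); last by rewrite ler_nat.
  by apply: ltW; apply: archi_boundP; exact: expR_ge0.
have T1 : 1 <= T%:R :> R by apply: le_trans TM; rewrite -expR0 ler_expR.
have Tp : (0 < T)%N by rewrite -(ler1n R).
have T0 : 0 < T%:R :> R by rewrite ltr0n.
have lT : M <= ln T%:R by rewrite -ler_expR lnK ?posrE.
split => //; apply: (le_trans (hC T Tp)).
have lamT : @lam R T <= ln T%:R + 2.
  rewrite -ler_expR expR_lam expRD lnK ?posrE//.
  have e2 : 3 <= expR 2 :> R by apply: le_trans (expR_ge1Dx 2); lra.
  have : T.+2%:R = T%:R + 2 :> R by rewrite -addn2 natrD.
  by move: (expR 2) (T%:R) (T.+2%:R) e2 T1 => e t t2 e2 t1 ->; nra.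
have -> : Num.sqrt (T%:R `^ (1 + 2 * eps)) = expR ((2^-1 + eps) * ln T%:R).
  rewrite /powR gt_eqF// (_ : (1 + 2 * eps) * ln T%:R = (2^-1 + eps) * ln T%:R + (2^-1 + eps) * ln T%:R); last by field.
  by rewrite expRD -expr2 sqrtr_sqr ger0_norm// expR_ge0.
have l1 : 1 <= ln T%:R :> R by apply: le_trans lT; rewrite /M lerDl divr_ge0 ?mulr_ge0// ltW.
apply: (@le_trans _ _ (C' * expR (al * ln T%:R))).
  rewrite /C' -[leRHS]mulrA -expRD; apply: ler_wpM2l => //; rewrite ler_expR -/al -mulrDr.
  by apply: ler_wpM2l => //; rewrite addrC.
have key : C' <= c * expR (eps / 4 * ln T%:R).
  have h := expR_ge1Dx (eps / 4 * ln T%:R).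
  have h2 : c * (eps / 4 * ln T%:R) <= c * expR (eps / 4 * ln T%:R).
    by rewrite ler_pM2l//; apply: le_trans h; rewrite lerDr.
  apply: le_trans h2; have : c * (eps / 4 * M) <= c * (eps / 4 * ln T%:R).
    by rewrite !ler_pM2l// divr_gt0.
  apply: le_trans; rewrite /M.
  have -> : c * (eps / 4 * (1 + 4 * C' / (eps * c))) = c * (eps / 4) + C'.
    by field; rewrite !gt_eqF.
  by rewrite lerDr mulr_ge0 ?divr_ge0// ltW.
apply: (@le_trans _ _ (c * expR (eps / 4 * ln T%:R) * expR (al * ln T%:R))).
  by rewrite ler_wpM2r ?expR_ge0.
rewrite -mulrA -expRD ler_pM2l// -mulrDl.
have -> : eps / 4 + al = 2^-1 + eps by rewrite /al; field.
by rewrite ler_peMl ?expR_ge0.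
Qed.

End Growth.

Unset Implicit Arguments.

Theorem theorem1 (R : realType) (Rsg : R) (hRsg : 0 < Rsg) :
  exists Cst : R, 0 < Cst /\
  forall (eps delta rho : R) (d K : nat),
    0 < eps -> eps < 1 / 2 -> 0 < delta -> delta < 1 -> 0 < rho ->
    (0 < d)%N -> (0 < K)%N ->
    exists T0 : nat, forall T : nat, (T0 <= T)%N ->
    forall (dO : measure_display) (Omega : measurableType dO)
           (P : probability Omega R)
           (F : nat -> set (set Omega))
           (x : nat -> 'I_K -> Omega -> 'cV[R]_d) (r : nat -> 'I_K -> Omega -> R)
           (mu : 'I_K -> 'cV[R]_d) (s2 : 'I_K -> R) (a : nat -> Omega -> 'I_K)
           (Z : nat -> 'I_K -> Omega -> 'cV[R]_d) (xi : nat -> 'I_K -> Omega -> R)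
           (L : nat -> 'I_K -> Omega -> 'M[R]_d),
    mvts_dn_setting P Rsg rho eps delta F x r mu s2 a Z xi L ->
    exists E : set Omega, measurable E /\ ((1 - delta)%:E <= P E)%E /\
      E `<=` [set w | regret x mu s2 rho a T w <=
        Cst * ((1 + rho + rho^-1) * d%:R * ln T%:R * ln (K%:R / delta)
               * Num.sqrt (d%:R * K%:R * (T%:R `^ (1 + 2 * eps))
                           * ln (K%:R / delta) / eps))].
Proof.
exists 1; split => // eps delta rho d K eps0 _ delta0 delta1 rho0 d0 K0.
have delta01 : 0 < delta < 1 by rewrite delta0.
have dR : 0 < d%:R :> R by rewrite ltr0n.
have KR : 0 < K%:R :> R by rewrite ltr0n.
have lnK0 : 0 < ln (K%:R / delta).
  by rewrite ln_gt0// ltr_pdivlMr// mul1r (lt_le_trans delta1)// ler1n.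
pose b := d%:R * K%:R * ln (K%:R / delta) / eps.
have b0 : 0 < b by rewrite divr_gt0// !mulr_gt0.
(* The factors free of [T] are gathered in [c], of which only positivity is used: [T0] may depend on
   all the parameters, though not on the probability space or the instance. *)
pose c := (1 + rho + rho^-1) * d%:R * ln (K%:R / delta) * Num.sqrt b.
have c0 : 0 < c.
  by rewrite !mulr_gt0 ?sqrtr_gt0// !addr_gt0// invr_gt0.
have [T0 hT0] := rbound_eventually hRsg rho0 eps0 delta01 d0 K0 c0.
exists T0 => T /hT0[Tp hT] dO Omega P F x r mu s2 a Z xi L setting.
have [E [mE [PE Er]]] := regret_whp hRsg rho0 delta01 K0 Tp
  (vpar_gt0 hRsg eps0 delta01 d0 K0) (upar_gt0 hRsg eps0 delta01 d0 K0) setting.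
exists E; split => //; split => // w /Er /= rw; apply: (le_trans rw); apply: (le_trans hT).
rewrite mul1r le_eqVlt; apply/orP; left; apply/eqP.
have -> : d%:R * K%:R * (T%:R `^ (1 + 2 * eps)) * ln (K%:R / delta) / eps = b * T%:R `^ (1 + 2 * eps).
  by rewrite /b; ring.
by rewrite sqrtrM ?(ltW b0)// /c; ring.
Qed.
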